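(* Let $S\subset\mathbb{C}$ be an open horizontal strip and let $u$ be a logarithmic subharmonic function in $S$. Then $\log u\in WAP(S)$ if and only if $u\in WAP(S)$.
   Context: Write $z=x+iy$. An open horizontal strip is a set $S=\{z\in\mathbb{C}: a<\mathrm{Im}\,z<b\}$ with $-\infty\le a<b\le+\infty$. Subharmonic functions are assumed not identically $-\infty$; they are locally integrable and hence are regarded as distributions. A function $u\ge0$ is called logarithmic subharmonic in a domain $G\subset\mathbb{C}$ if $\log u$ is subharmonic in $G$ (with $\log 0=-\infty$); such a $u$ is itself subharmonic. $D(S)$ denotes the space of test functions (smooth, compactly supported in $S$). Uniformly almost periodic (Bohr) function on the real axis: a continuous function $g$ on $\mathbb{R}$ such that from any sequence $\{t_n\}\subset\mathbb{R}$ one can choose a subsequence $\{t_{n'}\}$ for which the functions $g(t+t_{n'})$ converge uniformly on $\mathbb{R}$. $WAP(S)$ (subharmonic almost periodic functions): the class of subharmonic functions $v$ in $S$ such that for every test function $\varphi\in D(S)$ the function $t\mapsto\int v(z)\varphi(z-t)\,dx\,dy$, $t\in\mathbb{R}$, is uniformly almost periodic on the real axis. *)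

(* Defs.v *)
From HB Require Import structures.
From mathcomp Require Import all_boot all_order all_algebra.
From mathcomp Require Import all_classical all_reals all_analysis.

Set Implicit Arguments.
Unset Strict Implicit.
Unset Printing Implicit Defensive.

Import Order.TTheory GRing.Theory Num.Theory.
Import numFieldNormedType.Exports.

Local Open Scope classical_set_scope.
Local Open Scope ring_scope.
Local Open Scope ereal_scope.

(* The complex plane is [R * R]: the point x + iy is the pair (x, y), and
   dx dy is the product Lebesgue measure.  A function on an open set G is a
   total function on [R * R] whose values outside G are never used. *)

Section Plane.
Context {R : realType}.
Implicit Types (G S : set (R * R)) (z w : R * R).

Definition strip (a b : \bar R) : set (R * R) :=
  [set z | a < z.2%:E /\ z.2%:E < b].

Definition closed_disc z (r : R) : set (R * R) :=
  [set w | ((w.1 - z.1) ^+ 2 + (w.2 - z.2) ^+ 2 <= r ^+ 2)%R].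

(* Mean over the circle of centre z and radius r.  For an upper semicontinuous
   v < +oo the positive part of the integrand is bounded, so the integral is
   well defined in [-oo, +oo[. *)
Definition circle_mean (v : R * R -> \bar R) z (r : R) : \bar R :=
  ((2 * pi)^-1)%:E *
  \int[@lebesgue_measure R]_(t in `[0%R, (2 * pi)%R])
    v (z.1 + r * cos t, z.2 + r * sin t)%R.

Definition upper_semicontinuous_on G (v : R * R -> \bar R) : Prop :=
  forall z, G z -> forall c : R, v z < c%:E ->
    \forall w \near z, v w < c%:E.

(* Meant for G open and connected: "not identically -oo" is asked for on the
   whole of G, not on each component. *)
Definition subharmonic G (v : R * R -> \bar R) : Prop :=
  [/\ forall z, G z -> v z < +oo,
      exists2 z, G z & v z != -oo,
      upper_semicontinuous_on G v &
      forall z (r : R), (0 < r)%R -> closed_disc z r `<=` G ->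
        v z <= circle_mean v z r].

(* [lne] is -oo on the whole of ]-oo, 0], so nonnegativity is a separate
   condition. *)
Definition log_subharmonic G (u : R * R -> R) : Prop :=
  (forall z, G z -> (0 <= u z)%R) /\
  subharmonic G (fun z => lne (u z)%:E).

Fixpoint Ck (k : nat) (f : R * R -> R) : Prop :=
  if k is k'.+1 then
    [/\ forall z, derivable f z (1%R, 0%R),
        forall z, derivable f z (0%R, 1%R),
        Ck k' ('D_(1%R, 0%R) f) &
        Ck k' ('D_(0%R, 1%R) f)]
  else continuous f.

Definition smooth (f : R * R -> R) : Prop := forall k, Ck k f.

(* Elements of D(S), real-valued and extended by zero to the whole plane. *)
Definition test_function S (phi : R * R -> R) : Prop :=
  [/\ smooth phi,
      compact (closure [set z | phi z != 0%R]) &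
      closure [set z | phi z != 0%R] `<=` S].

Definition bohr_almost_periodic (g : R -> R) : Prop :=
  continuous g /\
  forall t : nat -> R, exists2 n : nat -> nat, increasing_seq n &
    exists h : R -> R,
      {uniform, (fun k x => g (x + t (n k))%R) @ \oo --> h}.

(* For t real, z |-> phi (z - t) is again supported in the strip S.  The
   integral is finite, v being locally integrable, so [fine] loses nothing. *)
Definition translate_pairing S (v : R * R -> \bar R) (phi : R * R -> R)
    (t : R) : R :=
  fine (\int[(@lebesgue_measure R \x @lebesgue_measure R)%E]_(z in S)
          (v z * (phi (z.1 - t, z.2)%R)%:E)).

Definition WAP S (v : R * R -> \bar R) : Prop :=
  subharmonic S v /\
  forall phi, test_function S phi ->
    bohr_almost_periodic (translate_pairing S v phi).

End Plane.

(* Main.v *)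
From HB Require Import structures.
From mathcomp Require Import all_boot all_order all_algebra.
From mathcomp Require Import all_classical all_reals all_analysis.
From mathcomp Require Import measurable_realfun.
From mathcomp Require Import ring lra.
Require Import Defs.

(** Put [v = log u].  Almost periodicity only concerns means against test
    functions, and neither the exponential nor the logarithm commutes with means.
    So both implications pass through mollifications.  Let [V] be the mean of [v]
    against a smooth radial density supported in a disc of radius [d].  Each value
    of [V] is a pairing of [v] with a test function, so [V], unlike [v], inherits
    almost periodicity in the uniform norm; and [v <= V] by subharmonicity.

    If [log u] is almost periodic, [u] is approximated by [exp V].  If [u] is almost
    periodic and [U] is its mollification, [log u] is approximated by
    [log (max U c)], where [c] is a positive lower bound for [exp V].  On bounded
    ranges [exp], and [log] on [c, +oo[, are Lipschitz, so these approximants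
    are almost periodic too ([mollify_coloured]).  The errors are bounded
    pointwise by multiples of [V - v] and [U - u] ([exp_approx], [ln_approx]).
    Therefore it suffices that [V - v] and [U - u] have small integral over every
    translate of a fixed box, uniformly in the translate
    ([uniform_mollification]); almost periodicity then passes to the limit
    ([totally_ap_approx], [WAP_of_approx]).

    Let [M] bound [v] from above.  Averaging moves the nonnegative superharmonic
    function [w = M - v], in the mean, by at most [d] times a Lipschitz constant of a cutoff
    times the mass of [w] ([integral_sub_average]).  By Harnack's inequality
    ([harnack_box]) that mass is controlled by one value of [w] in the box,
    hence uniformly in the translate provided that
    - [v] is bounded above on closed substrips ([WAP_upper_bound]).  The pairing
      with one test function is bounded, being almost periodic; a bound that is
      uniform in the height of the test function comes from a gliding hump
      argument in which the sum of the humps is itself a test function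
      ([gliding_hump], [bumpfun_superpose]);
    - every translate of some box contains a point where [v] is not very negative
      ([recurrent_lower]).  When [log u] is almost periodic, its bounded
      pairings give such points ([mollify_point]).  When [u] is almost periodic, a
      positive value of [U] recurs at bounded distances
      ([log_recurrent_of_WAP]).

    Throughout, Bohr almost periodicity is used in the form of total boundedness
    of the set of translates ([bohr_totally_ap], [totally_ap_bohr]). *)

Set Implicit Arguments.
Unset Strict Implicit.
Unset Printing Implicit Defensive.

Import Order.TTheory GRing.Theory Num.Theory.
Import numFieldNormedType.Exports.

Local Open Scope classical_set_scope.
Local Open Scope ring_scope.
Local Open Scope ereal_scope.

(** * Translations and rotations of planar Lebesgue measure *)

Section Invariance.
Context {R : realType}.
Local Notation mu := (@lebesgue_measure R).
Local Notation mu2 := (@lebesgue_measure R \x @lebesgue_measure R)%E.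
Local Notation mR := (measurableTypeR R).
Local Notation mR2 := (mR * mR)%type.

Let plane_sigma_finite : sigma_finite setT mu2.
Proof.
have /sigma_finiteP[F [TF ndF Foo]] := sigma_finiteT mu.
exists (fun n => F n `*` F n).
  rewrite -setXTT TF predeqE => -[x y]; split.
    move=> [/= [n _ Fnx] [k _ Fky]]; exists (maxn n k) => //; split.
    - by move: x Fnx; exact/subsetPset/ndF/leq_maxl.
    - by move: y Fky; exact/subsetPset/ndF/leq_maxr.
  by move=> [n _ []/= ? ?]; split; exists n.
move=> k; have [? ?] := Foo k.
split; first exact: measurableX.
by rewrite product_measure1E// lte_mul_pinfty// ge0_fin_numE.
Qed.

(** Bundled form of planar Lebesgue measure, for Tonelli's theorem in which
    the plane itself is one of the two factors. *)
Definition plane_measure : {sigma_finite_measure set mR2 -> \bar R} :=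
  HB.pack mu2 (Measure_isSigmaFinite.Build _ _ _ mu2 plane_sigma_finite).

Lemma lebesgue_measureD (a : R) (A : set mR) : measurable A ->
  pushforward mu ((fun x => x + a)%R : mR -> mR) A = mu A.
Proof.
move=> mA; have mphi : measurable_fun setT ((fun x => x + a)%R : mR -> mR).
  exact: measurable_funD.
pose mphi_mixin := isMeasurableFun.Build _ _ _ _ _ mphi.
pose phi : {mfun mR >-> mR} := HB.pack ((fun x => x + a)%R : mR -> mR) mphi_mixin.
apply/esym.
apply: (@lebesgue_measure_unique _ (pushforward mu phi)) => //= _ [[x y]] _ <-.
rewrite /pushforward.
rewrite [X in _ = lebesgue_measure X](_ : _ = `]x - a, y - a]%classic)%R; last first.
  by apply/seteqP; split => z /=; rewrite !in_itv/= ltrBlDr lerBrDr.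
rewrite !lebesgue_measure_itv/= !lte_fin ltrD2r.
by case: ifP => // _; congr (_%:E); ring.
Qed.

Lemma ge0_integralD_shift (a : R) (f : R -> \bar R) :
  measurable_fun (setT : set mR) f -> (forall x, 0 <= f x) ->
  \int[mu]_x f (x + a)%R = \int[mu]_x f x.
Proof.
move=> mf f0.
transitivity (\int[pushforward mu ((fun x => x + a)%R : mR -> mR)]_x f x).
  rewrite ge0_integral_pushforward//=.
  exact: measurable_funD.
apply: eq_measure_integral => [|mphi A mA _].
  exact: measurable_funD.
exact: lebesgue_measureD.
Qed.

(** Shears generate the translations and the rotations needed below; their
    invariance follows from Tonelli's theorem and invariance on the line. *)
Lemma ge0_integral_shear1 (g : R -> R) (f : R * R -> \bar R) :
  measurable_fun (setT : set mR) (g : mR -> mR) ->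
  measurable_fun (setT : set mR2) f -> (forall x, 0 <= f x) ->
  \int[mu2]_z f (z.1 + g z.2, z.2)%R = \int[mu2]_z f z.
Proof.
move=> mg mf f0.
have mF : measurable_fun (setT : set mR2) (fun z : mR2 => f (z.1 + g z.2, z.2)%R).
  apply: (measurableT_comp mf); apply: measurable_fun_pair => //.
  apply: measurable_funD => //.
  exact: (measurableT_comp mg).
rewrite (@fubini_tonelli2 _ _ _ _ R mu mu (fun z => f (z.1 + g z.2, z.2)%R) mF)//.
rewrite (fubini_tonelli2 _ mf)//.
apply: eq_integral => y _; rewrite /fubini_G/=.
apply: (@ge0_integralD_shift (g y) (fun x => f (x, y))) => //.
apply: (measurableT_comp mf); exact: measurable_fun_pair.
Qed.

Lemma ge0_integral_shear2 (g : R -> R) (f : R * R -> \bar R) :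
  measurable_fun (setT : set mR) (g : mR -> mR) ->
  measurable_fun (setT : set mR2) f -> (forall x, 0 <= f x) ->
  \int[mu2]_z f (z.1, z.2 + g z.1)%R = \int[mu2]_z f z.
Proof.
move=> mg mf f0.
have mF : measurable_fun (setT : set mR2) (fun z : mR2 => f (z.1, z.2 + g z.1)%R).
  apply: (measurableT_comp mf); apply: measurable_fun_pair => //.
  apply: measurable_funD => //.
  exact: (measurableT_comp mg).
rewrite (@fubini_tonelli1 _ _ _ _ R mu mu (fun z => f (z.1, z.2 + g z.1)%R) mF)//.
rewrite (fubini_tonelli1 _ mf)//.
apply: eq_integral => x _; rewrite /fubini_F/=.
apply: (@ge0_integralD_shift (g x) (fun y => f (x, y))) => //.
apply: (measurableT_comp mf); exact: measurable_fun_pair.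
Qed.

Lemma ge0_integral_translate (a : R * R) (f : R * R -> \bar R) :
  measurable_fun (setT : set mR2) f -> (forall x, 0 <= f x) ->
  \int[mu2]_z f (z.1 + a.1, z.2 + a.2)%R = \int[mu2]_z f z.
Proof.
move=> mf f0.
rewrite -(@ge0_integral_shear1 (cst a.1) f)//.
rewrite -[RHS](@ge0_integral_shear2 (cst a.2))//=.
apply: (measurableT_comp mf); apply: measurable_fun_pair => //.
exact: measurable_funD.
Qed.

Definition rot (c s : R) (p : R * R) : R * R :=
  (c * p.1 - s * p.2, s * p.1 + c * p.2)%R.

Lemma measurable_rot c s : measurable_fun (setT : set mR2) (rot c s : mR2 -> mR2).
Proof.
apply: measurable_fun_pair.
  by apply: measurable_funB; apply: measurable_funM.
by apply: measurable_funD; apply: measurable_funM.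
Qed.

(** A rotation with nonzero sine is a product of three shears; the two others
    are the identity and the square of a quarter turn. *)
Lemma ge0_integral_rot (c s : R) (f : R * R -> \bar R) :
  (c ^+ 2 + s ^+ 2 = 1)%R ->
  measurable_fun (setT : set mR2) f -> (forall x, 0 <= f x) ->
  \int[mu2]_z f (rot c s z) = \int[mu2]_z f z.
Proof.
move=> cs1 mf f0.
have sn0 (c' s' : R) (g : R * R -> \bar R) : s' != 0%R ->
    (c' ^+ 2 + s' ^+ 2 = 1)%R ->
    measurable_fun (setT : set mR2) g -> (forall x, 0 <= g x) ->
    \int[mu2]_z g (rot c' s' z) = \int[mu2]_z g z.
  (* The three shears have slopes [k], [s'] and [k]. *)
  move=> s0 cs mg g0; pose k := ((c' - 1) / s')%R.
  have mlin (l : R) : measurable_fun (setT : set mR) ((fun x => l * x)%R : mR -> mR).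
    exact: measurable_funM.
  pose g1 := (fun z : mR2 => g (z.1 + k * z.2, z.2)%R).
  have mg1 : measurable_fun setT g1.
    apply: (measurableT_comp mg); apply: measurable_fun_pair => //.
    by apply: measurable_funD => //; exact: measurable_funM.
  pose g2 := (fun z : mR2 => g1 (z.1, z.2 + s' * z.1)%R).
  have mg2 : measurable_fun setT g2.
    apply: (measurableT_comp mg1); apply: measurable_fun_pair => //.
    by apply: measurable_funD => //; exact: measurable_funM.
  rewrite -(ge0_integral_shear1 (mlin k) mg)//.
  rewrite -[RHS](ge0_integral_shear2 (mlin s') mg1)//; last by move=> ?; exact: g0.
  rewrite -[RHS](ge0_integral_shear1 (mlin k) mg2)//; last by move=> ?; exact: g0.
  apply: eq_integral => -[x y] _; rewrite /g2 /g1 /rot/=; congr (g (_, _)).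
    have -> : (s' * y = (1 - c' ^+ 2) / s' * y)%R.
      by congr (_ * _)%R; rewrite -cs; field.
    by rewrite /k; field.
  by rewrite /k; field.
have [s0|s0] := eqVneq s 0%R; last exact: sn0.
have /eqP : (c ^+ 2 = 1)%R by rewrite -cs1 s0 expr0n/= addr0.
rewrite sqrf_eq1 => /orP[|] /eqP c1.
  by apply: eq_integral => -[x y] _; rewrite /rot s0 c1/=; congr (f (_, _)); ring.
rewrite -[RHS](sn0 0%R 1%R)//; last by rewrite expr0n/= add0r expr1n.
rewrite -[RHS](sn0 0%R 1%R)//.
- by apply: eq_integral => -[x y] _; rewrite /rot s0 c1/=; congr (f (_, _)); ring.
- by rewrite expr0n/= add0r expr1n.
- by apply: (measurableT_comp mf); exact: measurable_rot.
Qed.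

End Invariance.

(** * Means over circles and over discs *)

Section RadialMean.
Context {R : realType}.
Local Notation mu := (@lebesgue_measure R).
Local Notation mu2 := (@lebesgue_measure R \x @lebesgue_measure R)%E.
Local Notation mR := (measurableTypeR R).
Local Notation mR2 := (mR * mR)%type.

Lemma ge0_integral_shift_itv (a x y : R) (g : R -> \bar R) :
  measurable_fun (setT : set mR) g -> (forall t, 0 <= g t) ->
  \int[mu]_(t in `]x, y]) g (t + a)%R = \int[mu]_(t in `](x + a)%R, (y + a)%R]) g t.
Proof.
move=> mg g0; rewrite integral_mkcond [RHS]integral_mkcond.
rewrite -[RHS](ge0_integralD_shift a).
- apply: eq_integral => t _; rewrite /patch.
  suff -> : (t \in `]x, y]%classic) = ((t + a)%R \in `](x + a)%R, (y + a)%R]%classic) by [].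
  by apply/idP/idP; rewrite !inE/= !in_itv/= !lerD2r !ltrD2r.
- by apply/(measurable_restrictT _ _).1 => //; exact: measurable_funTS.
- by move=> t; exact: erestrict_ge0.
Qed.

Lemma ge0_integral_periodic_shift (a T : R) (g : R -> \bar R) :
  measurable_fun (setT : set mR) g -> (forall t, 0 <= g t) ->
  (forall t, g (t + T)%R = g t) -> (0 <= a <= T)%R ->
  \int[mu]_(t in `[0%R, T]) g (t + a)%R = \int[mu]_(t in `[0%R, T]) g t.
Proof.
move=> mg g0 gT /andP[a0 aT].
have mga : measurable_fun (setT : set mR) (fun t => g (t + a)%R).
  by apply: (measurableT_comp mg); exact: measurable_funD.
rewrite -[LHS]integral_itv_obnd_cbnd; last exact: measurable_funTS.
rewrite -[RHS]integral_itv_obnd_cbnd; last exact: measurable_funTS.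
rewrite ge0_integral_shift_itv// add0r.
have E (x y z : R) : (x <= y <= z)%R ->
    \int[mu]_(t in `]x, z]) g t = \int[mu]_(t in `]x, y]) g t + \int[mu]_(t in `]y, z]) g t.
  move=> /andP[xy yz].
  rewrite -integral_setU//; last first.
  - apply/disj_setPS => t [/=]; rewrite !in_itv/= => /andP[_ ty] /andP[yt _].
    by rewrite leNgt yt in ty.
  - exact: measurable_funTS.
  - congr (integral _ _ _); apply/seteqP; split=> t /=; rewrite !in_itv/=.
    + move=> /andP[xt tz]; have [ty|ty] := leP t y; [left|right];
        by apply/andP; split.
    + by case=> /andP[? ?]; lra.
rewrite (E a T (T + a)%R); last by rewrite aT lerDl a0.
rewrite (E 0%R a T); last by rewrite a0.
rewrite addeC; congr (_ + _).
have -> : `]T, (T + a)%R]%classic = `](0 + T)%R, (a + T)%R]%classic.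
  by rewrite add0r addrC.
rewrite -ge0_integral_shift_itv//.
by apply: eq_integral => t _; rewrite gT.
Qed.

(** The angle is obtained from [acos], hence in [0, pi], and is reflected for points
    of the lower half-plane. *)
Lemma polar_coordinates (p : R * R) : p != (0, 0)%R ->
  exists r a : R, [/\ (0 < r)%R, (0 <= a <= 2 * pi)%R,
    (r ^+ 2 = p.1 ^+ 2 + p.2 ^+ 2)%R & p = (r * cos a, r * sin a)%R].
Proof.
case: p => x y /= xy0; pose r := Num.sqrt (x ^+ 2 + y ^+ 2).
have xyge0 : (0 <= x ^+ 2 + y ^+ 2)%R by rewrite addr_ge0 ?sqr_ge0.
have r2 : (r ^+ 2 = x ^+ 2 + y ^+ 2)%R by rewrite sqr_sqrtr.
have r0 : (0 < r)%R.
  rewrite sqrtr_gt0 lt_neqAle xyge0 andbT eq_sym; apply: contra xy0.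
  by rewrite paddr_eq0 ?sqr_ge0// !sqrf_eq0 => /andP[/eqP -> /eqP ->].
have rn0 : r != 0%R by rewrite gt_eqF.
pose c := (x / r)%R.
have c2 : (c ^+ 2 <= 1)%R.
  by rewrite /c expr_div_n ler_pdivrMr ?exprn_gt0// mul1r r2 lerDl sqr_ge0.
have c1 : (-1 <= c <= 1)%R by apply/andP; split; nra.
have ca : cos (acos c) = c by rewrite acosK// in_itv.
have sa : sin (acos c) = (`|y| / r)%R.
  rewrite sin_acos//; have -> : (1 - c ^+ 2 = (`|y| / r) ^+ 2)%R.
    by rewrite /c !expr_div_n real_normK ?num_real// r2; field; rewrite -r2 sqrf_eq0.
  by rewrite sqrtr_sqr ger0_norm// divr_ge0// ltW.
have pi0 := pi_ge0 R.
have a0 := acos_ge0 c1; have api := acos_lepi c1.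
have [y0|y0] := leP 0%R y.
  exists r, (acos c); split => //; first by lra.
  rewrite ca sa ger0_norm// /c; congr (_, _); field; exact: rn0.
exists r, (2 * pi - acos c)%R; split => //; first by lra.
have -> : (2 * pi - acos c = - acos c + pi *+ 2 :> R)%R by rewrite mulr_natl addrC.
rewrite cosD2pi sinD2pi cosN sinN ca sa ltr0_norm// /c; congr (_, _); field; exact: rn0.
Qed.

Lemma closed_disc_center (z : R * R) (r : R) : closed_disc z r z.
Proof. by rewrite /closed_disc/= !subrr expr0n/= addr0 sqr_ge0. Qed.

Lemma closed_disc_circle (z : R * R) (r t : R) :
  closed_disc z r (z.1 + r * cos t, z.2 + r * sin t)%R.
Proof.
rewrite /closed_disc/=.
rewrite (_ : (_ + _)%R = (r ^+ 2 * (cos t ^+ 2 + sin t ^+ 2))%R); last by ring.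
by rewrite cos2Dsin2 mulr1.
Qed.

Lemma measurable_circle (z : R * R) (r : R) : measurable_fun (setT : set mR)
  ((fun t => (z.1 + r * cos t, z.2 + r * sin t)%R) : mR -> mR2).
Proof.
apply: measurable_fun_pair.
  apply: measurable_funD => //; apply: measurable_funM => //.
  by apply: continuous_measurable_fun; exact: continuous_cos.
apply: measurable_funD => //; apply: measurable_funM => //.
by apply: continuous_measurable_fun; exact: continuous_sin.
Qed.

(** The mean value inequality of superharmonic functions, multiplied out by [2 * pi] to
    avoid a division of extended reals. *)
Definition supermean (B : set (R * R)) (w : R * R -> \bar R) :=
  forall (z : R * R) (r : R), (0 < r)%R -> closed_disc z r `<=` B ->
    \int[mu]_(t in `[0%R, (2 * pi)%R]) w (z.1 + r * cos t, z.2 + r * sin t)%R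
    <= (2 * pi)%:E * w z.

(** The circle through [p] is traversed from the argument of [p]: this starting
    point is irrelevant by periodicity. *)
Lemma supermean_circle (B : set (R * R)) w z p : measurable_fun (setT : set mR2) w ->
  (forall z, 0 <= w z) -> supermean B w ->
  closed_disc z (Num.sqrt (p.1 ^+ 2 + p.2 ^+ 2)) `<=` B ->
  \int[mu]_(t in `[0%R, (2 * pi)%R])
     w (z.1 + (rot (cos t) (sin t) p).1, z.2 + (rot (cos t) (sin t) p).2)%R
  <= (2 * pi)%:E * w z.
Proof.
move=> mw w0 sw; have pi0 : (0 < pi :> R)%R := pi_gt0 R.
have [->|/polar_coordinates[r [a [r0 /andP[a0 a2] rE pE]]]] := eqVneq p (0, 0)%R.
  move=> _; under eq_integral.
    move=> t _; rewrite (_ : (_, _) = z); last first.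
      by case: z => z1 z2; rewrite /rot/= !mulr0 subr0 !addr0.
    over.
  rewrite integral_cst//= lebesgue_measure_itv/= lte_fin mulr_gt0//.
  by rewrite sube0 muleC.
rewrite -rE sqrtr_sqr (gtr0_norm r0) => zB.
pose g t := w (z.1 + r * cos t, z.2 + r * sin t)%R.
have mg : measurable_fun (setT : set mR) g.
  exact: (measurableT_comp mw (measurable_circle z r)).
have gper t : g (t + 2 * pi)%R = g t by rewrite /g mulr_natl cosD2pi sinD2pi.
apply: le_trans (sw z r r0 zB).
rewrite -(@ge0_integral_periodic_shift a _ g) ?a0 ?a2//; last by move=> t; exact: w0.
rewrite le_eqVlt; apply/orP; left; apply/eqP; apply: eq_integral => t _.
by rewrite /g cosD sinD pE /rot/=; congr (w (_, _)); ring.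
Qed.

(** Integrating the circular inequality against a radial weight.  Instead of polar
    coordinates, the integral is averaged over all rotations of the plane, and
    Tonelli's theorem exchanges the two integrations. *)
Lemma radial_mean (B : set (R * R)) w (rho : R -> R) (d : R) z :
  measurable_fun (setT : set mR2) w -> (forall z, 0 <= w z) -> supermean B w ->
  measurable_fun (setT : set mR) (rho : mR -> mR) -> (forall s, 0 <= rho s)%R ->
  (forall s, d ^+ 2 < s -> rho s = 0)%R -> (0 <= d)%R ->
  closed_disc z d `<=` B ->
  \int[mu2]_p (w (z.1 + p.1, z.2 + p.2)%R * (rho (p.1 ^+ 2 + p.2 ^+ 2)%R)%:E)
  <= w z * \int[mu2]_p (rho (p.1 ^+ 2 + p.2 ^+ 2)%R)%:E.
Proof.
move=> mw w0 sw mrho rho0 rhod d0 zB.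
have pi0 : (0 < 2 * pi :> R)%R by rewrite mulr_gt0// pi_gt0.
pose n2 (p : R * R) := (p.1 ^+ 2 + p.2 ^+ 2)%R.
have mn2 : measurable_fun (setT : set mR2) (n2 : mR2 -> mR).
  by apply: measurable_funD; apply: measurable_funX.
have mrn : measurable_fun (setT : set mR2) (fun p : mR2 => (rho (n2 p))%:E).
  by apply/measurable_EFinP; exact: (measurableT_comp mrho).
pose q t p := (z.1 + (rot (cos t) (sin t) p).1, z.2 + (rot (cos t) (sin t) p).2)%R.
pose I1 := \1_(`[0%R, (2 * pi)%R]%classic) : R -> R.
pose f (tp : mR * mR2) : \bar R := (I1 tp.1)%:E * (w (q tp.1 tp.2) * (rho (n2 tp.2))%:E).
have f0 x : 0 <= f x.
  by rewrite /f mule_ge0// ?lee_fin ?mule_ge0// ?lee_fin.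
have mcos : measurable_fun (setT : set (mR * mR2)) (fun x : mR * mR2 => cos x.1 : mR).
  apply: (@measurableT_comp _ _ _ _ _ _ (cos : mR -> mR)) => //.
  by apply: continuous_measurable_fun; exact: continuous_cos.
have msin : measurable_fun (setT : set (mR * mR2)) (fun x : mR * mR2 => sin x.1 : mR).
  apply: (@measurableT_comp _ _ _ _ _ _ (sin : mR -> mR)) => //.
  by apply: continuous_measurable_fun; exact: continuous_sin.
have mf2 : measurable_fun (setT : set (mR * mR2)) (fun x : mR * mR2 => w (q x.1 x.2)).
  have m21 : measurable_fun (setT : set (mR * mR2)) (fun x : mR * mR2 => x.2.1 : mR).
    exact: (measurableT_comp measurable_fst).
  have m22 : measurable_fun (setT : set (mR * mR2)) (fun x : mR * mR2 => x.2.2 : mR).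
    exact: (measurableT_comp measurable_snd).
  apply: (measurableT_comp mw); apply: measurable_fun_pair => /=.
    by apply: measurable_funD => //; apply: measurable_funB; exact: measurable_funM.
  by apply: measurable_funD => //; apply: measurable_funD; exact: measurable_funM.
have mf : measurable_fun (setT : set (mR * mR2)) f.
  apply: emeasurable_funM.
    apply/measurable_EFinP; apply: (@measurableT_comp _ _ _ _ _ _ I1) => //.
    exact: measurable_indic.
  by apply: emeasurable_funM => //; exact: (measurableT_comp mrn).
have : \int[mu]_x \int[mu2]_y f (x, y) = \int[mu2]_y \int[mu]_x f (x, y).
  exact: (@fubini_tonelli _ _ mR mR2 R mu (@plane_measure R) f mf f0).
rewrite /f/=.
set I := \int[mu2]_p (w (z.1 + p.1, z.2 + p.2)%R * (rho (n2 p))%:E).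
have mI : measurable_fun (setT : set mR2)
    (fun p : mR2 => w (z.1 + p.1, z.2 + p.2)%R * (rho (n2 p))%:E).
  apply: emeasurable_funM => //; apply: (measurableT_comp mw).
  by apply: measurable_fun_pair; exact: measurable_funD.
have -> : \int[mu]_x \int[mu2]_y ((I1 x)%:E * (w (q x y) * (rho (n2 y))%:E)) =
    (2 * pi)%:E * I.
  transitivity (\int[mu]_x (I * (I1 x)%:E)).
    apply: eq_integral => t _.
    rewrite ge0_integralZl//; last 3 first.
    - apply: emeasurable_funM => //.
      exact: (measurableT_comp mf2 (pair1_measurable t)).
    - by move=> p _; rewrite mule_ge0 ?lee_fin.
    - by rewrite lee_fin.
    rewrite muleC; congr (_ * _).
    rewrite /I -(ge0_integral_rot (cos2Dsin2 t))//.
    - apply: eq_integral => p _; rewrite /q; congr (_ * (rho _)%:E).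
      rewrite /n2 /rot/=.
      have -> : ((cos t * p.1 - sin t * p.2) ^+ 2 + (sin t * p.1 + cos t * p.2) ^+ 2 =
         (cos t ^+ 2 + sin t ^+ 2) * (p.1 ^+ 2 + p.2 ^+ 2))%R by ring.
      by rewrite cos2Dsin2 mul1r.
    - by move=> p; rewrite mule_ge0 ?lee_fin.
  rewrite ge0_integralZl//.
  - rewrite integral_indic// setIT muleC; congr (_ * _).
    by rewrite [LHS]lebesgue_measure_itv/= lte_fin pi0 sube0.
  - by apply/measurable_EFinP; exact: measurable_indic.
  - by move=> x _; rewrite lee_fin.
  - by apply: integral_ge0 => p _; rewrite mule_ge0 ?lee_fin.
move=> E.
have pie0 : 0 < (2 * pi)%:E :> \bar R by rewrite lte_fin.
rewrite -(@lee_pmul2l _ (2 * pi)%:E)// E.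
rewrite -ge0_integralZl//; last by move=> p _; rewrite lee_fin.
have wrho0 p : 0 <= w z * (rho (n2 p))%:E by rewrite mule_ge0// lee_fin.
have mwrho : measurable_fun (setT : set mR2) (fun p : mR2 => w z * (rho (n2 p))%:E).
  exact: measurable_funeM.
rewrite -(ge0_integralZl mu2 measurableT mwrho (fun p _ => wrho0 p) (ltW pie0)).
apply: ge0_le_integral => //=.
- by move=> p _; apply: integral_ge0 => t _; exact: f0 (t, p).
- exact: (@measurable_fun_fubini_tonelli_G _ _ mR mR2 R mu f mf f0).
- exact: measurable_funeM.
move=> p _.
have [nd|nd] := leP (n2 p) (d ^+ 2)%R; last first.
  rewrite -/(n2 p) (rhod _ nd) !mule0.
  by under eq_integral do rewrite !mule0; rewrite integral0.
under eq_integral do rewrite muleA.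
rewrite ge0_integralZr ?lee_fin//; last 2 first.
- apply: emeasurable_funM; first by apply/measurable_EFinP; exact: measurable_indic.
  exact: (measurableT_comp mf2 (pair2_measurable p)).
- by move=> t _; rewrite mule_ge0 ?lee_fin.
rewrite muleA; apply: lee_wpmul2r; first by rewrite lee_fin.
rewrite [leLHS](_ : _ = \int[mu]_(t in `[0%R, (2 * pi)%R]) w (q t p)); last first.
  rewrite [RHS]integral_mkcond; apply: eq_integral => t _.
  by rewrite /I1 indicE /patch; case: ifP => _; rewrite ?mul1e ?mul0e.
apply: (supermean_circle mw w0 sw).
apply: subset_trans zB => x; rewrite /closed_disc/= => /le_trans; apply.
by rewrite sqr_sqrtr// addr_ge0// sqr_ge0.
Qed.

End RadialMean.

(** * Upper semicontinuity and the gap below an upper bound *)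

Section Deficit.
Context {R : realType}.
Local Notation mu := (@lebesgue_measure R).
Local Notation mu2 := (@lebesgue_measure R \x @lebesgue_measure R)%E.
Local Notation mR := (measurableTypeR R).
Local Notation mR2 := (mR * mR)%type.

(** Every open set is a countable union of boxes with rational vertices. *)
Lemma plane_open_measurable (U : set (R * R)) : open U -> measurable (U : set mR2).
Proof.
move=> oU.
pose I (q : (rat * rat) * (rat * rat)) : set mR2 :=
  `](ratr q.1.1 : R), ratr q.1.2[ `*` `](ratr q.2.1 : R), ratr q.2.2[.
pose F q := if pselect (I q `<=` U) then I q else set0.
have -> : U = \bigcup_q F q.
  apply/seteqP; split => [[x y] Uxy|z [q _]]; last first.
    by rewrite /F; case: pselect => // IU; exact: IU.
  have /nbhs_ballP[e /= e0 eU] := open_nbhs_nbhs (conj oU Uxy).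
  have sub (c : R) : exists q : rat * rat, `](ratr q.1 : R), ratr q.2[%classic c /\
      `](ratr q.1 : R), ratr q.2[ `<=` ball c e.
    have ce : (c - e < c)%R by rewrite ltrBlDr ltrDl.
    have ec : (c < c + e)%R by rewrite ltrDl.
    have [q1] := rat_in_itvoo ce; have [q2] := rat_in_itvoo ec.
    rewrite !in_itv/= => /andP[q2a q2b] /andP[q1a q1b]; exists (q1, q2).
    split => [|t] /=; rewrite in_itv/= ?q1b ?q2a// => /andP[t1 t2].
    rewrite /ball/= ltr_distlC.
    by rewrite (lt_trans q1a t1) (lt_trans t2 q2b).
  have [q1 [xq1 q1e]] := sub x; have [q2 [yq2 q2e]] := sub y.
  have IU : I (q1, q2) `<=` U.
    by case=> x' y' [/= x'q y'q]; apply: eU; split; [exact: q1e|exact: q2e].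
  by exists (q1, q2) => //; rewrite /F; case: pselect.
apply: countable_bigcupT_measurable => // q; rewrite /F; case: pselect => //= ?.
by apply: measurableX; exact: measurable_itv.
Qed.

Lemma usc_measurable (G : set (R * R)) (v : R * R -> \bar R) : open G ->
  upper_semicontinuous_on G v -> measurable_fun (G : set mR2) v.
Proof.
move=> oG uv; apply: (measurability _ (ErealGenInftyO.measurableE R)).
move=> /= _ [_ [c ->]] <-; apply: plane_open_measurable.
rewrite openE => z [Gz /=]; rewrite in_itv/= => vc.
apply: filterS2 (uv z Gz c vc) (open_nbhs_nbhs (conj oG Gz)) => w vwc Gw.
by split => //=; rewrite in_itv.
Qed.

Definition box (a b c d : R) : set (R * R) := `[a, b] `*` `[c, d].

Lemma boxE a b c d (z : R * R) :
  box a b c d z <-> [/\ a <= z.1, z.1 <= b, c <= z.2 & z.2 <= d]%R.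
Proof.
rewrite /box/=; split => [[]/=|[? ? ? ?]]; rewrite !in_itv/=.
  by move=> /andP[? ?] /andP[? ?].
by split; apply/andP; split.
Qed.

Lemma sub_box (a b c d a' b' c' d' : R) :
  (a' <= a)%R -> (b <= b')%R -> (c' <= c)%R -> (d <= d')%R ->
  box a b c d `<=` box a' b' c' d'.
Proof. by move=> ? ? ? ? z /boxE[? ? ? ?]; apply/boxE; split; lra. Qed.

Lemma measurable_box a b c d : measurable (box a b c d : set mR2).
Proof. by apply: measurableX; exact: measurable_itv. Qed.

Lemma area_box (a b c d : R) : (a <= b)%R -> (c <= d)%R ->
  mu2 (box a b c d) = ((b - a) * (d - c))%:E.
Proof.
move=> ab cd; rewrite /box product_measure1E//; do 2 ?exact: measurable_itv.
rewrite EFinM; congr (_ * _).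
  rewrite [LHS]lebesgue_measure_itv/= lte_fin; have [//|ba] := ltP a b.
  by rewrite (_ : a = b) ?subrr//; apply/le_anti; rewrite ab.
rewrite [LHS]lebesgue_measure_itv/= lte_fin; have [//|ba] := ltP c d.
by rewrite (_ : c = d) ?subrr//; apply/le_anti; rewrite cd.
Qed.

Lemma compact_box a b c d : compact (box a b c d).
Proof. by apply: compact_setX; exact: segment_compact. Qed.

(** The sublevel sets at real levels form an open cover of the compact set. *)
Lemma usc_bounded_above (G K : set (R * R)) (v : R * R -> \bar R) :
  upper_semicontinuous_on G v -> (forall z, G z -> v z < +oo) ->
  compact K -> K `<=` G -> exists2 M : R, (0 <= M)%R & forall z, K z -> v z <= M%:E.
Proof.
move=> uv vy cK KG.
have /compact_near_coveringP/(_ _ (nbhs (+oo : \bar R)) (fun (c : \bar R) z => v z < c) _) := cK.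
case.
  move=> z Kz.
  have [c vc] : exists c : R, v z < c%:E.
    have := vy z (KG z Kz); case: (v z) => [r _| //|_].
      by exists (r + 1)%R; rewrite lte_fin ltrDl.
    by exists 0%R; rewrite ltNyr.
  exists ([set w | v w < c%:E], [set e | c%:E < e]) => /=.
    split; first exact: uv (KG z Kz) c vc.
    by exists c; split => //; rewrite num_real.
  move=> [w e]/= [vw ce]; exact: lt_trans vw ce.
move=> c [cr]/= cP; exists (Num.max 0%R (c + 1)%R); first by rewrite le_max lexx.
move=> z Kz; apply: ltW; apply: (cP (Num.max 0%R (c + 1)%R)%:E) => //.
by rewrite lte_fin lt_max ltrDl ltr01 orbT.
Qed.

(** The identity [F - g + g^+ = F + g^-] between nonnegative functions makes this hold
    even when [g] has integral [-oo]. *)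
Lemma ge0_integral_deficit d (T : measurableType d) (m : {measure set T -> \bar R})
    (D : set T) (F g : T -> \bar R) : measurable D -> m.-integrable D F ->
  measurable_fun D g ->
  (forall x, D x -> 0 <= F x /\ F x \is a fin_num) ->
  (forall x, D x -> g x <= F x) ->
  \int[m]_(x in D) (F x - g x) = \int[m]_(x in D) F x - \int[m]_(x in D) g x.
Proof.
move=> mD iF mg F0 gF; have mF := measurable_int _ iF.
have E : \int[m]_(x in D) ((F x - g x) + g^\+ x) = \int[m]_(x in D) (F x + g^\- x).
  apply: eq_integral => x /set_mem Dx; have := gF x Dx; have [] := F0 x Dx.
  rewrite funeposE funenegE; case: (F x) => // f; rewrite lee_fin => f0 _.
  case: (g x) => [r||] //=; rewrite ?lee_fin => gf; last by rewrite maxNye maxye adde0.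
  rewrite -?EFinN -!EFin_max -?EFinN -?EFinB -!EFinD; congr (_%:E).
  by rewrite /Num.max; case: (ltP r 0%R); case: (ltP (- r)%R 0%R) => ? ?; lra.
have mFg : measurable_fun D (fun x => F x - g x) by exact: emeasurable_funB.
have Fg0 x : D x -> 0 <= F x - g x.
  by move=> Dx; rewrite sube_ge0 ?gF// (F0 x Dx).2 ?orbT.
rewrite (ge0_integralD m mD Fg0 mFg (fun _ _ => funepos_ge0 _ _)
  (measurable_funepos mg)) in E.
rewrite (ge0_integralD m mD (fun x Dx => (F0 x Dx).1) mF (fun _ _ => funeneg_ge0 _ _)
  (measurable_funeneg mg)) in E.
rewrite [X in _ = _ - X]integralE.
have fF := integrable_fin_num mD iF.
have g0 : 0 <= \int[m]_(x in D) g^\+ x by apply: integral_ge0.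
have fg : \int[m]_(x in D) g^\+ x \is a fin_num.
  rewrite ge0_fin_numE//; apply: le_lt_trans (_ : \int[m]_(x in D) F x < +oo).
    apply: ge0_le_integral => //; first exact: measurable_funepos.
    by move=> x Dx; rewrite funeposE ge_max gF// (F0 x Dx).1.
  by rewrite ltey_eq fF.
have n0 : 0 <= \int[m]_(x in D) g^\- x by apply: integral_ge0.
have a0 : 0 <= \int[m]_(x in D) (F x - g x) by apply: integral_ge0.
move: E fF fg n0 a0; move: (\int[m]_(x in D) (F x - g x)) => a.
case: (\int[m]_(x in D) F x) => // f; case: (\int[m]_(x in D) g^\+ x) => // p.
case: (\int[m]_(x in D) g^\- x) => [n||//]; case: a => [a||] //= E _ _ _ _.
by move: E; rewrite -!EFinD => -[E]; rewrite -?EFinB -?EFinN -?EFinD; congr (_%:E); lra.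
Qed.

Lemma integrable_cst d (T : measurableType d) (m : {measure set T -> \bar R})
    (D : set T) (k : R) : measurable D -> m D < +oo -> m.-integrable D (cst k%:E).
Proof.
move=> mD Doo; apply/integrableP; split; first exact: measurable_cst.
by rewrite integral_cst// lte_mul_pinfty ?abse_ge0.
Qed.

(** Extended by [0], so that it is measurable and nonnegative on the whole plane;
    it satisfies the mean value inequality on discs inside [B] only. *)
Definition gap (B : set (R * R)) (M : R) (v : R * R -> \bar R) : R * R -> \bar R :=
  (fun z => M%:E - v z) \_ B.

Lemma gapE B M v z : B z -> gap B M v z = M%:E - v z.
Proof. by move=> Bz; rewrite /gap patchT ?inE. Qed.

Lemma gap_ge0 B M v z : (forall z, B z -> v z <= M%:E) -> 0 <= gap B M v z.
Proof.
by move=> vM; rewrite /gap; apply: erestrict_ge0 => x Bx; rewrite sube_ge0 ?vM ?orbT.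
Qed.

Lemma measurable_gap (B : set (R * R)) M v : measurable (B : set mR2) ->
  measurable_fun (B : set mR2) v -> measurable_fun (setT : set mR2) (gap B M v).
Proof.
move=> mB mv; apply/(measurable_restrictT _ _).1 => //.
exact: emeasurable_funB.
Qed.

Lemma supermean_gap (S B : set (R * R)) M v : subharmonic S v -> open S ->
  measurable (B : set mR2) ->
  B `<=` S -> (0 <= M)%R -> (forall z, B z -> v z <= M%:E) -> supermean B (gap B M v).
Proof.
move=> [vy _ uv mean] oS mB BS M0 vM z r r0 zB.
have pi0 : (0 < 2 * pi :> R)%R by rewrite mulr_gt0// pi_gt0.
have Bz : B z by apply: zB; exact: closed_disc_center.
pose c t := (z.1 + r * cos t, z.2 + r * sin t)%R.
have Bc t : B (c t).
  by apply: zB; exact: closed_disc_circle.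
have mc : measurable_fun (setT : set mR) (c : mR -> mR2) := measurable_circle z r.
have mvc : measurable_fun (setT : set mR) (v \o c).
  apply: (measurable_comp (F := B : set mR2)) => //.
    by move=> _ [t _ <-]; exact: Bc.
  by apply: measurable_funS (usc_measurable oS uv) => //; exact: plane_open_measurable.
have mI : measurable (`[0%R, (2 * pi)%R]%classic : set mR) by exact: measurable_itv.
have lI : mu (`[0%R, (2 * pi)%R]%classic : set mR) = (2 * pi)%:E.
  by rewrite lebesgue_measure_itv/= lte_fin pi0 sube0.
rewrite gapE//; under eq_integral => t _ do rewrite (gapE M v (Bc t)).
have iM : mu.-integrable (`[0%R, (2 * pi)%R]%classic : set mR) (cst M%:E).
  by apply: integrable_cst => //; rewrite [ltLHS]lI ltry.
rewrite (@ge0_integral_deficit _ _ mu _ (cst M%:E) (v \o c) mI iM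
  (measurable_funTS mvc) (fun t _ => conj M0 isT) (fun t _ => vM _ (Bc t))).
rewrite integral_cst//= [X in _ * X - _]lI.
have := mean z r r0 (subset_trans zB BS); rewrite /circle_mean.
rewrite -[\int[_]_(_ in _) (v _)]/(\int[mu]_(t in `[0%R, (2 * pi)%R]) (v \o c) t).
have := vy z (BS z Bz); case: (v z) => [s _|//|_ _]; last first.
  by rewrite /= gt0_muley ?leey// lte_fin.
case: (\int[mu]_(t in _) _) => [I||]; last 2 first.
- by move=> _; rewrite -EFinM /= leNye.
- by rewrite gt0_muleNy ?lte_fin ?invr_gt0.
rewrite -?EFinB -!EFinM -?EFinB !lee_fin => sI.
have : (2 * pi * s <= I)%R by rewrite mulrC -ler_pdivlMr// mulrC.
lra.
Qed.

End Deficit.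

(** * Harnack's inequality for the mass of a superharmonic function *)

Section Harnack.
Context {R : realType}.
Local Notation mu := (@lebesgue_measure R).
Local Notation mu2 := (@lebesgue_measure R \x @lebesgue_measure R)%E.
Local Notation mR := (measurableTypeR R).
Local Notation mR2 := (mR * mR)%type.

Definition sq (z : R * R) (h : R) := box (z.1 - h) (z.1 + h) (z.2 - h) (z.2 + h).

Lemma norm_le_of_sqr (x y h : R) : (0 <= h)%R -> (x ^+ 2 + y ^+ 2 <= h ^+ 2)%R -> (`|x| <= h)%R.
Proof.
move=> h0 xyh; rewrite -ler_sqr ?nnegrE// real_normK ?num_real//.
by have := sqr_ge0 y; lra.
Qed.

Lemma closed_disc_sub_sq (z : R * R) (h : R) : (0 <= h)%R -> closed_disc z h `<=` sq z h.
Proof.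
move=> h0 [x y]; rewrite /closed_disc/= => xyh.
have := norm_le_of_sqr h0 xyh; rewrite addrC in xyh.
move: (norm_le_of_sqr h0 xyh); rewrite !ler_norml => /andP[? ?] /andP[? ?].
by apply/boxE => /=; split; lra.
Qed.

Lemma area_sq (z : R * R) (h : R) : (0 <= h)%R -> mu2 (sq z h) = (4 * h ^+ 2)%:E.
Proof. by move=> h0; rewrite area_box; [congr (_%:E); ring|lra|lra]. Qed.

(** The square of half side [h] lies in the disc of radius [2 * h], and that disc in a
    square of area [16 * h ^+ 2]. *)
Lemma supermean_sq (B : set (R * R)) w z h : measurable_fun (setT : set mR2) w ->
  (forall z, 0 <= w z) -> supermean B w -> (0 < h)%R -> sq z (2 * h) `<=` B ->
  \int[mu2]_(p in sq z h) w p <= (16 * h ^+ 2)%:E * w z.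
Proof.
move=> mw w0 sw h0 zB; have h20 : (0 <= 2 * h)%R by rewrite mulr_ge0// ltW.
pose rho : R -> R := \1_(`]-oo, ((2 * h) ^+ 2)%R]%classic).
have rho0 s : (0 <= rho s)%R by rewrite /rho indicE.
have mrho : measurable_fun (setT : set mR) (rho : mR -> mR).
  exact: measurable_indic.
have rhoE p : (p <= (2 * h) ^+ 2)%R -> rho p = 1%R.
  by move=> ph; rewrite /rho indicE mem_set//= in_itv.
have mn2 : measurable_fun (setT : set mR2) (fun p : mR2 => (p.1 ^+ 2 + p.2 ^+ 2)%R : mR).
  by apply: measurable_funD; apply: measurable_funX.
have mrn : measurable_fun (setT : set mR2) (fun p : mR2 => (rho (p.1 ^+ 2 + p.2 ^+ 2)%R)%:E).
  by apply/measurable_EFinP; exact: (measurableT_comp mrho).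
have rhod s : ((2 * h) ^+ 2 < s -> rho s = 0)%R.
  move=> hs; rewrite /rho indicE memNset//= in_itv/=.
  by move=> sh; move: hs; rewrite ltNge sh.
have msq a r : measurable (sq a r : set mR2) by exact: measurable_box.
have := radial_mean mw w0 sw mrho rho0 rhod h20
  (subset_trans (closed_disc_sub_sq h20) zB).
move=> rm; apply: (@le_trans _ _ (\int[mu2]_p (w (z.1 + p.1, z.2 + p.2)%R *
    (rho (p.1 ^+ 2 + p.2 ^+ 2)%R)%:E))).
  have mwq : measurable_fun (setT : set mR2) (w \_ (sq z h)).
    by apply/(measurable_restrictT _ _).1 => //; exact: measurable_funTS.
  have wq0 x : 0 <= (w \_ (sq z h)) x by exact: erestrict_ge0.
  rewrite integral_mkcond -(ge0_integral_translate z mwq wq0).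
  apply: ge0_le_integral => //=.
  - apply: (measurableT_comp mwq); apply: measurable_fun_pair; exact: measurable_funD.
  - apply: emeasurable_funM => //; apply: (measurableT_comp mw).
    by apply: measurable_fun_pair; exact: measurable_funD.
  move=> [x y] _ /=; rewrite patchE; case: ifPn; last first.
    by move=> _; rewrite mule_ge0// lee_fin.
  move=> /set_mem /boxE/= [h1 h2 h3 h4].
  by rewrite rhoE ?mule1 1?(addrC x) 1?(addrC y)//; nra.
apply: le_trans rm _; rewrite muleC; apply: lee_wpmul2r => //.
apply: (@le_trans _ _ (\int[mu2]_(p in sq (0, 0)%R (2 * h)) (cst 1%:E p))); last first.
  by rewrite integral_cst//= mul1e area_sq// lee_fin; rewrite le_eqVlt; apply/orP; left; apply/eqP; ring.
rewrite [leRHS]integral_mkcond; apply: ge0_le_integral => //=.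
- by move=> x _; rewrite lee_fin.
- apply/(measurable_restrictT _ _).1 => //; exact: measurable_cst.
move=> p _; rewrite patchE; case: ifPn => [_|].
  by rewrite lee_fin /rho indicE; case: (_ \in _).
move=> /negP pn; have [pd|pd] := leP (p.1 ^+ 2 + p.2 ^+ 2)%R ((2 * h) ^+ 2)%R.
  exfalso; apply: pn; apply/mem_set/closed_disc_sub_sq => //.
  by rewrite /closed_disc/= !subr0.
by rewrite rhod.
Qed.

(** The factor [2] instead of [4] avoids a strict inequality between integrals. *)
Lemma exists_le_of_integral_sq w (z : R * R) (h C : R) :
  measurable_fun (setT : set mR2) w -> (forall z, 0 <= w z) -> (0 < h)%R -> (0 < C)%R ->
  \int[mu2]_(p in sq z h) w p <= C%:E ->
  exists2 z', sq z h z' & w z' <= (C / (2 * h ^+ 2))%:E.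
Proof.
move=> mw w0 h0 C0 wC; apply: contrapT => nex.
have wgt p : sq z h p -> (C / (2 * h ^+ 2))%:E <= w p.
  by move=> zp; rewrite leNgt; apply/negP => wp; apply: nex; exists p => //; exact: ltW.
have msq : measurable (sq z h : set mR2) by exact: measurable_box.
have : \int[mu2]_(p in sq z h) (cst (C / (2 * h ^+ 2))%:E p) <= C%:E.
  apply: le_trans wC; apply: ge0_le_integral => //.
  - by move=> x _; rewrite lee_fin divr_ge0// ?ltW// mulr_gt0// exprn_gt0.
  - exact: measurable_funTS.
rewrite integral_cst//= (area_sq z (ltW h0)) -EFinM lee_fin.
have -> : (C / (2 * h ^+ 2) * (4 * h ^+ 2) = 2 * C)%R by field; rewrite gt_eqF.
lra.
Qed.

Lemma sq_sub_sq (z z' : R * R) (r r' e : R) : (`|z.1 - z'.1| <= e)%R ->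
  (`|z.2 - z'.2| <= e)%R -> (e + r <= r')%R -> sq z r `<=` sq z' r'.
Proof.
by rewrite !ler_norml => /andP[? ?] /andP[? ?] ?; apply: sub_box; lra.
Qed.

Lemma sq_sub_box (a b c d : R) (z : R * R) (r : R) : box a b c d z ->
  sq z r `<=` box (a - r) (b + r) (c - r) (d + r).
Proof. by move=> /boxE[? ? ? ?]; apply: sub_box; lra. Qed.

Lemma chain_step (x x0 h a b : R) (n : nat) : (a <= x <= b)%R -> (a <= x0 <= b)%R ->
  (`|x - x0| <= n.+1%:R * h)%R ->
  exists x', [/\ (a <= x' <= b)%R, (`|x' - x0| <= n%:R * h)%R & (`|x - x'| <= h)%R].
Proof.
rewrite -natr1 => /andP[ax xb] /andP[ax0 x0b] xx.
have n0 : (0 <= n%:R :> R)%R by rewrite ler0n.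
pose l := (n%:R / (n%:R + 1) : R)%R.
have l0 : (0 <= l)%R by rewrite divr_ge0// addr_ge0.
have l1 : (0 <= 1 - l)%R by rewrite subr_ge0 ler_pdivrMr ?mul1r ?lerDl//; lra.
have lnh : (l * ((n%:R + 1) * h) = n%:R * h)%R.
  by rewrite /l; field; rewrite gt_eqF//; lra.
exists (x0 + l * (x - x0))%R; split.
- rewrite (_ : _ + _ = (1 - l) * x0 + l * x)%R; last by ring.
  by apply/andP; split; nra.
- rewrite addrAC subrr add0r normrM (ger0_norm l0).
  by apply: le_trans (ler_wpM2l l0 xx) _; rewrite lnh.
- rewrite (_ : x - _ = (1 - l) * (x - x0))%R; last by ring.
  rewrite normrM (ger0_norm l1).
  by apply: le_trans (ler_wpM2l l1 xx) _; rewrite mulrBl lnh; lra.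
Qed.

(** If [w z0 <= m], the mean inequality at [z0] bounds the mass of [w] near
    [z0], hence [w] is bounded by a multiple of [m] at some point half a step
    further, where the mean inequality applies again. *)
Lemma harnack_chain (B : set (R * R)) w (a b c d h m : R) :
  measurable_fun (setT : set mR2) w -> (forall z, 0 <= w z) -> supermean B w ->
  (0 < h)%R -> (0 < m)%R ->
  box (a - 5 * h) (b + 5 * h) (c - 5 * h) (d + 5 * h) `<=` B ->
  forall n z0 z, box a b c d z0 -> box a b c d z ->
  (`|z.1 - z0.1| <= n%:R * (h / 2))%R -> (`|z.2 - z0.2| <= n%:R * (h / 2))%R ->
  w z0 <= m%:E ->
  \int[mu2]_(p in sq z h) w p <= (128 ^+ n * (16 * h ^+ 2 * m))%:E.
Proof.
move=> mw w0 sw h0 m0 KB.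
have h20 : (0 < h / 2)%R by lra.
have h2p : (0 < 2 * h)%R by lra.
have hh : (0 <= 16 * (2 * h) ^+ 2)%R by nra.
have e1 : (h / 2 + h / 2 <= h)%R by lra.
have e2 : (h / 2 + h <= 2 * h)%R by lra.
have e3 : (h / 2 + 2 * (2 * h) <= 5 * h)%R by lra.
have e4 : (0 + 2 * h <= 5 * h)%R by lra.
have msq x r : measurable (sq x r : set mR2) by exact: measurable_box.
have mws x r : measurable_fun (sq x r : set mR2) w by exact: measurable_funTS.
have sqB z z' r e : box a b c d z -> (`|z'.1 - z.1| <= e)%R -> (`|z'.2 - z.2| <= e)%R ->
    (e + r <= 5 * h)%R -> sq z' r `<=` B.
  move=> Kz z1 z2 er; apply: subset_trans KB.
  exact: subset_trans (sq_sub_sq z1 z2 er) (sq_sub_box Kz).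
elim=> [|n IH] z0 z Kz0 Kz.
  rewrite !mul0r !normr_le0 !subr_eq0 => /eqP z1 /eqP z2 wm.
  have -> : z = z0 by case: (z) (z0) z1 z2 => ? ? [? ?]/= -> ->.
  have : sq z0 (2 * h) `<=` B by apply: (sqB z0 z0 _ 0%R) => //; rewrite subrr normr0.
  move=> /(supermean_sq mw w0 sw h0) /le_trans; apply.
  rewrite expr0 mul1r [leRHS]EFinM; apply: lee_wpmul2l => //.
  by rewrite lee_fin mulr_ge0// exprn_ge0// ltW.
move=> z1 z2 wm.
pose C := (128 ^+ n * (16 * h ^+ 2 * m))%R.
have C0 : (0 < C)%R by rewrite !mulr_gt0// exprn_gt0.
move: (Kz0) (Kz) => /boxE[a0 b0 c0 d0] /boxE[a1 b1 c1 d1].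
have [x' [/andP[x1 x2] x3 x4]] : exists x', [/\ (a <= x' <= b)%R,
    (`|x' - z0.1| <= n%:R * (h / 2))%R & (`|z.1 - x'| <= h / 2)%R].
  by apply: chain_step z1; apply/andP.
have [y' [/andP[y1 y2] y3 y4]] : exists x', [/\ (c <= x' <= d)%R,
    (`|x' - z0.2| <= n%:R * (h / 2))%R & (`|z.2 - x'| <= h / 2)%R].
  by apply: chain_step z2; apply/andP.
have K' : box a b c d (x', y') by apply/boxE.
have : \int[mu2]_(p in sq z (h / 2)) w p <= C%:E.
  apply: le_trans (IH z0 (x', y') Kz0 K' x3 y3 wm).
  by apply: ge0_subset_integral => //; exact: (@sq_sub_sq z (x', y') _ _ _ x4 y4 e1).
move=> /(exists_le_of_integral_sq mw w0 h20 C0)[z3 Qz3].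
have -> : (C / (2 * (h / 2) ^+ 2) = 2 * C / h ^+ 2)%R by field; rewrite gt_eqF.
move=> wz3.
have [q1 q2] : (`|z3.1 - z.1| <= h / 2)%R /\ (`|z3.2 - z.2| <= h / 2)%R.
  by move: Qz3 => /boxE[? ? ? ?]; rewrite !ler_distl; split; apply/andP.
apply: (@le_trans _ _ (\int[mu2]_(p in sq z3 (2 * h)) w p)).
  apply: ge0_subset_integral => //; apply: (@sq_sub_sq _ _ _ _ _ _ _ e2); by rewrite distrC.
apply: le_trans (supermean_sq mw w0 sw h2p (sqB z z3 _ _ Kz q1 q2 e3)) _.
apply: (@le_trans _ _ ((16 * (2 * h) ^+ 2)%:E * (2 * C / h ^+ 2)%:E)).
  by apply: lee_wpmul2l => //; rewrite lee_fin.
rewrite -EFinM lee_fin (exprS 128%:R n) -[X in (_ <= X)%R]mulrA -/C le_eqVlt.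
apply/orP; left; apply/eqP.
by field; rewrite gt_eqF.
Qed.

Lemma ge0_integral_subU (w : R * R -> \bar R) (A A1 A2 : set (R * R)) :
  measurable_fun (setT : set mR2) w -> (forall z, 0 <= w z) ->
  measurable (A : set mR2) -> measurable (A1 : set mR2) -> measurable (A2 : set mR2) ->
  A `<=` A1 `|` A2 ->
  \int[mu2]_(p in A) w p <= \int[mu2]_(p in A1) w p + \int[mu2]_(p in A2) w p.
Proof.
move=> mw w0 mA mA1 mA2 AA.
apply: (@le_trans _ _ (\int[mu2]_(p in A1 `|` (A2 `\` A1)) w p)).
  apply: ge0_subset_integral => //; [|exact: measurable_funTS|].
  - by apply: measurableU => //; exact: measurableD.
  - by rewrite setDE setUIr setUv setIT.
rewrite ge0_integral_setU//; last 3 first.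
- exact: measurableD.
- exact: measurable_funTS.
- by apply/disj_setPS => x [A1x [_ nA1x]].
apply: leeD2l; apply: ge0_subset_integral => //.
- exact: measurableD.
- exact: measurable_funTS.
Qed.

(** The box is cut into columns and these into cells of side [h], peeled off one by
    one. *)
Lemma integral_box_cover (w : R * R -> \bar R) (a b c d h C : R) :
  measurable_fun (setT : set mR2) w -> (forall z, 0 <= w z) ->
  (0 < h)%R -> (0 <= C)%R ->
  (forall z, box a b c d z -> \int[mu2]_(p in sq z h) w p <= C%:E) ->
  forall n k : nat, (b - a <= n.+1%:R * h)%R -> (d - c <= k.+1%:R * h)%R ->
  \int[mu2]_(p in box a b c d) w p <= (n.+1%:R * (k.+1%:R * C))%:E.
Proof.
move=> mw w0 h0 C0 sqC n k.
have mb a1 b1 c1 d1 : measurable (box a1 b1 c1 d1 : set mR2) by exact: measurable_box.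
have msq x r : measurable (sq x r : set mR2) by exact: measurable_box.
have mwT (A : set (R * R)) : measurable_fun (A : set mR2) w by exact: measurable_funTS.
have small a' b' c' d' : (a <= a')%R -> (b' <= b)%R -> (c <= c')%R -> (d' <= d)%R ->
    (b' - a' <= h)%R -> (d' - c' <= h)%R -> \int[mu2]_(p in box a' b' c' d') w p <= C%:E.
  move=> aa bb cc dd ba dc.
  have [ab'|ab'] := leP a' b'; last first.
    rewrite (_ : box _ _ _ _ = set0) ?integral_set0 ?lee_fin//.
    by rewrite -subset0 => p /boxE[? ? ? ?]; lra.
  have [cd'|cd'] := leP c' d'; last first.
    rewrite (_ : box _ _ _ _ = set0) ?integral_set0 ?lee_fin//.
    by rewrite -subset0 => p /boxE[? ? ? ?]; lra.
  apply: le_trans (sqC (a', c') _); last by apply/boxE => /=; split; lra.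
  apply: ge0_subset_integral => // p /boxE[? ? ? ?].
  by apply/boxE => /=; split; lra.
have col a' b' : (a <= a')%R -> (b' <= b)%R -> (b' - a' <= h)%R ->
    forall c', (c <= c')%R -> (d - c' <= k.+1%:R * h)%R ->
    \int[mu2]_(p in box a' b' c' d) w p <= (k.+1%:R * C)%:E.
  move=> aa bb ba; elim: k => [|k IH] c' cc dc.
    by rewrite mul1r; apply: small => //; rewrite ?mul1r in dc *.
  rewrite -natr1 mulrDl mul1r addrC EFinD.
  apply: le_trans (@ge0_integral_subU w _ (box a' b' c' (Num.min d (c' + h)%R))
    (box a' b' (c' + h)%R d) mw w0 _ _ _ _) _ => //.
    move=> p /boxE[? ? ? ?]; have [ph|ph] := leP p.2 (c' + h)%R.
      by left; apply/boxE; split => //; rewrite le_min; apply/andP.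
    by right; apply/boxE; split => //; exact: ltW.
  apply: leeD.
    apply: small => //; first by rewrite ge_min lexx.
    have : (Num.min d (c' + h) <= c' + h)%R by rewrite ge_min lexx orbT.
    lra.
  by apply: IH; rewrite -?natr1 in dc *; lra.
have row a' : (a <= a')%R -> (b - a' <= n.+1%:R * h)%R -> (d - c <= k.+1%:R * h)%R ->
    \int[mu2]_(p in box a' b c d) w p <= (n.+1%:R * (k.+1%:R * C))%:E.
  elim: n a' => [|n IH] a' aa ba dc.
    by rewrite mul1r; apply: col => //; rewrite ?mul1r in ba *.
  rewrite -[in leRHS]natr1 mulrDl mul1r addrC EFinD.
  apply: le_trans (@ge0_integral_subU w _ (box a' (Num.min b (a' + h)%R) c d)
    (box (a' + h)%R b c d) mw w0 _ _ _ _) _ => //.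
    move=> p /boxE[? ? ? ?]; have [ph|ph] := leP p.1 (a' + h)%R.
      by left; apply/boxE; split => //; rewrite le_min; apply/andP.
    by right; apply/boxE; split => //; exact: ltW.
  apply: leeD.
    apply: col => //; first by rewrite ge_min lexx.
    have : (Num.min b (a' + h) <= a' + h)%R by rewrite ge_min lexx orbT.
    lra.
  by apply: IH => //; rewrite -?natr1 in ba *; lra.
by move=> ba dc; exact: row.
Qed.

(** The number of steps of a chain depends only on the size of the box, so [C] does
    not depend on the position of the box or on [w]. *)
Lemma harnack_box (X Y h m : R) : (0 < h)%R -> (0 < m)%R ->
  exists2 C : R, (0 <= C)%R & forall (B : set (R * R)) w (a b c d : R),
    measurable_fun (setT : set mR2) w -> (forall z, 0 <= w z) -> supermean B w ->
    (b - a <= X)%R -> (d - c <= Y)%R ->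
    box (a - 5 * h) (b + 5 * h) (c - 5 * h) (d + 5 * h) `<=` B ->
    (exists2 z0, box a b c d z0 & w z0 <= m%:E) ->
    \int[mu2]_(p in box a b c d) w p <= C%:E.
Proof.
move=> h0 m0.
pose n := Num.bound (`|X| / (h / 2))%R; pose k := Num.bound (`|Y| / (h / 2))%R.
have h20 : (0 < h / 2)%R by lra.
have nP : (X <= n%:R * (h / 2))%R.
  rewrite -ler_pdivrMr//; apply/ltW; apply: (@le_lt_trans _ _ (`|X| / (h / 2))%R).
    by rewrite ler_pM2r ?invr_gt0// ler_norm.
  by apply: archi_boundP; rewrite divr_ge0// ltW.
have kP : (Y <= k%:R * (h / 2))%R.
  rewrite -ler_pdivrMr//; apply/ltW; apply: (@le_lt_trans _ _ (`|Y| / (h / 2))%R).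
    by rewrite ler_pM2r ?invr_gt0// ler_norm.
  by apply: archi_boundP; rewrite divr_ge0// ltW.
pose N := maxn n k.
have XN : (X <= N%:R * (h / 2))%R.
  by apply: le_trans nP _; apply: ler_wpM2r; [exact: ltW|rewrite ler_nat leq_maxl].
have YN : (Y <= N%:R * (h / 2))%R.
  by apply: le_trans kP _; apply: ler_wpM2r; [exact: ltW|rewrite ler_nat leq_maxr].
pose C := (128 ^+ N * (16 * h ^+ 2 * m))%R.
have C0 : (0 <= C)%R by rewrite !mulr_ge0 ?exprn_ge0// ltW.
have NS : (N%:R * (h / 2) <= N.+1%:R * h)%R.
  by rewrite -[N.+1%:R]natr1 mulrDl; have : (0 <= N%:R :> R)%R by []; nra.
exists (N.+1%:R * (N.+1%:R * C))%R; first by rewrite mulr_ge0// mulr_ge0.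
move=> B w a b c d mw w0 sw ba dc KB [z0 Kz0 wz0].
apply: (@integral_box_cover w a b c d h C) => //; [|lra|lra].
move=> z Kz; apply: (harnack_chain mw w0 sw h0 m0 KB Kz0 Kz) => //.
  move: Kz0 Kz => /boxE[? ? ? ?] /boxE[? ? ? ?].
  by rewrite ler_norml; apply/andP; split; lra.
move: Kz0 Kz => /boxE[? ? ? ?] /boxE[? ? ? ?].
by rewrite ler_norml; apply/andP; split; lra.
Qed.

End Harnack.

(** * Radial averages *)

Section Averages.
Context {R : realType}.
Local Notation mu := (@lebesgue_measure R).
Local Notation mu2 := (@lebesgue_measure R \x @lebesgue_measure R)%E.
Local Notation mR := (measurableTypeR R).
Local Notation mR2 := (mR * mR)%type.

Definition sqnorm (p : R * R) : R := (p.1 ^+ 2 + p.2 ^+ 2)%R.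

(** [rho] is the profile of a radial probability density: the density is
    [rho \o sqnorm], it is supported in the disc of radius [d], and [A] bounds it. *)
Definition radial_kernel (d A : R) (rho : R -> R) : Prop :=
  [/\ measurable_fun (setT : set mR) (rho : mR -> mR),
      forall s, (0 <= rho s <= A)%R,
      forall s, (d ^+ 2 < s)%R -> rho s = 0%R,
      (0 < d)%R &
      \int[mu2]_p (rho (sqnorm p))%:E = 1].

Definition average (rho : R -> R) (w : R * R -> \bar R) (z : R * R) : \bar R :=
  \int[mu2]_p (w (z.1 + p.1, z.2 + p.2)%R * (rho (sqnorm p))%:E).

Variables (d A : R) (rho : R -> R).
Hypothesis krho : radial_kernel d A rho.
Variables (B : set (R * R)) (w : R * R -> \bar R).
Hypothesis mw : measurable_fun (setT : set mR2) w.
Hypothesis w0 : forall z, 0 <= w z.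

Let mrho : measurable_fun (setT : set mR) (rho : mR -> mR).
Proof. by have [] := krho. Qed.

Let rho_ge0 s : (0 <= rho s)%R.
Proof. by have [_ /(_ s)/andP[]] := krho. Qed.

Let rho_leA s : (rho s <= A)%R.
Proof. by have [_ /(_ s)/andP[]] := krho. Qed.

Let d_gt0 : (0 < d)%R.
Proof. by have [] := krho. Qed.

Let A_ge0 : (0 <= A)%R.
Proof. exact: le_trans (rho_ge0 0%R) (rho_leA 0%R). Qed.

Let rho_int : \int[mu2]_p (rho (sqnorm p))%:E = 1.
Proof. by have [] := krho. Qed.

Let rho_out p : (d ^+ 2 < p)%R -> rho p = 0%R.
Proof. by have [_ _ h _ _] := krho; exact: h. Qed.

Lemma measurable_sqnorm : measurable_fun (setT : set mR2) (sqnorm : mR2 -> mR).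
Proof. by apply: measurable_funD; apply: measurable_funX. Qed.

Let mrn : measurable_fun (setT : set mR2) (fun p : mR2 => (rho (sqnorm p))%:E).
Proof. by apply/measurable_EFinP; exact: (measurableT_comp mrho measurable_sqnorm). Qed.

Lemma measurable_translate_snd :
  measurable_fun (setT : set (mR2 * mR2))
    (fun x : mR2 * mR2 => (x.1.1 + x.2.1, x.1.2 + x.2.2)%R : mR2).
Proof.
have m1 : measurable_fun (setT : set (mR2 * mR2)) (fun x : mR2 * mR2 => x.1.1 : mR).
  exact: (measurableT_comp measurable_fst).
have m2 : measurable_fun (setT : set (mR2 * mR2)) (fun x : mR2 * mR2 => x.1.2 : mR).
  exact: (measurableT_comp measurable_snd).
have m3 : measurable_fun (setT : set (mR2 * mR2)) (fun x : mR2 * mR2 => x.2.1 : mR).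
  exact: (measurableT_comp measurable_fst).
have m4 : measurable_fun (setT : set (mR2 * mR2)) (fun x : mR2 * mR2 => x.2.2 : mR).
  exact: (measurableT_comp measurable_snd).
by apply: measurable_fun_pair; exact: measurable_funD.
Qed.

Let mwt : measurable_fun (setT : set (mR2 * mR2))
  (fun x : mR2 * mR2 => w (x.1.1 + x.2.1, x.1.2 + x.2.2)%R).
Proof. exact: (measurableT_comp mw measurable_translate_snd). Qed.

Let mwr : measurable_fun (setT : set (mR2 * mR2))
  (fun x : mR2 * mR2 => w (x.1.1 + x.2.1, x.1.2 + x.2.2)%R * (rho (sqnorm x.2))%:E).
Proof.
by apply: emeasurable_funM; [exact: mwt|exact: (measurableT_comp mrn measurable_snd)].
Qed.

Let wr0 z p : 0 <= w (z.1 + p.1, z.2 + p.2)%R * (rho (sqnorm p))%:E.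
Proof. by rewrite mule_ge0// lee_fin. Qed.

Lemma average_ge0 z : 0 <= average rho w z.
Proof. by apply: integral_ge0 => p _; exact: wr0. Qed.

Lemma measurable_average : measurable_fun (setT : set mR2) (average rho w).
Proof.
exact: (@measurable_fun_fubini_tonelli_F _ _ mR2 mR2 R (@plane_measure R) _ mwr
  (fun x => wr0 x.1 x.2)).
Qed.

Let mwz z : measurable_fun (setT : set mR2) (fun p : mR2 => w (z.1 + p.1, z.2 + p.2)%R).
Proof.
apply: (measurableT_comp mw); apply: measurable_fun_pair; exact: measurable_funD.
Qed.

Lemma average_le_integral z : average rho w z <= A%:E * \int[mu2]_p w p.
Proof.
have mwz' : measurable_fun (setT : set mR2) (fun p : mR2 => w (p.1 + z.1, p.2 + z.2)%R).
  by apply: (measurableT_comp mw); apply: measurable_fun_pair; exact: measurable_funD.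
rewrite -(ge0_integral_translate z mw w0).
rewrite -(@ge0_integralZl _ _ _ mu2 _ measurableT _ mwz' A%:E)//.
apply: ge0_le_integral => //=.
- by apply: emeasurable_funM => //; exact: mwz.
- exact: measurable_funeM.
move=> p _; rewrite muleC (addrC z.1) (addrC z.2).
by apply: lee_wpmul2r => //; rewrite lee_fin.
Qed.

Lemma average_le z : supermean B w -> closed_disc z d `<=` B -> average rho w z <= w z.
Proof.
move=> sw zB; have := radial_mean mw w0 sw mrho rho_ge0 rho_out (ltW d_gt0) zB.
by rewrite -/(average rho w z) [X in _ * X]rho_int mule1.
Qed.

Section Cutoff.
Variables (a1 b1 a2 b2 h : R).
Hypothesis h0 : (0 < h)%R.

Let excess (z : R * R) : R := Num.max 0%R (Num.max (Num.max (a1 - z.1) (z.1 - b1))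
  (Num.max (a2 - z.2) (z.2 - b2)))%R.

(** Only the Lipschitz constant [h^-1] of this cutoff enters the estimates, so a
    piecewise linear one suffices. *)
Definition cutoff (z : R * R) : R := Num.max 0%R (1 - excess z / h)%R.

Let excess_ge z : [/\ 0 <= excess z, a1 - z.1 <= excess z, z.1 - b1 <= excess z,
  a2 - z.2 <= excess z & z.2 - b2 <= excess z]%R.
Proof. by rewrite /excess; split; rewrite !le_max lexx ?orbT. Qed.

Let excess_le z e : (0 <= e)%R -> (a1 - z.1 <= e)%R -> (z.1 - b1 <= e)%R ->
  (a2 - z.2 <= e)%R -> (z.2 - b2 <= e)%R -> (excess z <= e)%R.
Proof. by move=> ? ? ? ? ?; rewrite /excess !ge_max; do !(apply/andP; split). Qed.

Lemma cutoff_ge0 z : (0 <= cutoff z)%R.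
Proof. by rewrite /cutoff le_max lexx. Qed.

Lemma cutoff_le1 z : (cutoff z <= 1)%R.
Proof.
have [e0 _ _ _ _] := excess_ge z.
by rewrite /cutoff ge_max ler01/= gerBl divr_ge0// ltW.
Qed.

Lemma cutoff_in z : box a1 b1 a2 b2 z -> cutoff z = 1%R.
Proof.
move=> /boxE[? ? ? ?]; have e0 : excess z = 0%R.
  have [e0 _ _ _ _] := excess_ge z.
  by apply/le_anti; rewrite e0 andbT; apply: excess_le; lra.
by rewrite /cutoff e0 mul0r subr0; apply/max_idPr.
Qed.

Lemma cutoff_out z : ~ box (a1 - h) (b1 + h) (a2 - h) (b2 + h) z -> cutoff z = 0%R.
Proof.
move=> nb; apply/max_idPl; rewrite subr_le0 ler_pdivlMr// mul1r leNgt.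
apply/negP => eh; apply: nb; have [e0 e1 e2 e3 e4] := excess_ge z.
by apply/boxE; split; lra.
Qed.

Lemma cutoff_lip z (p : R * R) (e : R) : (`|p.1| <= e)%R -> (`|p.2| <= e)%R ->
  (cutoff z <= cutoff (z.1 - p.1, z.2 - p.2)%R + e / h)%R.
Proof.
rewrite !ler_norml => /andP[p1 p1'] /andP[p2 p2'].
set z' := (_, _); have [e0 e1 e2 e3 e4] := excess_ge z.
have ee : (excess z' <= excess z + e)%R.
  by move: (excess z) e0 e1 e2 e3 e4 => E ? ? ? ? ?; apply: excess_le; rewrite /z'/=; lra.
have ge0 : (0 <= e / h)%R by apply: divr_ge0; [lra|exact: ltW].
rewrite {1}/cutoff ge_max.
apply/andP; split; first by rewrite addr_ge0// cutoff_ge0.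
apply: (@le_trans _ _ ((1 - excess z' / h) + e / h)%R); last first.
  by rewrite lerD2r /cutoff le_max lexx orbT.
rewrite -addrA lerD2l addrC -mulNr -mulNr -mulrDl ler_pM2r ?invr_gt0//; lra.
Qed.

Lemma measurable_cutoff : measurable_fun (setT : set mR2) (cutoff : mR2 -> mR).
Proof.
apply: measurable_maxr => //; apply: measurable_funB => //.
apply: measurable_funM => //; apply: measurable_maxr => //.
by apply: measurable_maxr; apply: measurable_maxr; exact: measurable_funB.
Qed.

(** Averaging [w] amounts to averaging the test function against which it is
    integrated, and the averaged cutoff is uniformly close to the cutoff.
    Hence the nonnegative function [w - average rho w] has small integral,
    with a bound which involves [w] only through its total mass. *)
Lemma integral_sub_average : \int[mu2]_p w p < +oo ->
  supermean B w ->
  box (a1 - h - d) (b1 + h + d) (a2 - h - d) (b2 + h + d) `<=` B ->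
  \int[mu2]_(z in box a1 b1 a2 b2) (w z - average rho w z)
    <= (d / h)%:E * \int[mu2]_p w p.
Proof.
move=> wfin sw QB.
set av := average rho w; set Q' := box (a1 - h) (b1 + h) (a2 - h) (b2 + h).
have I0 : 0 <= \int[mu2]_p w p by exact: integral_ge0.
have avI := average_le_integral.
move: wfin I0 avI; set I := integral _ _ _ => wfin I0 avI.
have Ifin : I \is a fin_num by rewrite ge0_fin_numE.
have dhe : 0 <= (d / h)%:E by rewrite lee_fin divr_ge0// ltW.
have dh0 : 0 <= (d / h)%:E * I := mule_ge0 dhe I0.
have mav := measurable_average : measurable_fun setT av.
have avfin z : av z \is a fin_num.
  rewrite ge0_fin_numE ?average_ge0//; apply: le_lt_trans (avI z) _.
  by rewrite -(fineK Ifin) -EFinM ltry.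
have mQ' : measurable (Q' : set mR2) by exact: measurable_box.
have avw z : Q' z -> av z <= w z.
  move=> /boxE[? ? ? ?]; apply: (average_le sw); apply: subset_trans QB.
  apply: (subset_trans (closed_disc_sub_sq (ltW d_gt0))).
  by apply: sub_box; rewrite ?lerD2r.
pose psi z : \bar R := (cutoff z)%:E.
have psi0 z : 0 <= psi z by rewrite lee_fin cutoff_ge0.
have psi1 z : psi z <= 1 by rewrite lee_fin cutoff_le1.
have mpsi : measurable_fun (setT : set mR2) psi.
  by apply/measurable_EFinP; exact: measurable_cutoff.
have psiw0 z : 0 <= psi z * w z by exact: mule_ge0.
have psiav0 z : 0 <= psi z * av z by rewrite mule_ge0 ?average_ge0.
have mpw : measurable_fun (setT : set mR2) (fun z : mR2 => psi z * w z).
  exact: emeasurable_funM.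
have mpav : measurable_fun (setT : set mR2) (fun z : mR2 => psi z * av z).
  exact: emeasurable_funM.
have psiw_fin : \int[mu2]_z (psi z * w z) < +oo.
  apply: le_lt_trans wfin; apply: ge0_le_integral => // z _.
  by rewrite -[leRHS]mul1e; apply: lee_wpmul2r.
have mpsishift : measurable_fun (setT : set (mR2 * mR2))
    (fun x : mR2 * mR2 => psi (x.1.1 - x.2.1, x.1.2 - x.2.2)%R).
  apply: (measurableT_comp mpsi); apply: measurable_fun_pair.
    by apply: measurable_funB; [exact: (measurableT_comp measurable_fst measurable_fst)|
      exact: (measurableT_comp measurable_fst measurable_snd)].
  by apply: measurable_funB; [exact: (measurableT_comp measurable_snd measurable_fst)|
      exact: (measurableT_comp measurable_snd measurable_snd)].
pose Xi p := \int[mu2]_z (psi (z.1 - p.1, z.2 - p.2)%R * w z).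
have Xi0 p : 0 <= Xi p by apply: integral_ge0 => z _; exact: mule_ge0.
have mXi : measurable_fun (setT : set mR2) Xi.
  apply: (@measurable_fun_fubini_tonelli_G _ _ mR2 mR2 R (@plane_measure R)
    (fun x => psi (x.1.1 - x.2.1, x.1.2 - x.2.2)%R * w x.1)).
    apply: emeasurable_funM; first exact: mpsishift.
    exact: (measurableT_comp mw measurable_fst).
  by move=> x; exact: mule_ge0.
have mpshift p : measurable_fun (setT : set mR2)
    (fun z : mR2 => psi (z.1 - p.1, z.2 - p.2)%R * w z).
  apply: emeasurable_funM => //.
  exact: (measurableT_comp mpsishift (pair2_measurable p)).
have mwrz z : measurable_fun (setT : set mR2)
    (fun p : mR2 => w (z.1 + p.1, z.2 + p.2)%R * (rho (sqnorm p))%:E).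
  exact: (measurableT_comp mwr (pair1_measurable z)).
have rhoe0 p : 0 <= (rho (sqnorm p))%:E by rewrite lee_fin.
(* Tonelli: the average is transferred from [w] to [psi]. *)
have E1 : \int[mu2]_z (psi z * av z) = \int[mu2]_p ((rho (sqnorm p))%:E * Xi p).
  pose f (x : mR2 * mR2) := psi x.1 *
    (w (x.1.1 + x.2.1, x.1.2 + x.2.2)%R * (rho (sqnorm x.2))%:E).
  have f0 x : 0 <= f x by rewrite mule_ge0.
  have mf : measurable_fun setT f.
    by apply: emeasurable_funM => //; exact: (measurableT_comp mpsi measurable_fst).
  have : \int[mu2]_z \int[mu2]_p f (z, p) = \int[mu2]_p \int[mu2]_z f (z, p).
    exact: (@fubini_tonelli _ _ mR2 mR2 R (@plane_measure R) (@plane_measure R) f mf f0).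
  rewrite /f/= => E; transitivity (\int[mu2]_z \int[mu2]_p (psi z *
      (w ((z.1 + p.1)%R, (z.2 + p.2)%R) * (rho (sqnorm p))%:E))).
    apply: eq_integral => z _.
    by rewrite (ge0_integralZl mu2 measurableT (mwrz z) (fun p _ => wr0 z p) (psi0 z)).
  rewrite E; apply: eq_integral => p _.
  have Xip0 z : 0 <= psi (z.1 - p.1, z.2 - p.2)%R * w z by exact: mule_ge0.
  rewrite /Xi -(ge0_integralZl mu2 measurableT (mpshift p) (fun z _ => Xip0 z) (rhoe0 p)).
  have mZ : measurable_fun (setT : set mR2) (fun z : mR2 => (rho (sqnorm p))%:E *
      (psi (z.1 - p.1, z.2 - p.2)%R * w z)) by exact: measurable_funeM.
  rewrite -(ge0_integral_translate p mZ (fun z => mule_ge0 (rhoe0 p) (Xip0 z))).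
  apply: eq_integral => z _ /=; rewrite !addrK -surjective_pairing.
  by rewrite muleA [RHS]muleC.
(* A shift by at most [d] changes [psi] by at most [d / h]. *)
have E2 : \int[mu2]_z (psi z * w z) <= \int[mu2]_z (psi z * av z) +
    (d / h)%:E * I.
  have J0 : 0 <= \int[mu2]_z (psi z * w z) by exact: integral_ge0.
  have mrk k : measurable_fun (setT : set mR2) (fun p : mR2 => (rho (sqnorm p))%:E * k).
    by apply: emeasurable_funM.
  rewrite E1 -[leLHS]mul1e -{1}rho_int.
  rewrite -(ge0_integralZr mu2 measurableT mrn (fun p _ => rhoe0 p) J0).
  rewrite -[X in _ + X]mul1e -{1}rho_int.
  rewrite -(ge0_integralZr mu2 measurableT mrn (fun p _ => rhoe0 p) dh0).
  rewrite -(ge0_integralD mu2 measurableT (fun p _ => mule_ge0 (rhoe0 p) (Xi0 p))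
    (emeasurable_funM mrn mXi) (fun p _ => mule_ge0 (rhoe0 p) dh0) (mrk _)).
  apply: ge0_le_integral.
  - exact: measurableT.
  - by move=> p _; exact: mule_ge0.
  - exact: mrk.
  - by apply: emeasurable_funD; [exact: (emeasurable_funM mrn mXi)|exact: mrk].
  move=> p _; rewrite -(ge0_muleDr _ (Xi0 p) dh0).
  have [pd|pd] := leP (sqnorm p) (d ^+ 2)%R; last first.
    by rewrite (rho_out pd) !mul0e; exact: lexx.
  apply: lee_wpmul2l; first exact: rhoe0.
  have Xip0 z : 0 <= psi (z.1 - p.1, z.2 - p.2)%R * w z by exact: mule_ge0.
  rewrite -(ge0_integralZl mu2 measurableT mw (fun z _ => w0 z) dhe).
  rewrite -(ge0_integralD mu2 measurableT (fun z _ => Xip0 z) (mpshift p)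
    (fun z _ => mule_ge0 dhe (w0 z)) (measurable_funeM _ mw)).
  apply: ge0_le_integral.
  - exact: measurableT.
  - by move=> z _; exact: psiw0.
  - exact: mpw.
  - by apply: emeasurable_funD; [exact: mpshift|exact: measurable_funeM].
  move=> z _; rewrite -ge0_muleDl; last 2 first.
  - exact: psi0.
  - exact: dhe.
  apply: lee_wpmul2r; first exact: w0.
  rewrite -EFinD lee_fin.
  have pd' : (p.2 ^+ 2 + p.1 ^+ 2 <= d ^+ 2)%R by rewrite addrC.
  apply: cutoff_lip.
    exact: (norm_le_of_sqr (ltW d_gt0) pd).
  exact: (norm_le_of_sqr (ltW d_gt0) pd').
have sub0 z : Q' z -> 0 <= w z - av z.
  by move=> Q'z; rewrite sube_ge0 ?(avw _ Q'z) ?avfin.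
have mwav : measurable_fun (setT : set mR2) (fun z : mR2 => w z - av z).
  exact: emeasurable_funB.
have mpd : measurable_fun (setT : set mR2) (fun z : mR2 => psi z * (w z - av z)).
  exact: emeasurable_funM.
have pd0 z : Q' z -> 0 <= psi z * (w z - av z).
  by move=> Q'z; apply: mule_ge0; [exact: psi0|exact: sub0].
have mQ : measurable (box a1 b1 a2 b2 : set mR2) by exact: measurable_box.
apply: (@le_trans _ _ (\int[mu2]_(z in Q') (psi z * (w z - av z)))).
  apply: (@le_trans _ _ (\int[mu2]_(z in box a1 b1 a2 b2) (psi z * (w z - av z)))).
    rewrite le_eqVlt; apply/orP; left; apply/eqP; apply: eq_integral => z.
    by rewrite inE => Qz; rewrite /psi (cutoff_in Qz) mul1e.
  apply: ge0_subset_integral.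
  - exact: mQ.
  - exact: mQ'.
  - exact: measurable_funTS.
  - exact: pd0.
  - by apply: sub_box; rewrite ?gerBl ?lerDl; exact: ltW.
have av_fin : \int[mu2]_(z in Q') (psi z * av z) \is a fin_num.
  rewrite ge0_fin_numE; last by apply: integral_ge0 => z _; exact: psiav0.
  apply: le_lt_trans psiw_fin.
  apply: (@le_trans _ _ (\int[mu2]_(z in Q') (psi z * w z))).
    apply: ge0_le_integral; [exact: mQ'| by move=> z _; exact: psiav0|
      exact: measurable_funTS|exact: measurable_funTS|].
    by move=> z Q'z; apply: lee_wpmul2l; [exact: psi0|exact: avw].
  apply: ge0_subset_integral; [exact: mQ'|exact: measurableT|exact: mpw|
    by move=> z _; exact: psiw0|exact: subsetT].
have res (g : R * R -> \bar R) : \int[mu2]_z (psi z * g z) = \int[mu2]_(z in Q') (psi z * g z).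
  rewrite [RHS]integral_mkcond; apply: eq_integral => z _; rewrite patchE.
  case: ifPn => [_|/negP nQ]; first reflexivity.
  rewrite /psi (cutoff_out (fun Qz => nQ (mem_set Qz))) mul0e; reflexivity.
move: E2; rewrite !res.
have -> : \int[mu2]_(z in Q') (psi z * w z) = \int[mu2]_(z in Q') (psi z * av z) +
    \int[mu2]_(z in Q') (psi z * (w z - av z)).
  rewrite -(ge0_integralD mu2 mQ' (fun z _ => psiav0 z) (measurable_funTS mpav)
    pd0 (measurable_funTS mpd)).
  apply: eq_integral => z; rewrite inE => Q'z.
  rewrite -(ge0_muleDr _ (average_ge0 z) (sub0 z Q'z)); congr (_ * _).
  by rewrite addeC (subeK _ (avfin z)).
rewrite leeD2lE; last exact: av_fin.
exact.
Qed.

End Cutoff.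

End Averages.

(** * Smooth functions of two variables *)

Section SmoothBump.
Context {R : realType}.
Local Open Scope ring_scope.
Implicit Types (f g : R * R -> R) (z v : R * R).

Lemma is_derive_slice f z v (df : R) :
  is_derive z v f df <-> is_derive (0 : R) 1 (fun h : R => f (h *: v + z)) df.
Proof.
have E : (fun h : R => h^-1 *: ((f \o shift z) (h *: v) - f z)) =
    (fun h : R => h^-1 *: (((fun k : R => f (k *: v + z)) \o shift 0) (h *: (1 : R)) -
      f ((0 : R) *: v + z))).
  by apply/funext => h /=; rewrite scale0r add0r addr0 /GRing.scale/= mulr1.
split => -[d1 d2]; split.
- by rewrite /derivable -E.
- by rewrite -d2 /derive -E.
- by rewrite /derivable E.
- by rewrite -d2 /derive E.
Qed.

Lemma is_derive_line f z v (t : R) :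
  (forall z, derivable f z v) ->
  is_derive t 1 (fun h : R => f (h *: v + z)) ('D_v f (t *: v + z)).
Proof.
move=> df; have /derivableP/is_derive_slice [d1 d2] := df (t *: v + z).
have E : (fun h : R => f (h *: v + (t *: v + z))) = (fun h : R => f (h *: v + z)) \o shift t.
  by apply/funext => h /=; rewrite addrA -scalerDl.
have E2 : (fun h : R => h^-1 *: (((fun h : R => f (h *: v + (t *: v + z))) \o shift 0)
       (h *: (1 : R)) - f ((0 : R) *: v + (t *: v + z)))) =
    (fun h : R => h^-1 *: (((fun h : R => f (h *: v + z)) \o shift t) (h *: (1 : R)) -
      f (t *: v + z))).
  by apply/funext => h; rewrite E /= addr0 scale0r add0r.
split; first by rewrite /derivable -E2.
by rewrite -d2 /derive -E2.
Qed.

Lemma directional_MVT f z v (h B : R) :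
  (forall z, derivable f z v) -> (forall z, `|'D_v f z| <= B) ->
  `|f (h *: v + z) - f z| <= B * `|h|.
Proof.
move=> df dB.
pose g (t : R) := f (t *: v + z).
have dg (t : R) : is_derive t (1 : R) g ('D_v f (t *: v + z)) by exact: is_derive_line.
have cg : continuous g.
  move=> t; apply/differentiable_continuous/derivable1_diffP.
  by have [] := dg t.
have cgw a b : {within `[a, b], continuous g} by exact: continuous_subspaceT.
have -> : f (h *: v + z) - f z = g h - g 0.
    by congr (_ - _); rewrite /g scale0r add0r.
have [h0|h0] := leP 0 h.
  have [c _ ->] := MVT_segment h0 (fun t _ => dg t) (cgw 0 h).
  by rewrite subr0 normrM; apply: ler_wpM2r.
have [c _ E] := MVT_segment (ltW h0) (fun t _ => dg t) (cgw h 0).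
by rewrite distrC E sub0r normrM normrN; apply: ler_wpM2r.
Qed.

Lemma directional_taylor f z v (h B : R) :
  (forall z, derivable f z v) -> (forall z, derivable ('D_v f) z v) ->
  (forall z, `|'D_v ('D_v f) z| <= B) ->
  `|f (h *: v + z) - f z - h * 'D_v f z| <= B * h ^+ 2.
Proof.
move=> df ddf dB.
have B0 : 0 <= B by exact: le_trans (dB z).
pose g (t : R) := f (t *: v + z).
have dg (t : R) : is_derive t (1 : R) g ('D_v f (t *: v + z)) by exact: is_derive_line.
have cg : continuous g.
  move=> t; apply/differentiable_continuous/derivable1_diffP.
  by have [] := dg t.
have cgw a b : {within `[a, b], continuous g} by exact: continuous_subspaceT.
have [c ch E] : exists2 c, `|c| <= `|h| & f (h *: v + z) - f z = 'D_v f (c *: v + z) * h.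
  have -> : f (h *: v + z) - f z = g h - g 0.
    by congr (_ - _); rewrite /g scale0r add0r.
  have [h0|h0] := leP 0 h.
    have [c] := MVT_segment h0 (fun t _ => dg t) (cgw 0 h).
    rewrite in_itv/= subr0 => /andP[c0 ch] E; exists c => //.
    by rewrite !ger0_norm.
  have [c] := MVT_segment (ltW h0) (fun t _ => dg t) (cgw h 0).
  rewrite in_itv/= sub0r => /andP[hc c0] E; exists c.
    by rewrite !ler0_norm ?lerN2// ltW.
  by rewrite -opprB E mulrN opprK.
rewrite E mulrC -mulrBr normrM.
have := directional_MVT z c ddf dB => H.
have -> : B * h ^+ 2 = `|h| * (B * `|h|).
  by rewrite [RHS]mulrCA -expr2 real_normK ?num_real.
apply: ler_wpM2l => //; apply: le_trans H _.
exact: ler_wpM2l.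
Qed.

(** This criterion serves where no calculus rule applies: for [flat n] at [0], and
    for infinite superpositions. *)
Lemma is_derive_of_sqr_bound (V : normedModType R) (f : V -> R) (z v : V) (df C : R) :
  (forall h : R, `|f (h *: v + z) - f z - h * df| <= C * h ^+ 2) -> is_derive z v f df.
Proof.
move=> fC.
have C0 : 0 <= C by have := fC 1; rewrite expr1n mulr1; exact: le_trans.
suff L : (fun h : R => h^-1 *: ((f \o shift z) (h *: v) - f z)) @ 0^' --> df.
  by split; [apply/cvg_ex; exists df|exact/cvg_lim].
apply/cvgrPdist_le => e e0; near=> h.
have h0 : h != 0 by near: h; exact: nbhs_dnbhs_neq.
have he : `|h| <= e / (C + 1).
  by near: h; apply: dnbhs0_le; rewrite divr_gt0//; lra.
have -> : df - h^-1 *: ((f \o shift z) (h *: v) - f z) =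
    - (h^-1 * (f (h *: v + z) - f z - h * df)).
  by rewrite /GRing.scale/=; field.
rewrite normrN normrM normfV.
rewrite ler_pdivrMl ?normr_gt0//; apply: le_trans (fC h) _.
rewrite -[h ^+ 2]real_normK ?num_real// expr2 mulrCA.
apply: ler_wpM2l => //; apply: (@le_trans _ _ ((C + 1) * `|h|)).
  by apply: ler_wpM2r => //; lra.
by rewrite mulrC -ler_pdivlMr//; lra.
Unshelve. all: by end_near.
Qed.

Local Notation dx f := ('D_((1, 0) : R * R) f).
Local Notation dy f := ('D_((0, 1) : R * R) f).

(** [Ck] asks for the continuity of the derivatives of top order only.  Requiring it
    at every order makes stability under products an immediate induction. *)
Fixpoint Cks (k : nat) f : Prop :=
  continuous f /\ (if k is k'.+1 then
    [/\ forall z, derivable f z (1, 0), forall z, derivable f z (0, 1),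
        Cks k' (dx f) & Cks k' (dy f)]
  else True).

Lemma Cks_Ck k f : Cks k f -> Ck k f.
Proof. elim: k f => [|k IH] f [cf]; first by [].
by move=> [d1 d2 s1 s2]; split; [exact: d1|exact: d2|exact: IH|exact: IH]. Qed.

Lemma Cks_cont k f : Cks k f -> continuous f.
Proof. by case: k => [|k] []. Qed.

Lemma Cks_le k f : Cks k.+1 f -> Cks k f.
Proof.
elim: k f => [|k IH] f [cf [d1 d2 s1 s2]]; first exact: conj cf I.
split; first exact: cf.
by split; [exact: d1|exact: d2|exact: IH s1|exact: IH s2].
Qed.

Lemma CksI k f (f1 f2 : R * R -> R) : continuous f ->
  (forall z, is_derive z (1, 0) f (f1 z)) -> (forall z, is_derive z (0, 1) f (f2 z)) ->
  Cks k f1 -> Cks k f2 -> Cks k.+1 f.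
Proof.
move=> cf d1 d2 s1 s2; split; first exact: cf.
have e1 : dx f = f1 by apply/funext => z; have [_ ->] := d1 z.
have e2 : dy f = f2 by apply/funext => z; have [_ ->] := d2 z.
split; [|by move=> z; have [] := d2 z|by rewrite e1|by rewrite e2].
by move=> z; have [] := d1 z.
Qed.

Lemma CksE k f : Cks k.+1 f ->
  [/\ forall z, is_derive z (1, 0) f (dx f z), forall z, is_derive z (0, 1) f (dy f z),
      Cks k (dx f) & Cks k (dy f)].
Proof. move=> [_ [d1 d2 s1 s2]]; split; [|by move=> z; exact: derivableP|exact: s1|exact: s2].
by move=> z; exact: derivableP. Qed.

Lemma Cks_cst k (c : R) : Cks k (cst c).
Proof.
elim: k c => [|k IH] c; first by split => // z; exact: cvg_cst.
exact: (@CksI k (cst c) (cst 0) (cst 0) (fun z => @cvg_cst _ _ _ _ _)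
  (fun z => is_derive_cst _ _ _) (fun z => is_derive_cst _ _ _) (IH 0) (IH 0)).
Qed.

Lemma CksD k f g : Cks k f -> Cks k g -> Cks k (f + g).
Proof.
elim: k f g => [|k IH] f g sf sg.
  split => // z; apply: continuousD.
    exact: (Cks_cont sf).
  exact: (Cks_cont sg).
have [f1 f2 sf1 sf2] := CksE sf; have [g1 g2 sg1 sg2] := CksE sg.
have cfg : continuous (f + g).
  move=> z; apply: continuousD.
    exact: (Cks_cont sf).
  exact: (Cks_cont sg).
exact: (@CksI k (f + g) (dx f + dx g) (dy f + dy g) cfg (fun z => is_deriveD (f1 z) (g1 z))
  (fun z => is_deriveD (f2 z) (g2 z)) (IH _ _ sf1 sg1) (IH _ _ sf2 sg2)).
Qed.

Lemma CksM k f g : Cks k f -> Cks k g -> Cks k (f * g).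
Proof.
elim: k f g => [|k IH] f g sf sg.
  split => // z; apply: continuousM.
    exact: (Cks_cont sf).
  exact: (Cks_cont sg).
have [f1 f2 sf1 sf2] := CksE sf; have [g1 g2 sg1 sg2] := CksE sg.
have kf := Cks_le sf; have kg := Cks_le sg.
have cfg : continuous (f * g).
  move=> z; apply: continuousM.
    exact: (Cks_cont sf).
  exact: (Cks_cont sg).
exact: (@CksI k (f * g) (f * dx g + g * dx f) (f * dy g + g * dy f) cfg
  (fun z => is_deriveM (f1 z) (g1 z)) (fun z => is_deriveM (f2 z) (g2 z))
  (CksD (IH _ _ kf sg1) (IH _ _ kg sf1)) (CksD (IH _ _ kf sg2) (IH _ _ kg sf2))).
Qed.

Lemma is_derive_fst z v : is_derive z v (fst : R * R -> R) v.1.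
Proof.
apply/is_derive_slice; rewrite (_ : (fun h : R => _) = (fun h : R => h * v.1 + z.1))//.
by apply: is_derive_eq; rewrite /GRing.scale/= mulr0 add0r mulr1 addr0.
Qed.

Lemma is_derive_snd z v : is_derive z v (snd : R * R -> R) v.2.
Proof.
apply/is_derive_slice; rewrite (_ : (fun h : R => _) = (fun h : R => h * v.2 + z.2))//.
by apply: is_derive_eq; rewrite /GRing.scale/= mulr0 add0r mulr1 addr0.
Qed.

Lemma Cks_fst k : Cks k (fst : R * R -> R).
Proof.
case: k => [|k]; first by split => // z; exact: cvg_fst.
have c1 : continuous (fst : R * R -> R) by move=> z; exact: cvg_fst.
have d1 z : is_derive z (1, 0) (fst : R * R -> R) ((cst 1) z) by exact: (is_derive_fst z (1, 0)).
have d2 z : is_derive z (0, 1) (fst : R * R -> R) ((cst 0) z) by exact: (is_derive_fst z (0, 1)).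
exact: (CksI c1 d1 d2 (Cks_cst k 1) (Cks_cst k 0)).
Qed.

Lemma Cks_snd k : Cks k (snd : R * R -> R).
Proof.
case: k => [|k]; first by split => // z; exact: cvg_snd.
have c1 : continuous (snd : R * R -> R) by move=> z; exact: cvg_snd.
have d1 z : is_derive z (1, 0) (snd : R * R -> R) ((cst 0) z) by exact: (is_derive_snd z (1, 0)).
have d2 z : is_derive z (0, 1) (snd : R * R -> R) ((cst 1) z) by exact: (is_derive_snd z (0, 1)).
exact: (CksI c1 d1 d2 (Cks_cst k 0) (Cks_cst k 1)).
Qed.

(** The functions [s^-n exp (- 1 / s)], extended by [0]: the class
    that they span is closed under differentiation. *)
Definition flat (n : nat) (s : R) : R :=
  if 0 < s then s^-1 ^+ n * expR (- s^-1) else 0.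

Lemma flat_ge0 n s : 0 <= flat n s.
Proof.
rewrite /flat; case: ifP => // s0; rewrite mulr_ge0 ?expR_ge0// exprn_ge0//.
by rewrite invr_ge0 ltW.
Qed.

(** The exponential dominates the term of degree [n.+2] of its series at [s^-1]. *)
Lemma flat_le_sqr n s : flat n s <= (n.+2)`!%:R * s ^+ 2.
Proof.
rewrite /flat; case: ifP => s0; last by rewrite mulr_ge0 ?sqr_ge0.
have x0 : 0 < s^-1 by rewrite invr_gt0.
have f0 : 0 < (n.+2)`!%:R :> R by rewrite ltr0n fact_gt0.
have := expR_ge1Dxn n.+1 (ltW x0) => E.
have {}E : s^-1 ^+ n.+2 / (n.+2)`!%:R <= expR s^-1.
  by apply: le_trans E; rewrite lerDr.
rewrite expRN ler_pdivrMr ?expR_gt0//.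
apply: (@le_trans _ _ ((n.+2)`!%:R * s ^+ 2 * (s^-1 ^+ n.+2 / (n.+2)`!%:R))); last first.
  by apply: ler_wpM2l => //; rewrite mulr_ge0 ?sqr_ge0.
rewrite le_eqVlt; apply/orP; left; apply/eqP.
rewrite -addn2 exprD !exprVn; field.
by rewrite expf_neq0 ?gt_eqF.
Qed.

Lemma is_derive_flat n (s : R) :
  is_derive s (1 : R) (flat n) (- n%:R * flat n.+1 s + flat n.+2 s).
Proof.
have [s0|s0|s0] := ltgtP s 0.
- rewrite /flat !ifF; try by apply/negbTE; rewrite -leNgt ltW.
  rewrite mulr0 addr0.
  suff h : \near s, cst 0 s = (if 0 < s then s^-1 ^+ n * expR (- s^-1) else 0).
    exact: (near_eq_is_derive h (is_derive_cst _ _ _)).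
  near=> t; rewrite ifF//; apply/negbTE; rewrite -leNgt; apply: ltW.
  by near: t; exact: lt_nbhsl.
- suff h : is_derive s 1 (fun s => s^-1 ^+ n * expR (- s^-1))
     (- n%:R * flat n.+1 s + flat n.+2 s).
    apply: near_eq_is_derive h.
    by near=> t; rewrite /flat ifT//; near: t; exact: lt_nbhsr.
  rewrite /flat s0.
  have sn0 : s != 0 by rewrite gt_eqF.
  have d1 : is_derive s 1 (fun x : R => x^-1) (- s ^- 2).
    have := @is_deriveV R id s 1 1 sn0 (is_derive_id _ _).
    by rewrite /GRing.scale/= mulr1.
  have d2 : is_derive s 1 (fun x : R => expR (- x^-1)) (s ^- 2 * expR (- s^-1)).
    have d3 : is_derive s 1 (fun x : R => - x^-1) (s ^- 2).
      by have := is_deriveN d1; rewrite opprK.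
    by have := @is_derive1_comp _ expR (fun x : R => - x^-1) s _ _ (is_derive_expR _) d3;
       rewrite mulrC.
  have d4 : is_derive s 1 (fun x : R => x^-1 ^+ n) (- n%:R * s^-1 ^+ n.+1).
    have := is_deriveX n d1; rewrite exprfctE.
    rewrite (_ : (_ *: _) = - n%:R * s^-1 ^+ n.+1)//.
    case: n => [|m]; first by rewrite mul0r scale0r oppr0 mul0r.
    by rewrite /GRing.scale/= -exprVn; move: (s^-1) => x; rewrite !exprSr expr0; ring.
  have := is_deriveM d4 d2; rewrite (_ : (_ *: _ + _) =
     - n%:R * (s^-1 ^+ n.+1 * expR (- s^-1)) + s^-1 ^+ n.+2 * expR (- s^-1))//.
  rewrite /GRing.scale/= -exprVn; move: (s^-1) (expR _) => x E.
  by rewrite !exprSr expr0; ring.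
- have f0 m : flat m 0 = 0 by rewrite /flat ltxx.
  rewrite s0 !f0 mulr0 addr0; apply: (@is_derive_of_sqr_bound _ _ _ _ _ (n.+2)`!%:R) => h.
  rewrite f0 mulr0 !subr0 /GRing.scale/= mulr1 addr0 ger0_norm ?flat_ge0//.
  exact: flat_le_sqr.
Unshelve. all: by end_near.
Qed.

End SmoothBump.

(** * Test functions supported in boxes *)

Section SmoothSupport.
Context {R : realType}.
Local Open Scope ring_scope.
Implicit Types (f g : R * R -> R) (z v : R * R).
Local Notation dx f := ('D_((1, 0) : R * R) f).
Local Notation dy f := ('D_((0, 1) : R * R) f).

Lemma smooth_Cks f k : smooth f -> Cks k f.
Proof.
elim: k f => [|k IH] f sf; first by split; [exact: (sf 0%N)|].
have [d1 d2 _ _] := sf 1%N.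
split; first exact: (sf 0%N).
split; [exact: d1|exact: d2| |].
  by apply: IH => n; have [] := sf n.+1.
by apply: IH => n; have [] := sf n.+1.
Qed.

(** The enclosing box is kept explicit because pairings are computed as integrals
    over it. *)
Definition bumpfun (a b c d : R) f : Prop :=
  (forall k, Cks k f) /\ (forall z, ~ box a b c d z -> f z = 0).

Lemma closed_box (a b c d : R) : closed (box a b c d).
Proof. by apply: compact_closed; [exact: norm_hausdorff|exact: compact_box]. Qed.

Lemma derive_off_support (a b c d : R) f v z : (forall z, ~ box a b c d z -> f z = 0) ->
  ~ box a b c d z -> 'D_v f z = 0.
Proof.
move=> f0 zb; rewrite -(@derive_val _ _ _ z v (cst (0 : R)) 0 (is_derive_cst _ _ _)).
apply: near_eq_derive.
have := open_nbhs_nbhs (conj (closed_openC (@closed_box a b c d)) zb).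
by apply: filterS => w wb; rewrite f0.
Qed.

Lemma bumpfun_dx (a b c d : R) f : bumpfun a b c d f -> bumpfun a b c d (dx f).
Proof.
move=> [sf f0]; split; last by move=> z; exact: derive_off_support.
by move=> k; have [_ [_ _]] := sf k.+1.
Qed.

Lemma bumpfun_dy (a b c d : R) f : bumpfun a b c d f -> bumpfun a b c d (dy f).
Proof.
move=> [sf f0]; split; last by move=> z; exact: derive_off_support.
by move=> k; have [_ [_ _]] := sf k.+1.
Qed.

Lemma bumpfun_bounded (a b c d : R) f : bumpfun a b c d f ->
  exists2 B : R, 0 <= B & forall z, `|f z| <= B.
Proof.
move=> [sf f0].
have [[z0 bz0]|nb] := pselect (box a b c d !=set0); last first.
  by exists 0 => // z; rewrite f0 ?normr0// => bz; apply: nb; exists z.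
have cf : continuous (fun z => `|f z|).
  by move=> z; apply: cvg_norm; exact: (Cks_cont (sf 0%N)).
have [m _ mP] := compact_EVT_max (ex_intro _ z0 bz0) (@compact_box R a b c d)
  (continuous_subspaceT cf).
exists `|f m| => // z; have [bz|bz] := pselect (box a b c d z).
  by apply: mP; rewrite inE.
by rewrite f0// normr0.
Qed.

Lemma bumpfun_derivable (a b c d : R) f : bumpfun a b c d f ->
  (forall z, derivable f z (1, 0)) /\ (forall z, derivable f z (0, 1)).
Proof. by move=> [sf _]; have [_ [d1 d2 _ _]] := sf 1%N. Qed.

Lemma bumpfun_lip (a b c d : R) f : bumpfun a b c d f ->
  exists2 L : R, 0 <= L & forall z z', `|f z - f z'| <= L * (`|z.1 - z'.1| + `|z.2 - z'.2|).
Proof.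
move=> bf; have [B1 B10 B1P] := bumpfun_bounded (bumpfun_dx bf).
have [B2 B20 B2P] := bumpfun_bounded (bumpfun_dy bf).
have [d1 d2] := bumpfun_derivable bf.
exists (B1 + B2); first exact: addr_ge0.
move=> z z'; pose y := (z'.1, z.2).
have e1 : z = (z.1 - z'.1) *: ((1, 0) : R * R) + y.
  rewrite [LHS]surjective_pairing; congr (_, _).
    by rewrite /= /GRing.scale/= mulr1 subrK.
  by rewrite /= /GRing.scale/= mulr0 add0r.
have e2 : y = (z.2 - z'.2) *: ((0, 1) : R * R) + z'.
  rewrite [LHS]surjective_pairing; congr (_, _).
    by rewrite /= /GRing.scale/= mulr0 add0r.
  by rewrite /= /GRing.scale/= mulr1 subrK.
have h1 : `|f z - f y| <= B1 * `|z.1 - z'.1|.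
  by have := directional_MVT y (z.1 - z'.1) d1 B1P; rewrite -e1.
have h2 : `|f y - f z'| <= B2 * `|z.2 - z'.2|.
  by have := directional_MVT z' (z.2 - z'.2) d2 B2P; rewrite -e2.
have := ler_normD (f z - f y) (f y - f z'); rewrite addrA subrK.
have := normr_ge0 (z.1 - z'.1); have := normr_ge0 (z.2 - z'.2).
move: h1 h2; move: (`|f z - f y|) (`|f y - f z'|) (`|f z - f z'|) (`|z.1 - z'.1|) (`|z.2 - z'.2|).
move=> p q r s t; nra.
Qed.

Lemma lip_continuous f (L : R) :
  (forall z z', `|f z - f z'| <= L * (`|z.1 - z'.1| + `|z.2 - z'.2|)) -> continuous f.
Proof.
move=> fL z; apply/cvgrPdist_le => e e0.
have L0 : 0 <= L.
  have := fL (1, 0) (0, 0); rewrite /= subr0 subrr normr0 addr0 normr1 mulr1.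
  exact: le_trans.
pose r := e / (2 * (L + 1)).
have r0 : 0 < r by rewrite divr_gt0//; lra.
have : nbhs z (ball z r) by exact: nbhsx_ballx.
apply: filterS => z' [/= b1 b2]; apply: le_trans (fL z z') _.
have {}b1 : `|z.1 - z'.1| <= r by exact: ltW.
have {}b2 : `|z.2 - z'.2| <= r by exact: ltW.
have E : (L + 1) * (r + r) = e by rewrite /r; field; lra.
rewrite -E; apply: (@le_trans _ _ (L * (r + r))).
  by apply: ler_wpM2l => //; exact: lerD.
by apply: ler_wpM2r; lra.
Qed.

Lemma bumpfun_test_function S (a b c d : R) f : bumpfun a b c d f ->
  box a b c d `<=` S -> test_function S f.
Proof.
move=> [sf f0] bS.
have cl : closure [set z | f z != 0] `<=` box a b c d.
  rewrite [X in _ `<=` X]((closure_id _).1 (@closed_box a b c d)).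
  apply: closureS => z /= fz; apply: contrapT => bz.
  by rewrite f0 ?eqxx in fz.
split; last exact: subset_trans bS.
  by move=> k; exact: Cks_Ck.
exact: (subclosed_compact (@closed_closure _ _) (@compact_box R a b c d) cl).
Qed.

(** The coordinates attain their bounds on the compact support, at points of the
    strip; the zero function is apart, its support being empty. *)
Lemma test_function_bumpfun (a b : \bar R) f : test_function (strip a b) f ->
  exists x1 x2 y1 y2 : R, [/\ bumpfun x1 x2 y1 y2 f,
    x1 <= x2, y1 <= y2, (a < y1%:E)%E & (y2%:E < b)%E] \/ (forall z, f z = 0).
Proof.
move=> [sf cK KS]; set K := closure _ in cK KS.
have [[z0 Kz0]|nK] := pselect (K !=set0); last first.
  exists 0, 0, 0, 0; right => z; apply/eqP; apply: contrapT => /negP fz; apply: nK.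
  by exists z; exact: subset_closure.
have ext (p : R * R -> R) : continuous p -> exists m M, [/\ K m, K M &
    forall z, K z -> p m <= p z <= p M].
  move=> cp.
  have [M KM MP] := compact_EVT_max (ex_intro _ z0 Kz0) cK (continuous_subspaceT cp).
  have [m Km mP] := compact_EVT_min (ex_intro _ z0 Kz0) cK (continuous_subspaceT cp).
  exists m, M; split; [by rewrite inE in Km|by rewrite inE in KM|].
  by move=> z Kz; apply/andP; split; [apply: mP|apply: MP]; rewrite inE.
have [m1 [M1 [Km1 KM1 P1]]] := ext fst (Cks_cont (Cks_fst 0)).
have [m2 [M2 [Km2 KM2 P2]]] := ext snd (Cks_cont (Cks_snd 0)).
exists m1.1, M1.1, m2.2, M2.2; left; split.
- split; first by move=> k; exact: smooth_Cks.
  move=> z bz; apply/eqP; apply: contrapT => /negP fz; apply: bz.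
  have Kz : K z by exact: subset_closure.
  by apply/boxE; have /andP[? ?] := P1 z Kz; have /andP[? ?] := P2 z Kz.
- by have /andP[] := P1 _ KM1.
- by have /andP[] := P2 _ KM2.
- by have [] := KS _ Km2.
- by have [] := KS _ KM2.
Qed.

Lemma is_derive_comp1 (phi : R -> R) f z v (p df : R) :
  is_derive (f z) 1 phi p -> is_derive z v f df -> is_derive z v (phi \o f) (p * df).
Proof.
move=> dphi /is_derive_slice dfs; apply/is_derive_slice.
have dphi' : is_derive (f ((0 : R) *: v + z)) 1 phi p by rewrite scale0r add0r.
exact: (@is_derive1_comp _ phi (fun h : R => f (h *: v + z)) 0 _ _ dphi' dfs).
Qed.

Lemma Cks_flat_comp k n f : (forall k, Cks k f) -> Cks k (flat n \o f).
Proof.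
move=> sf; have cont m : continuous (flat m \o f).
  move=> z; apply: continuous_comp; first exact: (Cks_cont (sf 0%N)).
  apply/differentiable_continuous/derivable1_diffP.
  by have [] := is_derive_flat m (f z).
elim: k n => [|k IH] n; first by split; [exact: cont|].
have [f1 f2 sf1 sf2] := CksE (sf k.+1).
pose p := (cst (- n%:R) * (flat n.+1 \o f) + (flat n.+2 \o f)) : R * R -> R.
have sp : Cks k p by apply: CksD; [apply: CksM; [exact: Cks_cst|exact: IH]|exact: IH].
exact: (@CksI _ k (flat n \o f) (p * dx f) (p * dy f) (cont n)
  (fun z => is_derive_comp1 (is_derive_flat n (f z)) (f1 z))
  (fun z => is_derive_comp1 (is_derive_flat n (f z)) (f2 z))
  (CksM sp sf1) (CksM sp sf2)).
Qed.

Lemma flat0_le1 (s : R) : flat 0 s <= 1.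
Proof.
rewrite /flat; case: ifP => // s0; rewrite expr0 mul1r -expR0 ler_expR.
by rewrite oppr_le0 invr_ge0 ltW.
Qed.

(** The argument of [flat 0] is a polynomial, positive exactly in the open disc of
    radius [d]. *)
Lemma bumpfun_flat (d k y : R) : 0 < d ->
  bumpfun (- d) d (y - d) (y + d) (fun z => k * flat 0 (d ^+ 2 - sqnorm (z.1, z.2 - y))).
Proof.
move=> d0; split.
  move=> n; pose p := (snd + cst (- y)) : R * R -> R.
  pose q := (cst (d ^+ 2) + cst (- 1) * (fst * fst + p * p)) : R * R -> R.
  have sp m : Cks m p by apply: CksD; [exact: Cks_snd|exact: Cks_cst].
  have sq m : Cks m q.
    have ss := CksD (CksM (@Cks_fst R m) (@Cks_fst R m)) (CksM (sp m) (sp m)).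
    exact: (CksD (Cks_cst _ _) (CksM (Cks_cst _ _) ss)).
  have := CksM (Cks_cst n k) (Cks_flat_comp n 0 sq).
  rewrite (_ : _ * _ = (fun z => k * flat 0 (d ^+ 2 - sqnorm (z.1, z.2 - y))))//.
  apply/funext => z.
  rewrite -[LHS]/(k * flat 0 (d ^+ 2 + (-1) * (z.1 * z.1 + (z.2 - y) * (z.2 - y)))) /sqnorm/=.
  by congr (_ * flat 0 _); ring.
move=> z bz; rewrite /flat ifF ?mulr0//; apply/negbTE; rewrite -leNgt subr_le0 leNgt.
apply/negP => zd; apply: bz.
have /(closed_disc_sub_sq (ltW d0))/boxE/= : closed_disc (0, y) d z.
  by rewrite /closed_disc/= subr0; exact: ltW.
by rewrite sub0r add0r => -[? ? ? ?]; apply/boxE.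
Qed.

End SmoothSupport.

(** * Infinite superpositions of translated test functions *)

Section Superposition.
Context {R : realType}.
Local Open Scope ring_scope.
Implicit Types (f g : R * R -> R) (z v : R * R).
Local Notation dx f := ('D_((1, 0) : R * R) f).
Local Notation dy f := ('D_((0, 1) : R * R) f).
Variables (c : nat -> R) (y : nat -> R).
Hypothesis cc : cvgn (series (fun j => `|c j|)).

Definition wsum (g : nat -> R) : R := limn (series (fun j => c j * g j)).

Let T : R := limn (series (fun j => `|c j|)).

Lemma is_cvg_wsum (g : nat -> R) (B : R) : (forall j, `|g j| <= B) ->
  cvgn (series (fun j => c j * g j)) /\ `|wsum g| <= B * T.
Proof.
move=> gB; have B0 : 0 <= B by exact: le_trans (gB 0%N).
have cB : cvgn (series (B *: (fun j => `|c j|) : nat -> R)) by exact: is_cvg_seriesZ.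
have le j : `|c j * g j| <= (B *: (fun j => `|c j|) : nat -> R) j.
  by rewrite normrM mulrC; apply: ler_wpM2r.
have nc : cvgn [normed series (fun j => c j * g j)].
  apply: series_le_cvg cB; [by move=> j; exact: normr_ge0| |exact: le].
  by move=> j; exact: (mulr_ge0 B0 (normr_ge0 (c j))).
split; first exact: (@normed_cvg _ R^o).
apply: le_trans (@lim_series_norm _ R^o _ nc) _.
have -> : B * T = limn (series (B *: (fun j => `|c j|) : nat -> R)).
  by rewrite lim_seriesZ.
by apply: lim_series_le => //.
Qed.

Lemma wsum_lin (g1 g2 : nat -> R) (k B1 B2 : R) :
  (forall j, `|g1 j| <= B1) -> (forall j, `|g2 j| <= B2) ->
  wsum (fun j => g1 j - k * g2 j) = wsum g1 - k * wsum g2.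
Proof.
move=> /is_cvg_wsum[c1 _] /is_cvg_wsum[c2 _].
have ck : cvgn (series (k *: (fun j => c j * g2 j) : nat -> R)) by exact: is_cvg_seriesZ.
rewrite /wsum.
have -> : (fun j => c j * (g1 j - k * g2 j)) = (fun j => c j * g1 j) -
    (k *: (fun j => c j * g2 j) : nat -> R).
  by apply/funext => j; rewrite mulrBr mulrCA.
by rewrite lim_seriesB// lim_seriesZ.
Qed.

Definition superpose f z : R := wsum (fun j => f (z.1, z.2 - y j)).

Lemma bumpfun_wsum_bound x1 x2 y1 y2 f : bumpfun x1 x2 y1 y2 f ->
  exists B, forall z j, `|f (z.1, z.2 - y j)| <= B.
Proof. by move=> /bumpfun_bounded[B _ fB]; exists B. Qed.

Lemma superpose_continuous x1 x2 y1 y2 f : bumpfun x1 x2 y1 y2 f ->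
  continuous (superpose f).
Proof.
move=> bf; have [B fB] := bumpfun_wsum_bound bf.
have [L L0 fL] := bumpfun_lip bf.
apply: (@lip_continuous _ _ (L * T)) => z z'.
have E : superpose f z - superpose f z' =
    wsum (fun j => f (z.1, z.2 - y j) - 1 * f (z'.1, z'.2 - y j)).
  by rewrite (wsum_lin 1 (fB z) (fB z')) mul1r.
rewrite E mulrAC; apply: (is_cvg_wsum _).2 => j; rewrite mul1r.
apply: le_trans (fL _ _) _; rewrite /= (_ : z.2 - y j - (z'.2 - y j) = z.2 - z'.2)//.
by ring.
Qed.

(** Taylor's bound is uniform in [j], so it can be summed. *)
Lemma superpose_derive x1 x2 y1 y2 f v : bumpfun x1 x2 y1 y2 f ->
  (v = (1, 0) \/ v = (0, 1)) ->
  forall z, is_derive z v (superpose f) (superpose ('D_v f) z).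
Proof.
move=> bf vE z.
have bdf : bumpfun x1 x2 y1 y2 ('D_v f).
  by case: vE => ->; [exact: bumpfun_dx|exact: bumpfun_dy].
have bddf : bumpfun x1 x2 y1 y2 ('D_v ('D_v f)).
  by case: vE bdf => -> bdf; [exact: bumpfun_dx|exact: bumpfun_dy].
have dv g : bumpfun x1 x2 y1 y2 g -> forall z, derivable g z v.
  by move=> /bumpfun_derivable[e1 e2]; case: vE => vE; rewrite vE; [exact: e1|exact: e2].
have df := dv _ bf; have ddf := dv _ bdf.
have [B fB] := bumpfun_wsum_bound bf.
have [B1 dfB] := bumpfun_wsum_bound bdf.
have [B2 _ ddfB] := bumpfun_bounded bddf.
apply: (@is_derive_of_sqr_bound _ _ _ _ _ _ (B2 * T)) => h.
pose sh w j : R * R := (w.1, w.2 - y j).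
have shE j : sh (h *: v + z) j = h *: v + sh z j.
  by rewrite /sh /=; congr (_, _); rewrite addrA.
have fB' w j : `|f (sh w j)| <= B := fB w j.
have sB j : `|f (sh (h *: v + z) j) - 1 * f (sh z j)| <= B + B.
  by rewrite mul1r; apply: le_trans (ler_normB _ _) _; apply: lerD.
have E : superpose f (h *: v + z) - superpose f z - h * superpose ('D_v f) z =
    wsum (fun j => (f (sh (h *: v + z) j) - 1 * f (sh z j)) - h * 'D_v f (sh z j)).
  by rewrite (wsum_lin h sB (dfB z)) (wsum_lin 1 (fB' _) (fB' _)) mul1r.
rewrite E mulrAC; apply: (is_cvg_wsum _).2 => j; rewrite mul1r shE.
exact: directional_taylor.
Qed.

Lemma superpose_Cks x1 x2 y1 y2 f k : bumpfun x1 x2 y1 y2 f -> Cks k (superpose f).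
Proof.
elim: k f => [|k IH] f bf; first by split; [exact: superpose_continuous bf|].
exact: (@CksI _ k _ _ _ (superpose_continuous bf)
  (superpose_derive bf (or_introl erefl)) (superpose_derive bf (or_intror erefl))
  (IH _ (bumpfun_dx bf)) (IH _ (bumpfun_dy bf))).
Qed.

(** A bound for a derivative of [f] is common to all its translates, so the
    differentiated series converge uniformly. *)
Lemma bumpfun_superpose x1 x2 y1 y2 f (l u : R) : bumpfun x1 x2 y1 y2 f ->
  (forall j, l <= y j <= u) -> bumpfun x1 x2 (l + y1) (u + y2) (superpose f).
Proof.
move=> bf yb; split; first by move=> k; exact: superpose_Cks bf.
move=> z bz; rewrite /superpose /wsum (_ : (fun j => _) = cst 0).
  by rewrite (_ : series _ = cst 0) ?lim_cst//; apply/funext => n; rewrite /series/= big1.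
apply/funext => j; rewrite bf.2 ?mulr0// => /boxE/= [h1 h2 h3 h4]; apply: bz.
by have /andP[? ?] := yb j; apply/boxE; split=> //; lra.
Qed.

End Superposition.

(** * Bohr almost periodicity as total boundedness *)

Section AlmostPeriods.
Context {R : realType}.
Local Open Scope ring_scope.

(** Total boundedness of the set of translations, expressed by colours rather than
    by finite nets: relations are then combined by pairing the colours. *)
Definition finitely_coloured (r : R -> R -> Prop) : Prop :=
  exists (T : finType) (col : R -> T), forall s t, col s = col t -> r s t.

Lemma finitely_colouredI (r1 r2 : R -> R -> Prop) :
  finitely_coloured r1 -> finitely_coloured r2 ->
  finitely_coloured (fun s t => r1 s t /\ r2 s t).
Proof.
move=> [T1 [c1 h1]] [T2 [c2 h2]]; exists (T1 * T2)%type, (fun t => (c1 t, c2 t)).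
by move=> s t [e1 e2]; split; [exact: h1|exact: h2].
Qed.

Lemma finitely_coloured_forall (I : Type) (l : seq I) (r : I -> R -> R -> Prop) :
  (forall i, List.In i l -> finitely_coloured (r i)) ->
  finitely_coloured (fun s t => forall i, List.In i l -> r i s t).
Proof.
elim: l => [|i l IH] h; first by exists unit, (fun=> tt).
have [T [c hc]] := finitely_colouredI (h i (or_introl erefl))
  (IH (fun j lj => h j (or_intror lj))).
exists T, c => s t /hc[r1 r2] j [<-//|]; exact: r2.
Qed.

Lemma finitely_coloured_sub (r1 r2 : R -> R -> Prop) :
  (forall s t, r1 s t -> r2 s t) -> finitely_coloured r1 -> finitely_coloured r2.
Proof. by move=> r12 [T [c h]]; exists T, c => s t /h /r12. Qed.

(** Finitely many representatives, hence a bounded set of them. *)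
Lemma finitely_coloured_net (r : R -> R -> Prop) : finitely_coloured r ->
  exists L : R, forall t, exists2 s, `|s| <= L & r s t.
Proof.
move=> [T [c h]].
pose rep (x : T) : R := if pselect (exists s, c s = x) is left e then projT1 (cid e) else 0.
have repP t : c (rep (c t)) = c t.
  rewrite /rep; case: pselect => [e|ne]; first by case: cid.
  by exfalso; apply: ne; exists t.
exists (\sum_(x : T) `|rep x|) => t; exists (rep (c t)); last exact: h.
rewrite (bigD1 (c t))//= lerDl; exact: sumr_ge0.
Qed.

Definition near_translates (F : R -> R) (e s t : R) : Prop :=
  forall x, `|F (x + s) - F (x + t)| <= e.

Definition totally_ap (F : R -> R) : Prop :=
  forall e : R, 0 < e -> finitely_coloured (near_translates F e).

Lemma near_translatesC F e s t : near_translates F e s t -> near_translates F e t s.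
Proof. by move=> h x; rewrite distrC. Qed.

Lemma near_translatesD F e1 e2 s t u : near_translates F e1 s t ->
  near_translates F e2 t u -> near_translates F (e1 + e2) s u.
Proof.
move=> h1 h2 x; rewrite (_ : _ - _ = (F (x + s) - F (x + t)) + (F (x + t) - F (x + u))).
  by apply: le_trans (ler_normD _ _) _; exact: lerD.
by rewrite addrA subrK.
Qed.

(** Without a finite net there is a sequence of pairwise distant translates, which
    has no uniformly convergent subsequence.  The colour of [t] is the index of the
    first net point close to it. *)
Lemma bohr_totally_ap F : bohr_almost_periodic F -> totally_ap F.
Proof.
move=> [_ bF] e e0; have e20 : 0 < e / 2 by lra.
have [[l lP]|nl] := pselect (exists l : seq R, forall t, exists2 s, s \in l &
    near_translates F (e / 2) s t).
  pose col t := [pick i : 'I_(size l) | `[< near_translates F (e / 2) (nth 0 l i) t >]].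
  exists (option 'I_(size l)), col => s t.
  have some u : exists2 i : 'I_(size l), col u = Some i &
      near_translates F (e / 2) (nth 0 l i) u.
    rewrite /col; case: pickP => [i /asboolP h|h]; first by exists i.
    have [v vl vu] := lP u; have vi : (index v l < size l)%N by rewrite index_mem.
    by have := h (Ordinal vi); rewrite /= nth_index// => /asboolP.
  have [i -> is_] := some s; have [j -> jt] := some t => -[ij].
  rewrite -ij in jt; rewrite (_ : e = e / 2 + e / 2); last by lra.
  exact: near_translatesD (near_translatesC is_) jt.
exfalso.
have ex (l : seq R) : exists t, forall s, s \in l -> ~ near_translates F (e / 2) s t.
  apply: contrapT => h; apply: nl; exists l => t.
  apply: contrapT => h2; apply: h; exists t => s sl st; apply: h2.
  by exists s.
pose g l := projT1 (cid (ex l)).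
have gP l s : s \in l -> ~ near_translates F (e / 2) s (g l).
  by rewrite /g; case: cid => /= t; exact.
pose L := fix L n : seq R := if n is m.+1 then g (L m) :: L m else [::].
have Lmem i j : (i < j)%N -> g (L i) \in L j.
  elim: j => [//|j IH]; rewrite ltnS leq_eqVlt => /orP[/eqP ->|ij].
    by rewrite /= inE eqxx.
  by rewrite /= inE IH ?orbT.
have [n ninc [h hP]] := bF (fun i => g (L i)).
have e40 : 0 < e / 4 by lra.
have : nbhs (h : {uniform R -> R}) [set f | forall y, `|h y - f y| < e / 4].
  apply/uniform_nbhs; exists [set p | `|p.1 - p.2| < e / 4].
  split; last by move=> f /= hf y; exact: hf.
  by rewrite -entourage_from_ballE; exists (e / 4).
move=> /hP[N _ NP].
have h1 := NP N (leqnn N); have h2 := NP N.+1 (leqnSn N).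
have nn : (n N < n N.+1)%N.
  by have := ninc N.+1 N; rewrite leEnat ltnn => nE; rewrite ltnNge nE.
apply: (gP (L (n N.+1)) (g (L (n N))) (Lmem _ _ nn)) => x.
have := h1 x; have := h2 x; rewrite /= => q1 q2.
rewrite (_ : _ - _ = (h x - F (x + g (L (n N.+1)))) - (h x - F (x + g (L (n N))))); last by ring.
apply: le_trans (ler_normB _ _) _; lra.
Qed.

Lemma infinite_pigeonhole (T : finType) (P : nat -> Prop) (col : nat -> T) :
  (forall m, exists2 n, (m <= n)%N & P n) ->
  exists x, forall m, exists2 n, (m <= n)%N & P n /\ col n = x.
Proof.
move=> infP; apply: contrapT => nex.
have bnd x : exists m, forall n, (m <= n)%N -> P n -> col n <> x.
  apply: contrapT => h; apply: nex; exists x => m.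
  apply: contrapT => h2; apply: h; exists m => n mn Pn cn.
  by apply: h2; exists n.
pose b x := projT1 (cid (bnd x)).
have bP x n : (b x <= n)%N -> P n -> col n <> x.
  by rewrite /b; case: cid => /= m; exact.
have [n mn Pn] := infP (\max_x b x).
by apply: (bP (col n) n) => //; apply: leq_trans mn; exact: leq_bigmax.
Qed.

(** Successive applications of the pigeonhole principle, followed by a diagonal
    extraction. *)
Lemma diagonal_subsequence (T : nat -> finType) (col : forall k, nat -> T k) :
  exists2 n : nat -> nat, increasing_seq n &
    forall k i j, (k <= i)%N -> (k <= j)%N -> col k (n i) = col k (n j).
Proof.
pose inf (P : nat -> Prop) := forall m, exists2 n, (m <= n)%N & P n.
pose step k (P : {P | inf P}) : {P | inf P} :=
  let x := cid (infinite_pigeonhole (col k) (projT2 P)) in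
  exist _ (fun n => projT1 P n /\ col k n = projT1 x) (projT2 x).
have infT : inf (fun=> True) by move=> m; exists m.
pose P := fix P k : {P | inf P} :=
  if k is j.+1 then step j (P j) else exist _ (fun=> True) infT.
have Psub k j n : (j <= k)%N -> projT1 (P k) n -> projT1 (P j) n.
  elim: k => [|k IH]; first by rewrite leqn0 => /eqP ->.
  by rewrite leq_eqVlt => /orP[/eqP ->//|jk] /= [Pn _]; exact: IH.
have Pcol k : exists x, forall n, projT1 (P k.+1) n -> col k n = x.
  by rewrite /=; eexists => n [_ ->]; reflexivity.
pose nxt k m := s2val (cid2 (projT2 (P k.+1) m)).
have nxt_ge k m : (m <= nxt k m)%N by rewrite /nxt; case: cid2.
have nxtP k m : projT1 (P k.+1) (nxt k m) by rewrite /nxt; case: cid2.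
pose n := fix n k : nat := if k is j.+1 then nxt j.+1 (n j).+1 else nxt 0%N 0%N.
have nP k : projT1 (P k.+1) (n k) by case: k => [|k]; exact: nxtP.
exists n.
  by apply/increasing_seqP => k; rewrite ltEnat/=; exact: nxt_ge.
move=> k i j ki kj; have [x xP] := Pcol k.
by rewrite !xP//; apply: (Psub _ _ _ _ (nP _)).
Qed.

Lemma cauchy_is_cvgn (u : nat -> R) :
  (forall e, 0 < e -> exists N, forall i, (N <= i)%N -> `|u N - u i| < e) -> cvgn u.
Proof.
move=> uC; apply/cauchy_cvgP/cauchyP => e e0.
by have [N NP] := uC e e0; exists (u N), N => // i /= Ni; exact: NP.
Qed.

(** Along a diagonal subsequence all late terms have the same [k]-th colour, so the
    translates form a uniform Cauchy sequence. *)
Lemma totally_ap_bohr F : continuous F -> totally_ap F -> bohr_almost_periodic F.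
Proof.
move=> cF tF; split => // t.
have e0 k : 0 < k.+1%:R^-1 :> R by rewrite invr_gt0.
pose T k := projT1 (cid (tF _ (e0 k))).
pose c k : R -> T k := projT1 (cid (projT2 (cid (tF _ (e0 k))))).
have cP k s s' : c k s = c k s' -> near_translates F k.+1%:R^-1 s s'.
  exact: (projT2 (cid (projT2 (cid (tF _ (e0 k))))) s s').
have [n ninc nP] := diagonal_subsequence (fun k i => c k (t i)).
exists n => //; have close k i j x : (k <= i)%N -> (k <= j)%N ->
    `|F (x + t (n i)) - F (x + t (n j))| <= k.+1%:R^-1.
  by move=> ki kj; apply: (cP k); exact: nP.
have arch (e : R) : 0 < e -> exists k : nat, k.+1%:R^-1 < e.
  move=> e1; exists (Num.bound e^-1); rewrite invf_plt ?posrE//.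
  by apply: lt_trans (archi_boundP _) _; rewrite ?invr_ge0 1?ltW// ltr_nat.
pose u x := fun i => F (x + t (n i)).
have cu x : cvgn (u x).
  apply: cauchy_is_cvgn => e /arch[k ke]; exists k => i ki.
  exact: le_lt_trans (close k k i x (leqnn k) ki) ke.
exists (fun x => limn (u x)) => P /uniform_nbhs[E [entE EP]].
move: entE; rewrite -entourage_from_ballE => -[e /= e1 eE].
have e2 : 0 < e / 2 by lra.
have [k ke] := arch _ e2; exists k => // i /= ki; apply: EP => x _; apply: eE => /=.
rewrite /ball/=; apply: (@le_lt_trans _ _ (k.+1%:R^-1)); last first.
  by apply: lt_trans ke _; move: e1 => /= e1; rewrite ltr_pdivrMr// ltr_pMr// ltr1n.
have cvd : (fun j => `|u x j - u x i|) @ \oo --> `|limn (u x) - u x i|.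
  by apply: cvg_norm; apply: cvgB; [exact: cu|exact: cvg_cst].
rewrite -(cvg_lim _ cvd)//; apply: limr_le; first by apply/cvg_ex; eexists; exact: cvd.
by exists k => // j /= kj; exact: close.
Qed.

End AlmostPeriods.

(** * Uniform boundedness by a gliding hump *)

Section UniformBoundedness.
Context {R : realType}.
Local Open Scope ring_scope.

Lemma geometric_tail (n k : nat) :
  \sum_(n.+1 <= j < n.+1 + k) (3^-1 : R) ^+ j <= (3^-1 : R) ^+ n / 2.
Proof.
suff: \sum_(n.+1 <= j < n.+1 + k) (3^-1 : R) ^+ j =
    (3^-1 : R) ^+ n / 2 - (3^-1 : R) ^+ (n + k) / 2.
  move=> ->; rewrite gerBl divr_ge0// exprn_ge0//; lra.
elim: k => [|k IH]; first by rewrite !addn0 big_geq// subrr.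
rewrite addnS big_nat_recr/=; last by rewrite leq_addr.
by rewrite IH addSn addnS exprS; field.
Qed.

Lemma cvg_geometric3 (c : nat -> R) : (forall j, `|c j| <= (3^-1) ^+ j) ->
  cvgn (series (fun j => `|c j|)).
Proof.
move=> cP; apply: (@series_le_cvg _ _ (geometric 1 (3^-1 : R))).
- by move=> j.
- by move=> j; rewrite /geometric/= mul1r exprn_ge0//; lra.
- by move=> j; rewrite /geometric/= mul1r.
- by apply: is_cvg_geometric_series; rewrite ger0_norm; lra.
Qed.

(** The uniform boundedness principle without a complete space of test functions.
    Were [a] unbounded, one could choose [t n] and [y n] with
    [3^-n * `|a (t n) (y n)|] large and nearly maximal in [y], and then the signs of
    the coefficients [+-3^-n] one after the other, so that the first [n.+1] terms
    at [t n] do not cancel; the tail is too small to compensate. *)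
Lemma gliding_hump (a : R -> R -> R) (Y : set R) :
  (forall t, exists N, forall y, Y y -> `|a t y| <= N) ->
  (forall c y : nat -> R, (forall j, Y (y j)) -> (forall j, `|c j| <= (3^-1) ^+ j) ->
     exists B, forall t, `|wsum c (fun j => a t (y j))| <= B) ->
  exists M, forall t y, Y y -> `|a t y| <= M.
Proof.
move=> aN aS; apply: contrapT => nM.
(* [4 / 3] bounds the ratio of the supremum to the chosen value, so that the tail
   is at most [2 / 3] of the [n]-th term. *)
have pick n : exists ty : R * R, [/\ Y ty.2, 4 * (n%:R * 3 ^+ n) <= `|a ty.1 ty.2|,
    0 < `|a ty.1 ty.2| & forall y, Y y -> 3 * `|a ty.1 y| <= 4 * `|a ty.1 ty.2|].
  have X0 : 0 <= n%:R * 3 ^+ n :> R by rewrite mulr_ge0// exprn_ge0.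
  move: X0; move: (n%:R * 3 ^+ n) => X X0; pose K : R := 6 * X + 1.
  have K0 : 0 < K by rewrite /K; lra.
  have [t [y0 Yy0 aK]] : exists t, exists2 y, Y y & K < `|a t y|.
    apply: contrapT => h; apply: nM; exists K => t y Yy; rewrite leNgt; apply/negP => aK.
    by apply: h; exists t, y.
  have [N NP] := aN t; pose A := [set `|a t y| | y in Y].
  have supA : has_sup A.
    split; first by exists `|a t y0|, y0.
    by exists N => _ [y Yy <-]; exact: NP.
  have leA y : Y y -> `|a t y| <= sup A.
    by move=> Yy; apply: ub_le_sup; [exact: supA.2|exists y].
  have sK : K < sup A by apply: lt_le_trans aK (leA _ Yy0).
  have s40 : 0 < sup A / 4 by lra.
  have [_ [y Yy <-] sy] := sup_adherent s40 supA.
  exists (t, y); split => //=; last by move=> y' /leA; lra.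
    by rewrite /K in sK; lra.
  by lra.
pose ty n := projT1 (cid (pick n)).
have tyP n := projT2 (cid (pick n)); rewrite -/(ty _) in tyP.
pose t n := (ty n).1; pose y n := (ty n).2.
pose psum (l : seq R) (s : R) := \sum_(j < size l) nth 0 l j * a s (y j).
pose new (l : seq R) : R := let n := size l in let k := (3^-1) ^+ n in
  if `|k * a (t n) (y n)| <= `|psum l (t n) + k * a (t n) (y n)| then k else - k.
pose L := fix L n : seq R := if n is m.+1 then rcons (L m) (new (L m)) else [::].
have sL n : size (L n) = n by elim: n => //= n IH; rewrite size_rcons IH.
pose c n := new (L n).
have Lc n j : (j < n)%N -> nth 0 (L n) j = c j.
  elim: n => [//|n IH]; rewrite ltnS leq_eqVlt => /orP[/eqP ->|jn] /=.
    by rewrite nth_rcons sL ltnn eqxx.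
  by rewrite nth_rcons sL jn IH.
have k0 n : 0 <= (3^-1 : R) ^+ n by rewrite exprn_ge0//; lra.
have cle n : `|c n| = (3^-1) ^+ n.
  by rewrite /c /new sL; case: ifP => _; rewrite ?normrN ger0_norm.
have psumE n s : psum (L n) s = \sum_(j < n) c j * a s (y j).
  by rewrite /psum sL; apply: eq_bigr => j _; rewrite Lc.
have hump n : (3^-1) ^+ n * `|a (t n) (y n)| <=
    `|\sum_(j < n.+1) c j * a (t n) (y j)|.
  rewrite big_ord_recr/= -psumE /c /new sL.
  set x := (3^-1) ^+ n * a (t n) (y n); set S := psum _ _.
  rewrite -[X in X * _](ger0_norm (k0 n)) -normrM -/x.
  case: ifP => // /negbT; rewrite -ltNge mulNr -/x => h.
  have := ler_normB (S + x) (S - x); rewrite (_ : S + x - (S - x) = 2 * x); last by ring.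
  by rewrite normrM ger0_norm//; lra.
have [j|j|B BP] := aS c y; [by have [] := tyP j|by rewrite cle|].
have ccvg : cvgn (series (fun j => `|c j|)).
  by apply: cvg_geometric3 => j; rewrite cle.
pose n := (Num.bound `|B|).+1.
have Bn : B < n%:R.
  apply: le_lt_trans (ler_norm B) _; apply: lt_trans (archi_boundP _) _ => //.
  by rewrite ltr_nat.
have [_ aA A0 aA'] := tyP n; rewrite -/(t n) -/(y n) in aA A0 aA'.
set A := `|a (t n) (y n)| in aA A0 aA'.
have aj j : `|a (t n) (y j)| <= 4 / 3 * A.
  by have [Yj _ _ _] := tyP j; have := aA' _ Yj; lra.
have [cvS _] := is_cvg_wsum ccvg aj.
have := BP (t n); apply/negP; rewrite -ltNge; apply: lt_le_trans Bn _.
have nA : 4 * n%:R <= (3^-1) ^+ n * A.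
  have K1 : (3^-1) ^+ n * 3 ^+ n = 1 :> R by rewrite -exprMn mulVf ?expr1n.
  have G (p q m : R) : p * (4 * (m * q)) = 4 * m * (p * q) by ring.
  by have := ler_wpM2l (k0 n) aA; rewrite G K1 mulr1.
have part m : n%:R <= `|\sum_(0 <= j < n.+1 + m) c j * a (t n) (y j)|.
  rewrite (big_cat_nat (n := n.+1))/= ?leq_addr// big_mkord.
  set S1 := \sum_(_ < _) _; set S2 := \sum_(_ <= _ < _) _.
  have h1 : (3^-1) ^+ n * A <= `|S1| := hump n.
  have h2 : `|S2| <= (3^-1) ^+ n / 2 * (4 / 3 * A).
    apply: le_trans (ler_norm_sum _ _ _) _.
    apply: le_trans (ler_wpM2r _ (geometric_tail n m)); last by lra.
    rewrite mulr_suml; apply: ler_sum => j _.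
    by rewrite normrM cle; apply: ler_wpM2l.
  have := ler_normB (S1 + S2) S2; rewrite addrK.
  move: h1 h2 nA; rewrite (_ : (3^-1) ^+ n / 2 * (4 / 3 * A) = 2 / 3 * ((3^-1) ^+ n * A)).
    by move: ((3^-1) ^+ n * A) => X; have : 0 <= n%:R :> R by []; lra.
  by move: ((3^-1) ^+ n) => X; lra.
rewrite /wsum -lim_norm//; apply: limr_ge; first exact: is_cvg_norm.
exists n.+1 => // m /= nm; have := part (m - n.+1)%N.
by rewrite subnKC.
Qed.

End UniformBoundedness.

(** * Smooth radial kernels *)

Section Kernel.
Context {R : realType}.
Local Notation mu2 := (@lebesgue_measure R \x @lebesgue_measure R)%E.
Local Notation mR := (measurableTypeR R).
Local Notation mR2 := (mR * mR)%type.

Definition bump_profile (d k s : R) : R := (k * flat 0 (d ^+ 2 - s))%R.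

Let mflat : measurable_fun (setT : set mR) (flat 0 : mR -> mR).
Proof.
apply: continuous_measurable_fun => s.
by apply/differentiable_continuous/derivable1_diffP; have [] := is_derive_flat 0 s.
Qed.

(** The density is normalised by its integral, which is positive because the
    density is bounded below on a small square. *)
Lemma exists_radial_kernel (d : R) : (0 < d)%R ->
  exists k A : R, radial_kernel d A (bump_profile d k).
Proof.
move=> d0; pose g (p : R * R) : \bar R := (flat 0 (d ^+ 2 - sqnorm p))%:E.
have mg : measurable_fun (setT : set mR2) g.
  apply/measurable_EFinP; apply: (measurableT_comp mflat).
  by apply: measurable_funB => //; exact: measurable_sqnorm.
have g0 p : 0 <= g p by rewrite lee_fin flat_ge0.
have dn0 : (0 <= d)%R := ltW d0.
have out s : (d ^+ 2 < s)%R -> flat 0 (d ^+ 2 - s) = 0%R.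
  by move=> ds; rewrite /flat ifF//; apply/negbTE; rewrite -leNgt subr_le0 ltW.
have mb (z : R * R) h : measurable (sq z h : set mR2) by exact: measurable_box.
have up : \int[mu2]_p g p <= (4 * d ^+ 2)%:E.
  apply: (@le_trans _ _ (\int[mu2]_(p in sq (0, 0)%R d) cst 1 p)); last first.
    by rewrite integral_cst//= mul1e area_sq.
  rewrite [leRHS]integral_mkcond; apply: ge0_le_integral.
  - exact: measurableT.
  - by move=> p _; exact: g0.
  - exact: mg.
  - by apply/(measurable_restrictT _ _).1 => //; exact: measurable_cst.
  move=> p _; rewrite patchE; case: ifPn => [_|/negP pn].
    by rewrite lee_fin flat0_le1.
  rewrite /g out// ltNge; apply/negP => pd; apply: pn.
  by apply/mem_set/closed_disc_sub_sq => //; rewrite /closed_disc/= !subr0.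
have d2 : (0 < d / 2)%R by lra.
have lowE : (0 < expR (- (d ^+ 2 / 2)^-1) * (4 * (d / 2) ^+ 2))%R.
  by rewrite mulr_gt0 ?expR_gt0// mulr_gt0// exprn_gt0.
have low : (expR (- (d ^+ 2 / 2)^-1) * (4 * (d / 2) ^+ 2))%:E <= \int[mu2]_p g p.
  apply: (@le_trans _ _ (\int[mu2]_(p in sq (0, 0)%R (d / 2))
      cst (expR (- (d ^+ 2 / 2)^-1))%:E p)).
    by rewrite integral_cst//= area_sq ?(ltW d2)// -EFinM.
  rewrite [leLHS]integral_mkcond; apply: ge0_le_integral.
  - exact: measurableT.
  - by move=> p _; apply: erestrict_ge0 => x _; rewrite lee_fin expR_ge0.
  - by apply/(measurable_restrictT _ _).1 => //; exact: measurable_cst.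
  - exact: mg.
  move=> p _; rewrite patchE; case: ifPn => [/set_mem /boxE/= [h1 h2 h3 h4]|_]; last exact: g0.
  have pd : (d ^+ 2 / 2 <= d ^+ 2 - sqnorm p)%R.
    by rewrite /sqnorm; move: (p.1) (p.2) h1 h2 h3 h4 => x y ? ? ? ?; nra.
  have dd : (0 < d ^+ 2 / 2)%R by rewrite divr_gt0// exprn_gt0.
  rewrite /g lee_fin /flat ifT; last exact: lt_le_trans dd pd.
  by rewrite expr0 mul1r ler_expR lerN2 lef_pV2// posrE (lt_le_trans dd pd).
have [I IE] : exists I : R, \int[mu2]_p g p = I%:E.
  exists (fine (\int[mu2]_p g p)); rewrite fineK// ge0_fin_numE.
    exact: le_lt_trans up (ltry _).
  by apply: integral_ge0 => p _; exact: g0.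
have I0 : (0 < I)%R by move: low; rewrite IE lee_fin; exact: lt_le_trans.
have Ii0 : (0 <= I^-1)%R by rewrite invr_ge0 ltW.
exists I^-1%R, I^-1%R; split.
- apply: measurable_funM; first exact: measurable_cst.
  by apply: (measurableT_comp mflat); exact: measurable_funB.
- move=> s; rewrite /bump_profile mulr_ge0 ?flat_ge0//=.
  by rewrite -[leRHS]mulr1; apply: ler_wpM2l => //; exact: flat0_le1.
- by move=> s /out; rewrite /bump_profile => ->; rewrite mulr0.
- exact: d0.
- rewrite /bump_profile; under eq_integral do rewrite EFinM.
  have Iie : 0 <= (I^-1%R)%:E :> \bar R by rewrite lee_fin.
  rewrite (ge0_integralZl mu2 measurableT mg (fun p _ => g0 p) Iie) IE -EFinM.
  by rewrite mulVf// gt_eqF.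
Qed.

End Kernel.

(** * Subharmonic functions in a strip *)

Section Strip.
Context {R : realType}.
Local Notation mu2 := (@lebesgue_measure R \x @lebesgue_measure R)%E.
Local Notation mR := (measurableTypeR R).
Local Notation mR2 := (mR * mR)%type.
Variables (a b : \bar R).

Lemma open_strip : open (strip a b).
Proof.
have ogt : open [set z : R * R | a < z.2%:E].
  case: a => [r||].
  - rewrite (_ : [set _ | _] = snd @^-1` [set x : R | (r < x)%R])//.
    by apply: open_comp; [move=> z _; exact: cvg_snd|exact: open_gt].
  - have -> : [set z : R * R | +oo < z.2%:E] = set0 by apply/seteqP; split.
    exact: open0.
  - have -> : [set z : R * R | -oo < z.2%:E] = setT.
      by apply/seteqP; split => z //= _; rewrite ltNyr.
    exact: openT.
have olt : open [set z : R * R | z.2%:E < b].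
  case: b => [r||].
  - rewrite (_ : [set _ | _] = snd @^-1` [set x : R | (x < r)%R])//.
    by apply: open_comp; [move=> z _; exact: cvg_snd|exact: open_lt].
  - have -> : [set z : R * R | z.2%:E < +oo] = setT.
      by apply/seteqP; split => z //= _; rewrite ltry.
    exact: openT.
  - have -> : [set z : R * R | z.2%:E < -oo] = set0 by apply/seteqP; split.
    exact: open0.
exact: (openI ogt olt).
Qed.

Lemma box_sub_strip (x1 x2 y1 y2 : R) : a < y1%:E -> y2%:E < b ->
  box x1 x2 y1 y2 `<=` strip a b.
Proof.
move=> ay yb z /boxE[_ _ y1z zy2]; split.
  by apply: lt_le_trans ay _; rewrite lee_fin.
by apply: le_lt_trans yb; rewrite lee_fin.
Qed.

Lemma strip_margin (y1 y2 : R) : a < y1%:E -> y2%:E < b ->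
  exists2 r : R, (0 < r)%R & a < (y1 - r)%:E /\ (y2 + r)%:E < b.
Proof.
move=> ay yb.
have [r1 r10 ar1] : exists2 r : R, (0 < r)%R & a < (y1 - r)%:E.
  case: a ay => [r||]// ar; last by exists 1%R => //; rewrite ltNyr.
  rewrite lte_fin in ar; exists ((y1 - r) / 2)%R; first by lra.
  by rewrite lte_fin; lra.
have [r2 r20 br2] : exists2 r : R, (0 < r)%R & (y2 + r)%:E < b.
  case: b yb => [r||]// br; last by exists 1%R => //; rewrite ltry.
  rewrite lte_fin in br; exists ((r - y2) / 2)%R; first by lra.
  by rewrite lte_fin; lra.
exists (Num.min r1 r2); first by rewrite lt_min r10.
split; [apply: lt_le_trans ar1 _|apply: le_lt_trans br2].
  by rewrite lee_fin lerD2l lerN2 ge_min lexx.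
by rewrite lee_fin lerD2l ge_min lexx orbT.
Qed.

Definition htrans (T : Type) (t : R) (f : R * R -> T) (z : R * R) : T := f (z.1 + t, z.2)%R.

Lemma subharmonic_htrans (v : R * R -> \bar R) (t : R) :
  subharmonic (strip a b) v -> subharmonic (strip a b) (htrans t v).
Proof.
move=> [vy [z0 Sz0 vz0] uv mean]; split.
- by move=> z Sz; exact: vy.
- by exists (z0.1 - t, z0.2)%R => //; rewrite /htrans/= subrK -surjective_pairing.
- move=> z Sz c vc.
  have := uv _ (Sz : strip a b (z.1 + t, z.2)%R) c vc.
  have ct : (fun w : R * R => (w.1 + t, w.2)%R) @ z --> (z.1 + t, z.2)%R.
    have c1 : (fun w : R * R => (w.1 + t)%R) @ z --> (z.1 + t)%R.
      by apply: cvgD; [exact: cvg_fst|exact: cvg_cst].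
    have c2 : (fun w : R * R => w.2) @ z --> z.2 by exact: cvg_snd.
    exact: (cvg_pair c1 c2).
  by move=> /ct.
- move=> z r r0 zS; have zS' : closed_disc (z.1 + t, z.2)%R r `<=` strip a b.
    move=> p pz; have : closed_disc z r (p.1 - t, p.2)%R.
      move: pz; rewrite /closed_disc/=; congr (is_true (_ <= _)%R).
      by congr (_ ^+ 2 + _)%R; ring.
    by move=> /zS.
  have := mean _ _ r0 zS'; rewrite /circle_mean /htrans/=.
  move/le_trans; apply; rewrite le_eqVlt; apply/orP; left; apply/eqP.
  by congr (_ * _); apply: eq_integral => s _; rewrite addrAC.
Qed.

Lemma closed_disc_sub_box (x1 x2 y1 y2 d : R) (z : R * R) : (0 <= d)%R ->
  box (x1 + d) (x2 - d) (y1 + d) (y2 - d) z -> closed_disc z d `<=` box x1 x2 y1 y2.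
Proof.
move=> d0 /boxE[? ? ? ?]; apply: subset_trans (closed_disc_sub_sq d0) _.
by apply: sub_box; lra.
Qed.

Variable v : R * R -> \bar R.
Hypothesis sv : subharmonic (strip a b) v.

Let v_lty z : strip a b z -> v z < +oo.
Proof. by have [h _ _ _] := sv; exact: h. Qed.

Lemma subharmonic_measurable (D : set (R * R)) : D `<=` strip a b ->
  measurable (D : set mR2) -> measurable_fun (D : set mR2) v.
Proof.
move=> DS mD; have [_ _ uv _] := sv.
apply: measurable_funS (usc_measurable open_strip uv) => //.
exact: plane_open_measurable open_strip.
Qed.

Lemma subharmonic_box_bounded (x1 x2 y1 y2 : R) : a < y1%:E -> y2%:E < b ->
  exists2 M : R, (0 <= M)%R & forall z, box x1 x2 y1 y2 z -> v z <= M%:E.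
Proof.
move=> ay yb; have [_ _ uv _] := sv.
exact: (usc_bounded_above uv v_lty (@compact_box R x1 x2 y1 y2) (box_sub_strip ay yb)).
Qed.

Lemma measurable_gap_box (x1 x2 y1 y2 M : R) : a < y1%:E -> y2%:E < b ->
  measurable_fun (setT : set mR2) (gap (box x1 x2 y1 y2) M v).
Proof.
move=> ay yb; apply: measurable_gap; first exact: measurable_box.
by apply: subharmonic_measurable; [exact: box_sub_strip|exact: measurable_box].
Qed.

Lemma supermean_gap_box (x1 x2 y1 y2 M : R) : a < y1%:E -> y2%:E < b -> (0 <= M)%R ->
  (forall z, box x1 x2 y1 y2 z -> v z <= M%:E) ->
  supermean (box x1 x2 y1 y2) (gap (box x1 x2 y1 y2) M v).
Proof.
move=> ay yb M0 vM; apply: (supermean_gap sv open_strip) => //.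
  exact: measurable_box.
exact: box_sub_strip.
Qed.

Lemma integral_gap (B : set (R * R)) (M : R) : measurable (B : set mR2) ->
  \int[mu2]_z (gap B M v z) = \int[mu2]_(z in B) (M%:E - v z).
Proof. by move=> mB; rewrite [RHS]integral_mkcond. Qed.

(** One point where [v] is finite gives, by Harnack's inequality, local integrability. *)
Lemma integral_gap_lty (x1 x2 y1 y2 M : R) : a < y1%:E -> y2%:E < b -> (0 <= M)%R ->
  (x1 <= x2)%R -> (y1 <= y2)%R -> (forall z, box x1 x2 y1 y2 z -> v z <= M%:E) ->
  \int[mu2]_z (gap (box x1 x2 y1 y2) M v z) < +oo.
Proof.
move=> ay yb M0 x12 y12 vM; have [_ [z0 [az0 z0b] vz0] _ _] := sv.
pose X1 := Num.min x1 z0.1; pose X2 := Num.max x2 z0.1.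
pose Y1 := Num.min y1 z0.2; pose Y2 := Num.max y2 z0.2.
have aY : a < Y1%:E by rewrite /Y1; case: (leP y1 z0.2).
have Yb : Y2%:E < b by rewrite /Y2; case: (leP y2 z0.2).
have [r r0 [ar rb]] := strip_margin aY Yb.
pose h := (r / 5)%R; have h0 : (0 < h)%R by rewrite divr_gt0.
have hr : (5 * h = r)%R by rewrite /h; lra.
pose B := box (X1 - 5 * h) (X2 + 5 * h) (Y1 - 5 * h) (Y2 + 5 * h).
have aB : a < (Y1 - 5 * h)%:E by rewrite hr.
have bB : (Y2 + 5 * h)%:E < b by rewrite hr.
have [M' M'0 vM'] := subharmonic_box_bounded (X1 - 5 * h) (X2 + 5 * h) aB bB.
have mw := measurable_gap_box (X1 - 5 * h) (X2 + 5 * h) M' aB bB.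
have sw := supermean_gap_box aB bB M'0 vM'.
have w0 z := gap_ge0 z vM'.
have Kz0 : box X1 X2 Y1 Y2 z0.
  by apply/boxE; rewrite /X1 /X2 /Y1 /Y2 !ge_min !le_max !lexx !orbT.
have Bz0 : B z0.
  move: Kz0 => /boxE[? ? ? ?]; apply/boxE; split; lra.
have [m m0 wm] : exists2 m : R, (0 < m)%R & gap B M' v z0 <= m%:E.
  rewrite gapE//; have := v_lty (conj az0 z0b).
  case: (v z0) vz0 => [s|//|//] _ _; exists (`|M' - s| + 1)%R.
    by rewrite ltr_wpDl.
  by rewrite -EFinB lee_fin; apply: le_trans (ler_norm _) _; rewrite lerDl.
have [C C0 CP] := harnack_box (X2 - X1) (Y2 - Y1) h0 m0.
have iC := CP B _ _ _ _ _ mw w0 sw (lexx _) (lexx _) (@subset_refl _ B) (ex_intro2 _ _ z0 Kz0 wm).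
have QK : box x1 x2 y1 y2 `<=` box X1 X2 Y1 Y2.
  by apply: sub_box; rewrite ?ge_min ?le_max lexx.
have KB : box X1 X2 Y1 Y2 `<=` B.
  by apply: sub_box; rewrite ?gerBl ?lerDl mulr_ge0// ltW.
have mQ := @measurable_box R x1 x2 y1 y2; have mK := @measurable_box R X1 X2 Y1 Y2.
rewrite integral_gap//.
apply: (@le_lt_trans _ _ (\int[mu2]_(z in box x1 x2 y1 y2) (gap B M' v z + M%:E))).
  apply: ge0_le_integral.
  - exact: mQ.
  - by move=> z Qz; rewrite sube_ge0 ?vM ?orbT.
  - by apply: emeasurable_funB => //; apply: subharmonic_measurable => //; exact: box_sub_strip.
  - by apply: emeasurable_funD => //; exact: measurable_funTS.
  move=> z Qz; rewrite gapE; last by apply/KB/QK.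
  rewrite addeC; case: (v z) => [s||]//=.
    by rewrite -?EFinB -EFinD lee_fin; lra.
have Me0 (z : R * R) : 0 <= M%:E by rewrite lee_fin.
rewrite (ge0_integralD mu2 mQ (fun z _ => w0 z) (measurable_funTS mw)
  (fun z _ => Me0 z) (measurable_cst _)).
apply: lte_add_pinfty.
  apply: le_lt_trans (ltry C); apply: le_trans iC.
  apply: ge0_subset_integral; [exact: mQ|exact: mK|exact: measurable_funTS| |exact: QK].
  by move=> z _; exact: w0.
rewrite integral_cst//= area_box// -EFinM; exact: ltry.
Qed.

Lemma subharmonic_integrable (x1 x2 y1 y2 : R) : a < y1%:E -> y2%:E < b ->
  (x1 <= x2)%R -> (y1 <= y2)%R -> mu2.-integrable (box x1 x2 y1 y2) v.
Proof.
move=> ay yb x12 y12; have [M M0 vM] := subharmonic_box_bounded x1 x2 ay yb.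
have mQ := @measurable_box R x1 x2 y1 y2.
have mv : measurable_fun (box x1 x2 y1 y2 : set mR2) v.
  by apply: subharmonic_measurable => //; exact: box_sub_strip.
have := integral_gap_lty ay yb M0 x12 y12 vM; rewrite integral_gap// => fin.
apply/integrableP; split => //.
apply: (@le_lt_trans _ _ (\int[mu2]_(z in box x1 x2 y1 y2) ((M%:E - v z) + M%:E))).
  apply: ge0_le_integral.
  - exact: mQ.
  - by move=> z _; exact: abse_ge0.
  - exact: (measurableT_comp _ mv).
  - by apply: emeasurable_funD => //; exact: emeasurable_funB.
  move=> z /vM; case: (v z) => [s||]//=; rewrite lee_fin => sM.
  by rewrite -?EFinB -EFinD lee_fin ler_norml; apply/andP; split; lra.
have Me0 (z : R * R) : 0 <= M%:E by rewrite lee_fin.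
have mMv : measurable_fun (box x1 x2 y1 y2 : set mR2) (fun z => M%:E - v z).
  exact: emeasurable_funB.
have Mv0 z : box x1 x2 y1 y2 z -> 0 <= M%:E - v z.
  by move=> Qz; rewrite sube_ge0 ?vM ?orbT.
rewrite (ge0_integralD mu2 mQ Mv0 mMv (fun z _ => Me0 z) (measurable_cst _)).
apply: lte_add_pinfty; first exact: fin.
rewrite integral_cst//= area_box// -EFinM; exact: ltry.
Qed.

End Strip.

(** * Pairings with test functions and mollification *)

Section Pairing.
Context {R : realType}.
Local Notation mu2 := (@lebesgue_measure R \x @lebesgue_measure R)%E.
Local Notation mR := (measurableTypeR R).
Local Notation mR2 := (mR * mR)%type.

Lemma integral_translate (c : R * R) (f : R * R -> \bar R) :
  measurable_fun (setT : set mR2) f ->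
  \int[mu2]_z f (z.1 + c.1, z.2 + c.2)%R = \int[mu2]_z f z.
Proof.
move=> mf; rewrite integralE [RHS]integralE.
congr (_ - _).
  rewrite -(ge0_integral_translate c (measurable_funepos mf) (funepos_ge0 _)).
  by apply: eq_integral => z _; rewrite !funeposE.
rewrite -(ge0_integral_translate c (measurable_funeneg mf) (funeneg_ge0 _)).
by apply: eq_integral => z _; rewrite !funenegE.
Qed.

Section RealPairing.
Variables (K : set (R * R)).
Hypothesis mK : measurable (K : set mR2).

Lemma integrable_pair (f phi : R * R -> R) (B : R) :
  mu2.-integrable K (EFin \o f) -> measurable_fun (K : set mR2) (phi : mR2 -> mR) ->
  (forall z, K z -> `|phi z| <= B)%R ->
  mu2.-integrable K (EFin \o (fun z => f z * phi z)%R).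
Proof.
move=> intf mphi phiB.
have mf : measurable_fun (K : set mR2) (f : mR2 -> mR).
  by apply/measurable_EFinP; exact: measurable_int intf.
apply: (@le_integrable _ _ _ mu2 K mK _ (fun z => B%:E * (EFin \o f) z)).
- by apply/measurable_EFinP; exact: measurable_funM.
- move=> z Kz; rewrite /= -?EFinM lee_fin !normrM mulrC; apply: ler_wpM2r => //.
  by apply: le_trans (phiB z Kz) _; exact: ler_norm.
- exact: integrableZl.
Qed.

Lemma pair_lip (f phi psi : R * R -> R) (B e : R) :
  mu2.-integrable K (EFin \o f) ->
  measurable_fun (K : set mR2) (phi : mR2 -> mR) -> measurable_fun (K : set mR2) (psi : mR2 -> mR) ->
  (forall z, K z -> `|phi z| <= B)%R -> (forall z, K z -> `|psi z| <= B)%R ->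
  (forall z, K z -> `|phi z - psi z| <= e)%R ->
  (`|\int[mu2]_(z in K) (f z * phi z) - \int[mu2]_(z in K) (f z * psi z)|
     <= e * \int[mu2]_(z in K) `|f z|)%R.
Proof.
move=> intf mphi mpsi phiB psiB ppe.
have i1 := integrable_pair intf mphi phiB; have i2 := integrable_pair intf mpsi psiB.
have ian : mu2.-integrable K (EFin \o (fun z => `|f z|)%R) by exact: integrable_norm.
rewrite -(RintegralB mK i1 i2).
have i3 : mu2.-integrable K (EFin \o (fun z => f z * phi z - f z * psi z)%R).
  by have := integrableB mK i1 i2; apply: eq_integrable => // z _.
apply: le_trans (le_normr_Rintegral mK i3) _.
rewrite -(RintegralZl e mK ian).
apply: le_Rintegral => //.
- exact: integrable_norm.
- by have := integrableZl mK e ian; apply: eq_integrable => // z _.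
move=> z Kz; rewrite -mulrBr normrM mulrC; apply: ler_wpM2r => //.
exact: ppe.
Qed.

End RealPairing.

Variables (a b : \bar R).
Local Notation S := (strip a b).

Lemma measurable_htrans d (T : measurableType d) (t : R) (f : R * R -> T) :
  measurable_fun (setT : set mR2) f -> measurable_fun (setT : set mR2) (htrans t f).
Proof.
move=> mf; apply: (measurableT_comp mf); apply: measurable_fun_pair => //.
exact: measurable_funD.
Qed.

Lemma measurable_pairing_integrand (v : R * R -> \bar R) (phi : R * R -> R) (t : R) :
  subharmonic S v -> measurable_fun (setT : set mR2) (phi : mR2 -> mR) ->
  measurable_fun (setT : set mR2) ((fun z => v z * (phi (z.1 - t, z.2)%R)%:E) \_ S).
Proof.
move=> sv mphi; have mS : measurable (S : set mR2).
  exact: plane_open_measurable (@open_strip R a b).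
apply/(measurable_restrictT _ _).1 => //; apply: emeasurable_funM.
  by apply: (subharmonic_measurable sv).
apply: measurable_funTS; apply/measurable_EFinP.
exact: (@measurable_htrans _ mR (- t)%R phi).
Qed.

Lemma translate_pairing_htrans (v : R * R -> \bar R) (phi : R * R -> R) (s t : R) :
  subharmonic S v -> measurable_fun (setT : set mR2) (phi : mR2 -> mR) ->
  translate_pairing S (htrans t v) phi s = translate_pairing S v phi (s + t)%R.
Proof.
move=> sv mphi; rewrite /translate_pairing; congr fine.
rewrite integral_mkcond [RHS]integral_mkcond.
rewrite -[RHS](integral_translate (t, 0)%R (measurable_pairing_integrand (s + t) sv mphi)).
apply: eq_integral => z _; rewrite !patchE /=.
have -> : ((z.1 + t, z.2 + 0)%R \in S) = (z \in S).
  by rewrite addr0; apply/idP/idP; rewrite !inE.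
case: ifP => // _; rewrite /htrans addr0; congr (_ * (phi (_, _))%:E).
by ring.
Qed.

Lemma fine_integrable (v : R * R -> \bar R) (K : set (R * R)) : measurable (K : set mR2) ->
  mu2.-integrable K v -> mu2.-integrable K (EFin \o (fine \o v)).
Proof.
move=> mK iv; apply: (le_integrable mK _ _ iv).
  by apply/measurable_EFinP; apply: (measurableT_comp _ (measurable_int _ iv));
    exact: fine_measurable.
by move=> z _ /=; case: (v z) => [r||]//=; rewrite normr0 leey.
Qed.

(** Moving the translation from the test function to [v] fixes the domain of integration,
    and [v] may be replaced by a real-valued function, being finite almost everywhere. *)
Lemma translate_pairingE (v : R * R -> \bar R) (phi : R * R -> R) (x1 x2 y1 y2 B t : R) :
  subharmonic S v -> measurable_fun (setT : set mR2) (phi : mR2 -> mR) ->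
  (forall z, `|phi z| <= B)%R -> (forall z, ~ box x1 x2 y1 y2 z -> phi z = 0%R) ->
  a < y1%:E -> y2%:E < b -> (x1 <= x2)%R -> (y1 <= y2)%R ->
  translate_pairing S v phi t =
    (\int[mu2]_(z in box x1 x2 y1 y2) (fine (htrans t v z) * phi z))%R.
Proof.
move=> sv mphi phiB phi0 ay yb x12 y12.
rewrite -[t in LHS]add0r -translate_pairing_htrans//.
have svt := subharmonic_htrans t sv; set w := htrans t v in svt *.
have KS := @box_sub_strip _ a b x1 x2 y1 y2 ay yb.
have mK := @measurable_box R x1 x2 y1 y2.
have iw := subharmonic_integrable svt ay yb x12 y12.
have iwf := fine_integrable mK iw.
rewrite /translate_pairing /Rintegral; congr fine.
transitivity (\int[mu2]_(z in box x1 x2 y1 y2) (w z * (phi z)%:E)).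
  rewrite integral_mkcond [RHS]integral_mkcond; apply: eq_integral => z _.
  rewrite !patchE subr0 -surjective_pairing.
  have [zK|zK] := boolP (z \in box x1 x2 y1 y2).
    by rewrite ifT//; rewrite inE; apply: KS; rewrite inE in zK.
  by rewrite phi0 ?mule0 ?if_same// => Kz; rewrite mem_set in zK.
apply: ae_eq_integral => //.
- by apply: emeasurable_funM; [exact: measurable_int iw|apply: measurable_funTS; exact/measurable_EFinP].
- exact: measurable_int (integrable_pair mK iwf (measurable_funTS mphi) (fun z _ => phiB z)).
have := integrable_ae mK iw; apply: filterS => z /= fz Kz.
by rewrite EFinM fineK// fz.
Qed.

(** ** Mollification *)

Section Mollify.
Variables (d k A : R).
Local Notation rho := (bump_profile d k).
Hypothesis krho : radial_kernel d A rho.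

Let d0 : (0 < d)%R. Proof. by have [] := krho. Qed.

Definition bump_at (y : R) (p : R * R) : R := rho (sqnorm (p.1, p.2 - y)%R).

Lemma bumpfun_bump_at (y : R) : bumpfun (- d) d (y - d) (y + d) (bump_at y).
Proof. exact: bumpfun_flat. Qed.

Lemma bumpfun_measurable (x1 x2 y1 y2 : R) (f : R * R -> R) : bumpfun x1 x2 y1 y2 f ->
  measurable_fun (setT : set mR2) (f : mR2 -> mR).
Proof.
move=> [sf _]; have cf := Cks_cont (sf 0%N).
apply/measurable_EFinP; apply: (@usc_measurable R setT); first exact: openT.
move=> z _ r; rewrite /= lte_fin => fr.
have := cf z; move=> /(_ [set x | (x < r)%R]) /= h.
have : nbhs (f z) [set x : R | (x < r)%R] by exact: (open_nbhs_nbhs (conj (@open_lt _ r) fr)).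
exact: h.
Qed.

Lemma bump_at_bounds y z : (0 <= bump_at y z <= A)%R.
Proof. by have [_ + _ _ _] := krho; exact. Qed.

Definition mollify (v : R * R -> \bar R) (z : R * R) : R :=
  translate_pairing S v (bump_at z.2) z.1.

Lemma mollify_htrans v t z : subharmonic S v ->
  mollify (htrans t v) z = mollify v (z.1 + t, z.2)%R.
Proof.
move=> sv; rewrite /mollify translate_pairing_htrans//.
exact: bumpfun_measurable (bumpfun_bump_at _).
Qed.

Section OneFunction.
Variable v : R * R -> \bar R.
Hypothesis sv : subharmonic S v.
Variables (x1 x2 y1 y2 M : R).
Hypotheses (ay : a < y1%:E) (yb : y2%:E < b) (M0 : (0 <= M)%R).
Hypotheses (x12 : (x1 <= x2)%R) (y12 : (y1 <= y2)%R).
Let B := box x1 x2 y1 y2.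
Hypothesis vM : forall z, B z -> v z <= M%:E.
Let w := gap B M v.

Let BS : B `<=` S. Proof. exact: box_sub_strip. Qed.

Let mB : measurable (B : set mR2). Proof. exact: measurable_box. Qed.

Let mw : measurable_fun (setT : set mR2) w. Proof. exact: (measurable_gap_box sv _ _ _ ay yb). Qed.

Let w0 z : 0 <= w z. Proof. exact: (gap_ge0 z vM). Qed.

Let sw : supermean B w. Proof. exact: (supermean_gap_box sv ay yb M0 vM). Qed.

Let wfin : \int[mu2]_z w z < +oo. Proof. exact: (integral_gap_lty sv ay yb M0 x12 y12 vM). Qed.

Let wfinE : \int[mu2]_z w z = (fine (\int[mu2]_z w z))%:E.
Proof. by rewrite fineK// ge0_fin_numE//; apply: integral_ge0 => z _; exact: w0. Qed.

Lemma average_gap_bounds z :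
  [/\ average rho w z \is a fin_num, (0 <= fine (average rho w z))%R &
      (fine (average rho w z) <= A * fine (\int[mu2]_z w z))%R].
Proof.
have a0 := average_ge0 krho w0 z; have aI := average_le_integral krho mw w0 z.
have afin : average rho w z \is a fin_num.
  by rewrite ge0_fin_numE//; apply: le_lt_trans aI _; rewrite wfinE -EFinM ltry.
split => //; first exact: fine_ge0.
by rewrite -lee_fin fineK// EFinM -wfinE.
Qed.

Lemma mollifyE z : closed_disc z d `<=` B ->
  mollify v z = (M - fine (average rho w z))%R.
Proof.
move=> zB; have [afin _ _] := average_gap_bounds z.
pose rz (p : R * R) : \bar R := (rho (sqnorm (p.1 - z.1, p.2 - z.2)%R))%:E.
have rz0 p : 0 <= rz p by rewrite lee_fin; have /andP[] := bump_at_bounds 0 (p.1 - z.1, p.2 - z.2)%R; rewrite /bump_at/= subr0.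
have [mrho _ rho_out _ rho1] := krho.
have mr0 : measurable_fun (setT : set mR2) (fun p : mR2 => (rho (sqnorm p))%:E).
  by apply/measurable_EFinP; exact: (measurableT_comp mrho (@measurable_sqnorm R)).
have mrz : measurable_fun (setT : set mR2) rz.
  have mt : measurable_fun (setT : set mR2) (fun p : mR2 => (p.1 - z.1, p.2 - z.2)%R : mR2).
    by apply: measurable_fun_pair; exact: measurable_funB.
  exact: (measurableT_comp mr0 mt).
have rz_out p : ~ B p -> rz p = 0.
  move=> Bp; rewrite /rz rho_out// ltNge; apply/negP => pz; apply/Bp/zB.
  by move: pz; rewrite /sqnorm/=.
have toB (g : R * R -> \bar R) : \int[mu2]_p (g p * rz p) = \int[mu2]_(p in B) (g p * rz p).
  rewrite [RHS]integral_mkcond; apply: eq_integral => p _; rewrite patchE.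
  case: ifPn => // pB; rewrite rz_out ?mule0// => Bp.
  by rewrite mem_set in pB.
have int1 : \int[mu2]_p rz p = 1.
  rewrite -rho1 -(ge0_integral_translate z mrz rz0); apply: eq_integral => p _.
  by rewrite /rz/= !addrK -surjective_pairing.
have intM : \int[mu2]_(p in B) (M%:E * rz p) = M%:E.
  have Me0 : 0 <= M%:E by rewrite lee_fin.
  by rewrite -(toB (cst M%:E)) (ge0_integralZl mu2 measurableT mrz (fun p _ => rz0 p) Me0)
    int1 mule1.
have mMr : measurable_fun (B : set mR2) (fun p => M%:E * rz p).
  by apply: measurable_funTS; exact: measurable_funeM.
have Mr0 p : 0 <= M%:E * rz p by apply: mule_ge0; [rewrite lee_fin|exact: rz0].
have iM : mu2.-integrable B (fun p => M%:E * rz p).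
  apply/integrableP; split => //.
  by under eq_integral do rewrite gee0_abs//; rewrite intM ltry.
have mv : measurable_fun (B : set mR2) (fun p => v p * rz p).
  by apply: emeasurable_funM; [exact: (subharmonic_measurable sv BS mB)|exact: measurable_funTS].
have := ge0_integral_deficit mB iM mv (fun p _ => conj (Mr0 p) isT)
  (fun p Bp => lee_wpmul2r (rz0 p) (vM Bp)).
have -> : \int[mu2]_(p in B) (M%:E * rz p - v p * rz p) = average rho w z.
  transitivity (\int[mu2]_(p in B) (w p * rz p)).
    apply: eq_integral => p; rewrite inE => Bp; rewrite /w gapE// muleBl//.
  rewrite -toB.
  have mwr : measurable_fun (setT : set mR2) (fun p : mR2 => w p * rz p).
    exact: emeasurable_funM.
  rewrite -(ge0_integral_translate z mwr (fun p => mule_ge0 (w0 p) (rz0 p))).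
  apply: eq_integral => p _; rewrite /rz/= !addrK -surjective_pairing.
  by rewrite (addrC p.1) (addrC p.2).
rewrite intM.
have -> : \int[mu2]_(p in B) (v p * rz p) = \int[mu2]_(p in S) (v p * (bump_at z.2 (p.1 - z.1, p.2)%R)%:E).
  rewrite integral_mkcond [RHS]integral_mkcond; apply: eq_integral => p _; rewrite !patchE.
  have [pB|pB] := boolP (p \in B).
    by rewrite ifT//; rewrite inE; apply: BS; rewrite inE in pB.
  have := rz_out p; rewrite /rz => h; rewrite /bump_at/= h ?mule0 ?if_same// => Bp.
  by rewrite mem_set in pB.
rewrite /mollify /translate_pairing; move: afin; case: (average _ _ _) => // r _.
by case: (integral _ _ _) => [s||]//= [->]; ring.
Qed.

Lemma mollify_bounds z : closed_disc z d `<=` B ->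
  (M - A * fine (\int[mu2]_z w z) <= mollify v z <= M)%R.
Proof.
move=> zB; rewrite mollifyE//; have [_ a0 aA] := average_gap_bounds z.
by apply/andP; split; lra.
Qed.

(** The mean value inequality at [z], integrated over all radii. *)
Lemma mollify_ge z : closed_disc z d `<=` B -> v z <= (mollify v z)%:E.
Proof.
move=> zB; have Bz : B z by apply: zB; exact: closed_disc_center.
rewrite mollifyE//; have [afin _ _] := average_gap_bounds z.
have := average_le krho mw w0 sw zB; rewrite /w gapE// -/w -{1}(fineK afin).
by case: (v z) => [s||]//=; rewrite -?EFinB ?lee_fin ?leNye//; lra.
Qed.

(** The mean deviation of [v] from its mollification tends to [0] with [d],
    at a rate which depends on [v] only through the mass of the gap. *)
Lemma integral_mollify_sub (q1 q2 s1 s2 h : R) : (0 < h)%R ->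
  box (q1 - h - d) (q2 + h + d) (s1 - h - d) (s2 + h + d) `<=` B ->
  \int[mu2]_(z in box q1 q2 s1 s2) ((mollify v z)%:E - v z) <=
    (d / h * fine (\int[mu2]_z w z))%:E.
Proof.
move=> h0 QB; rewrite EFinM -wfinE.
apply: le_trans (integral_sub_average krho mw w0 h0 wfin sw QB).
rewrite le_eqVlt; apply/orP; left; apply/eqP; apply: eq_integral => z.
rewrite inE => /boxE[? ? ? ?]; have zB : closed_disc z d `<=` B.
  apply: subset_trans QB; apply: closed_disc_sub_box; first exact: ltW.
  by apply/boxE; split; lra.
have Bz : B z by apply: zB; exact: closed_disc_center.
rewrite mollifyE//; have [afin _ _] := average_gap_bounds z.
rewrite -{2}(fineK afin) /w gapE// -/w.
by case: (v z) => [s||]//=; rewrite -?EFinB -?EFinD; congr (_%:E); ring.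
Qed.

End OneFunction.

End Mollify.

End Pairing.

(** * Bounds uniform in the translation *)

Section UniformBounds.
Context {R : realType}.
Local Notation mu2 := (@lebesgue_measure R \x @lebesgue_measure R)%E.
Local Notation mR := (measurableTypeR R).
Local Notation mR2 := (mR * mR)%type.

(** Every translate is close to one by a bounded amount, so the supremum is that of
    a continuous function on a segment, up to an error. *)
Lemma bohr_bounded (F : R -> R) : bohr_almost_periodic F ->
  exists B, forall t, (`|F t| <= B)%R.
Proof.
move=> bF; have [cF _] := bF.
have [L LP] := finitely_coloured_net (bohr_totally_ap bF (ltr01 : (0 < 1 :> R)%R)).
have L0 : (0 <= L)%R by have [s sL _] := LP 0%R; exact: le_trans (normr_ge0 s) sL.
have cabs : {within `[(- L)%R, L], continuous (fun t => `|F t|%R)}.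
  by apply: continuous_subspaceT => t; apply: cvg_norm; exact: cF.
have LL : (- L <= L)%R by lra.
have [m _ mP] := EVT_max LL cabs.
exists (`|F m| + 1)%R => t; have [s sL st] := LP t.
have := st 0%R; rewrite !add0r => h.
have sI : s \in `[(- L)%R, L] by rewrite in_itv/= -ler_norml.
have := ler_normB (F s) (F s - F t)%R; rewrite opprB addrC subrK => h2.
by have := mP s sI; lra.
Qed.

Lemma Rintegral_pair_sum (K : set (R * R)) (f : R * R -> R) (phi : nat -> R * R -> R)
    (c : nat -> R) (B : R) (n : nat) : measurable (K : set mR2) ->
  mu2.-integrable K (EFin \o f) ->
  (forall j, measurable_fun (K : set mR2) (phi j : mR2 -> mR)) ->
  (forall j z, `|phi j z| <= B)%R ->
  (\int[mu2]_(z in K) (f z * \sum_(0 <= j < n) c j * phi j z) =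
   \sum_(0 <= j < n) c j * \int[mu2]_(z in K) (f z * phi j z))%R.
Proof.
move=> mK intf mphi phiB; elim: n => [|n IH].
  rewrite big_geq//; under eq_Rintegral do rewrite big_geq// mulr0.
  by rewrite Rintegral_cst// mul0r.
rewrite big_nat_recr//= -IH.
have mS : measurable_fun (K : set mR2) (fun z : mR2 => (\sum_(0 <= j < n) c j * phi j z)%R : mR).
  apply: measurable_sum => j; apply: measurable_funM; [exact: measurable_cst|exact: mphi].
have SB z : K z -> (`|\sum_(0 <= j < n) c j * phi j z| <= \sum_(0 <= j < n) `|c j| * B)%R.
  move=> _; apply: le_trans (ler_norm_sum _ _ _) _; apply: ler_sum => j _.
  by rewrite normrM; apply: ler_wpM2l.
have i1 := integrable_pair mK intf mS SB.
have i2 := integrable_pair mK intf (mphi n) (fun z _ => phiB n z).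
have i3 : mu2.-integrable K (EFin \o (fun z => c n * (f z * phi n z))%R).
  by have := integrableZl mK (c n) i2; apply: eq_integrable.
rewrite -(RintegralZl (c n) mK i2) -(RintegralD mK i1 i3).
apply: eq_Rintegral => z _; rewrite big_nat_recr//= mulrDr; congr (_ + _)%R.
by rewrite mulrCA.
Qed.

(** The pairing commutes with uniformly convergent series of test functions. *)
Lemma Rintegral_pair_wsum (K : set (R * R)) (f : R * R -> R) (phi : nat -> R * R -> R)
    (c : nat -> R) (B : R) : measurable (K : set mR2) ->
  mu2.-integrable K (EFin \o f) ->
  (forall j, measurable_fun (K : set mR2) (phi j : mR2 -> mR)) ->
  (forall j z, `|phi j z| <= B)%R ->
  (forall j, `|c j| <= (3^-1) ^+ j)%R ->
  measurable_fun (K : set mR2) ((fun z => wsum c (fun j => phi j z)) : mR2 -> mR) ->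
  (\int[mu2]_(z in K) (f z * wsum c (fun j => phi j z)) =
   wsum c (fun j => \int[mu2]_(z in K) (f z * phi j z)))%R.
Proof.
move=> mK intf mphi phiB cP mw.
have B0 : (0 <= B)%R by exact: le_trans (phiB 0%N (0, 0)%R).
have cc := cvg_geometric3 cP.
pose T := limn (series (fun j => `|c j|%R)).
have T0 : (0 <= T)%R.
  by apply: limr_ge => //; near=> n; rewrite /series/=; apply: sumr_ge0.
have tail z n : (`|wsum c (fun j => phi j z) - \sum_(0 <= j < n.+1) c j * phi j z|
    <= B * (3^-1) ^+ n)%R.
  have [cv _] := is_cvg_wsum cc (fun j => phiB j z).
  have cvd : (fun m => `|\sum_(0 <= j < m) c j * phi j z -
      \sum_(0 <= j < n.+1) c j * phi j z|%R) @ \oo -->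
      `|wsum c (fun j => phi j z) - \sum_(0 <= j < n.+1) c j * phi j z|%R.
    by apply: cvg_norm; apply: cvgB; [exact: cv|exact: cvg_cst].
  rewrite -(cvg_lim _ cvd)//; apply: limr_le; first by apply/cvg_ex; eexists; exact: cvd.
  exists n.+1 => // m /= nm.
  rewrite (big_cat_nat (n := n.+1))//= addrAC subrr add0r.
  apply: le_trans (ler_norm_sum _ _ _) _.
  apply: (@le_trans _ _ (\sum_(n.+1 <= j < m) (3^-1) ^+ j * B)%R).
    by apply: ler_sum => j _; rewrite normrM; apply: ler_pM.
  rewrite -mulr_suml mulrC; apply: ler_wpM2l => //.
  have := geometric_tail n (m - n.+1) (R := R); rewrite subnKC// => /le_trans; apply.
  by rewrite ler_pdivrMr// ler_peMr ?ler1n// exprn_ge0.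
apply/esym/cvg_lim => //.
set I := (\int[mu2]_(z in K) (f z * _))%R; set C := (\int[mu2]_(z in K) `|f z|)%R.
have C0 : (0 <= C)%R by apply: Rintegral_ge0.
have est n : (`|I - \sum_(0 <= j < n.+1) c j * \int[mu2]_(z in K) (f z * phi j z)|
    <= B * (3^-1) ^+ n * C)%R.
  rewrite -(Rintegral_pair_sum c n.+1 mK intf mphi phiB).
  have mS : measurable_fun (K : set mR2) (fun z : mR2 => (\sum_(0 <= j < n.+1) c j * phi j z)%R : mR).
    apply: measurable_sum => j; apply: measurable_funM; [exact: measurable_cst|exact: mphi].
  apply: (@pair_lip _ K mK f _ _ (B * T + B)%R) => //.
  - by move=> z _; apply: le_trans (is_cvg_wsum cc (fun j => phiB j z)).2 _; rewrite lerDl.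
  - move=> z _; have h1 := tail z n; have h2 := (is_cvg_wsum cc (fun j => phiB j z)).2.
    have := ler_normB (wsum c (fun j => phi j z)) (wsum c (fun j => phi j z) -
      \sum_(0 <= j < n.+1) c j * phi j z)%R.
    rewrite opprB addrC subrK => /le_trans; apply; apply: lerD => //.
    apply: le_trans h1 _; rewrite -[leRHS]mulr1; apply: ler_wpM2l => //.
    by apply: exprn_ile1; lra.
have small : (fun n => B * (3^-1) ^+ n * C)%R @ \oo --> 0%R.
  have s1 : (fun n => (3^-1 : R) ^+ n)%R @ \oo --> 0%R.
    by apply: cvg_expr; rewrite ger0_norm; lra.
  have s2 := cvgM (cvgM (cvg_cst B) s1) (cvg_cst C).
  rewrite mulr0 mul0r in s2; exact: s2.
rewrite -(cvg_shiftS (series _)); apply/cvgrPdist_le => e e0.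
move/cvgrPdist_le : small => /(_ e e0); apply: filterS => n.
rewrite sub0r normrN => h; apply: le_trans (est n) _.
by apply: le_trans h; exact: ler_norm.
Unshelve. all: by end_near.
Qed.

Variables (a b : \bar R).
Local Notation S := (strip a b).

Lemma WAP_bohr v phi x1 x2 y1 y2 : WAP S v -> bumpfun x1 x2 y1 y2 phi ->
  a < y1%:E -> y2%:E < b -> bohr_almost_periodic (translate_pairing S v phi).
Proof.
move=> [_ wv] bphi ay yb; apply: wv; apply: bumpfun_test_function bphi _.
exact: box_sub_strip.
Qed.

(** A mean value bounds [v] at the centre; uniformity in the height of the centre
    comes from the uniform boundedness principle. *)
Lemma WAP_upper_bound v c e : WAP S v -> a < c%:E -> e%:E < b -> (c <= e)%R ->
  exists2 M : R, (0 <= M)%R & forall z, (c <= z.2 <= e)%R -> v z <= M%:E.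
Proof.
move=> wv ac eb ce; have [sv _] := wv.
have [d d0 [acd ebd]] := strip_margin ac eb.
have [k [A krho]] := exists_radial_kernel d0.
pose K := box (- d) d (c - d) (e + d).
have mK : measurable (K : set mR2) by exact: measurable_box.
have dd : (- d <= d)%R by lra.
have cde : (c - d <= e + d)%R by lra.
have discK y : (c <= y <= e)%R -> closed_disc (0, y)%R d `<=` K.
  move=> /andP[? ?]; apply: closed_disc_sub_box; first exact: ltW.
  by apply/boxE => /=; split; lra.
have mollE t y : mollify a b d k v (t, y) = mollify a b d k (htrans t v) (0, y)%R.
  by rewrite (mollify_htrans krho _ _ sv)/= add0r.
have A0 : (0 <= A)%R by have /andP[h1 h2] := bump_at_bounds krho 0 (0, 0)%R; exact: le_trans h2.
have bnd y z : (`|bump_at d k y z| <= A)%R.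
  by have /andP[h1 h2] := bump_at_bounds krho y z; rewrite ger0_norm.
have [M MP] : exists M, forall t y, [set y | c <= y <= e]%R y ->
    (`|mollify a b d k v (t, y)| <= M)%R.
  apply: gliding_hump.
    move=> t; have svt := subharmonic_htrans t sv.
    have [M M0 vM] := subharmonic_box_bounded svt (- d) d acd ebd.
    exists (M + `|M - A * fine (\int[mu2]_z gap K M (htrans t v) z)|)%R => y /= yce.
    rewrite mollE.
    have /andP[h1 h2] := mollify_bounds krho svt acd ebd M0 dd cde vM (discK y yce).
    move: h1 h2; rewrite -/K; set X := (M - _)%R; set Y := mollify _ _ _ _ _ _ => h1 h2.
    have := ler_norm X; have := ler_norm (- X)%R; rewrite normrN => ? ?.
    by rewrite ler_norml; apply/andP; split; lra.
  move=> cs ys ysP csP.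
  have b0 := bumpfun_bump_at krho 0.
  have bs := bumpfun_superpose (cvg_geometric3 csP) b0 ysP.
  have bs' : bumpfun (- d) d (c - d) (e + d) (superpose cs ys (bump_at d k 0)).
    by rewrite !add0r in bs.
  have [B BP] := bohr_bounded (WAP_bohr wv bs' acd ebd).
  exists B => t; suff -> : wsum cs (fun j => mollify a b d k v (t, ys j)) =
      translate_pairing S v (superpose cs ys (bump_at d k 0)) t by exact: BP.
  have [B1 _ B1P] := bumpfun_bounded bs'.
  rewrite (translate_pairingE t sv (bumpfun_measurable bs') B1P bs'.2 acd ebd dd cde).
  have supE z : superpose cs ys (bump_at d k 0) z = wsum cs (fun j => bump_at d k (ys j) z).
    rewrite /superpose; congr (wsum cs _); apply/funext => j.
    by rewrite /bump_at/= subr0.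
  under eq_Rintegral do rewrite supE.
  have mball j : measurable_fun (K : set mR2) (bump_at d k (ys j) : mR2 -> mR).
    by apply: measurable_funTS; exact: bumpfun_measurable (bumpfun_bump_at krho _).
  rewrite (Rintegral_pair_wsum mK _ mball (fun j z => bnd (ys j) z) csP); last 2 first.
  - apply: fine_integrable => //.
    exact: (subharmonic_integrable (subharmonic_htrans t sv) acd ebd dd cde).
  - apply: measurable_funTS; rewrite (_ : (fun z => _) = superpose cs ys (bump_at d k 0)).
      exact: bumpfun_measurable bs'.
    by apply/funext => z; rewrite supE.
  congr (wsum cs _); apply/funext => j; rewrite /mollify/=.
  have /andP[yj1 yj2] : (c <= ys j <= e)%R := ysP j.
  apply: (translate_pairingE t sv _ (bnd (ys j)) _ acd ebd dd cde).
    exact: bumpfun_measurable (bumpfun_bump_at krho _).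
  move=> z zK; apply: (bumpfun_bump_at krho (ys j)).2 => zb; apply: zK.
  by apply: sub_box zb; lra.
exists `|M|%R => // -[t y] /= yce.
have svt := subharmonic_htrans t sv.
have [M' M'0 vM'] := subharmonic_box_bounded svt (- d) d acd ebd.
have := mollify_ge krho svt acd ebd M'0 dd cde vM' (discK y yce).
rewrite -mollE /htrans/= add0r => /le_trans; apply; rewrite lee_fin.
by apply: le_trans (ler_norm _) _; apply: le_trans (MP t y yce) (ler_norm _).
Qed.

(** Translates in which [v] is not very negative at some point of a fixed
    compact set have gaps of uniformly bounded mass. *)
Definition recurrent_lower (v : R * R -> \bar R) (y1 y2 : R) : Prop :=
  exists L m : R, forall t, exists z, [/\ (`|z.1 - t| <= L)%R, (y1 <= z.2 <= y2)%R &
    (- m)%:E <= v z].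

Lemma uniform_gap_bound v x1 x2 y1 y2 M r : subharmonic S v -> (0 < r)%R ->
  a < (y1 - r)%:E -> (y2 + r)%:E < b -> (0 <= M)%R ->
  (x1 <= x2)%R -> (y1 <= y2)%R ->
  (forall z, (y1 - r <= z.2 <= y2 + r)%R -> v z <= M%:E) ->
  recurrent_lower v y1 y2 ->
  exists2 C : R, (0 <= C)%R & forall t,
    \int[mu2]_z gap (box x1 x2 y1 y2) M (htrans t v) z <= C%:E.
Proof.
move=> sv r0 ay yb M0 x12 y12 vM [L [m Lm]].
pose X1 := Num.min x1 (- L)%R; pose X2 := Num.max x2 L.
pose h := (r / 5)%R; have h0 : (0 < h)%R by rewrite divr_gt0.
have hr : (5 * h = r)%R by rewrite /h; lra.
have m0 : (0 < `|M + m| + 1)%R by rewrite ltr_wpDl.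
have [C C0 CP] := harnack_box (X2 - X1) (y2 - y1) h0 m0.
exists C => // t; have svt := subharmonic_htrans t sv.
pose B := box (X1 - 5 * h) (X2 + 5 * h) (y1 - 5 * h) (y2 + 5 * h).
have aB : a < (y1 - 5 * h)%:E by rewrite hr.
have bB : (y2 + 5 * h)%:E < b by rewrite hr.
have vMt z : B z -> htrans t v z <= M%:E.
  by move=> /boxE[_ _ h1 h2]; apply: vM; rewrite -hr /=; apply/andP.
have mw := measurable_gap_box svt (X1 - 5 * h) (X2 + 5 * h) M aB bB.
have sw := supermean_gap_box svt aB bB M0 vMt.
have w0 z := gap_ge0 z vMt.
have KB : box X1 X2 y1 y2 `<=` B.
  by apply: sub_box; rewrite ?gerBl ?lerDl mulr_ge0// ltW.
have [z0 [z0L z0y z0m]] := Lm t.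
have Kz : box X1 X2 y1 y2 (z0.1 - t, z0.2)%R.
  move: z0L; rewrite ler_norml => /andP[l1 l2]; have /andP[? ?] := z0y.
  by apply/boxE; split => //=; rewrite ?ge_min ?le_max ?l1 ?l2 orbT.
have wz : gap B M (htrans t v) (z0.1 - t, z0.2)%R <= (`|M + m| + 1)%:E.
  rewrite gapE; last exact: KB.
  rewrite /htrans/= subrK -surjective_pairing; move: z0m; case: (v z0) => [s||]//=.
    rewrite -?EFinB !lee_fin => ms; have := ler_norm (M + m)%R; lra.
  by rewrite addeNy leNye.
have iC := CP B _ _ _ _ _ mw w0 sw (lexx _) (lexx _) (@subset_refl _ B)
  (ex_intro2 _ _ _ Kz wz).
have QK : box x1 x2 y1 y2 `<=` box X1 X2 y1 y2.
  by apply: sub_box; rewrite ?ge_min ?le_max lexx.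
have mQ := @measurable_box R x1 x2 y1 y2; have mK := @measurable_box R X1 X2 y1 y2.
apply: le_trans iC; rewrite integral_gap//.
apply: (@le_trans _ _ (\int[mu2]_(z in box x1 x2 y1 y2) gap B M (htrans t v) z)).
  rewrite le_eqVlt; apply/orP; left; apply/eqP; apply: eq_integral => z.
  by rewrite inE => Qz; rewrite gapE//; exact/KB/QK.
apply: ge0_subset_integral; [exact: mQ|exact: mK|exact: measurable_funTS| |exact: QK].
by move=> z _; exact: w0.
Qed.

End UniformBounds.

(** * Almost periodicity through approximation in the mean *)

Section Approximation.
Context {R : realType}.
Local Notation mu2 := (@lebesgue_measure R \x @lebesgue_measure R)%E.
Local Notation mR := (measurableTypeR R).
Local Notation mR2 := (mR * mR)%type.
Variables (a b : \bar R).
Local Notation S := (strip a b).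

Lemma finite_net (c e h : R) : (c <= e)%R -> (0 < h)%R ->
  exists l : seq R, (forall y, List.In y l -> (c <= y <= e)%R) /\
    forall y, (c <= y <= e)%R -> exists2 y', List.In y' l & (`|y - y'| <= h)%R.
Proof.
move=> ce h0.
have net n : exists l : seq R, (forall y, List.In y l -> (c <= y <= e)%R) /\
    forall y, (c <= y <= e)%R -> (y <= c + n%:R * h)%R ->
      exists2 y', List.In y' l & (`|y - y'| <= h)%R.
  elim: n => [|n [l [l1 l2]]].
    exists [:: c]; split => [y [<-|//]|y /andP[cy ye]]; first by rewrite lexx.
    rewrite mul0r addr0 => yc; exists c; first by left.
    by rewrite ler_norml; apply/andP; split; lra.
  have [q|q] := leP (c + n%:R * h)%R e; last first.
    exists l; split => // y yce _; apply: l2 => //.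
    by have /andP[_ ye] := yce; exact/ltW/(le_lt_trans ye).
  exists ((c + n%:R * h)%R :: l); split.
    move=> y [<-|]; last exact: l1.
    by rewrite q andbT lerDl mulr_ge0// ltW.
  move=> y yce yn; have [yn'|yn'] := leP y (c + n%:R * h)%R.
    by have [y' ? ?] := l2 y yce yn'; exists y' => //; right.
  exists (c + n%:R * h)%R; first by left.
  move: yn; rewrite -natr1 mulrDl mul1r addrA => yn.
  by rewrite ler_norml; apply/andP; split; lra.
have [l [l1 l2]] := net (Num.bound ((e - c) / h)).
exists l; split => // y yce; apply: l2 => //.
have hh : ((e - c) / h < (Num.bound ((e - c) / h))%:R)%R.
  by apply: archi_boundP; rewrite divr_ge0 ?subr_ge0// ltW.
by rewrite ltr_pdivrMr// in hh; have /andP[_ ye] := yce; lra.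
Qed.

(** Mollification turns almost periodicity in the mean into uniform almost
    periodicity on closed substrips.  Kernels centred at nearby heights are uniformly
    close, so finitely many heights control all the others. *)
Lemma mollify_coloured (d k A : R) (v : R * R -> \bar R) (c e C eps : R) :
  radial_kernel d A (bump_profile d k) -> WAP S v ->
  a < (c - d)%:E -> (e + d)%:E < b -> (c <= e)%R -> (0 <= C)%R -> (0 < eps)%R ->
  (forall t, \int[mu2]_(z in box (- d) d (c - d) (e + d)) `|fine (htrans t v z)| <= C)%R ->
  finitely_coloured (fun s t => forall z : R * R, (c <= z.2 <= e)%R ->
    `|mollify a b d k v (z.1 + s, z.2) - mollify a b d k v (z.1 + t, z.2)| <= eps)%R.
Proof.
move=> krho wv ac eb ce C0 eps0 vC; have [sv _] := wv.
have [_ _ _ d0 _] := krho.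
have dd : (- d <= d)%R by lra.
have cde : (c - d <= e + d)%R by lra.
pose K := box (- d) d (c - d) (e + d).
have mK : measurable (K : set mR2) by exact: measurable_box.
have [L L0 LP] := bumpfun_lip (bumpfun_bump_at krho 0).
have bnd y z : (`|bump_at d k y z| <= A)%R.
  by have /andP[h1 h2] := bump_at_bounds krho y z; rewrite ger0_norm.
have mbump y : measurable_fun (setT : set mR2) (bump_at d k y : mR2 -> mR).
  exact: bumpfun_measurable (bumpfun_bump_at krho y).
have moll_pair t y : (c <= y <= e)%R -> mollify a b d k v (t, y) =
    (\int[mu2]_(z in K) (fine (htrans t v z) * bump_at d k y z))%R.
  move=> /andP[cy ye]; apply: (translate_pairingE t sv (mbump y) (bnd y) _ ac eb dd cde).
  move=> z zK; apply: (bumpfun_bump_at krho y).2 => zb; apply: zK.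
  by apply: sub_box zb; lra.
have mollL t y y' : (c <= y <= e)%R -> (c <= y' <= e)%R ->
    (`|mollify a b d k v (t, y) - mollify a b d k v (t, y')| <= L * `|y - y'| * C)%R.
  move=> yce y'ce; rewrite !moll_pair//.
  have iv : mu2.-integrable K (EFin \o (fine \o htrans t v)).
    apply: fine_integrable => //.
    exact: (subharmonic_integrable (subharmonic_htrans t sv) ac eb dd cde).
  apply: le_trans (@pair_lip _ K mK _ _ _ A (L * `|y - y'|)%R iv (measurable_funTS (mbump y))
    (measurable_funTS (mbump y')) (fun z _ => bnd y z) (fun z _ => bnd y' z) _) _.
    move=> z _; have := LP (z.1, z.2 - y)%R (z.1, z.2 - y')%R.
    rewrite /bump_at/= !subr0 subrr normr0 add0r (_ : z.2 - y - (z.2 - y') = - (y - y'))%R.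
      by rewrite normrN.
    by ring.
  by apply: ler_wpM2l; [exact: mulr_ge0|exact: vC].
pose h := (eps / (3 * (L * C + 1)))%R.
have LC0 : (0 <= L * C)%R by exact: mulr_ge0.
have h0 : (0 < h)%R by rewrite divr_gt0//; lra.
have hE : (L * h * C <= eps / 3)%R.
  have -> : (L * h * C = (L * C) * eps / (3 * (L * C + 1)))%R by rewrite /h; ring.
  rewrite ler_pdivrMr; last by lra.
  by move: LC0; move: (L * C)%R => q q0; nra.
have [l [l1 l2]] := finite_net ce h0.
have eps30 : (0 < eps / 3)%R by lra.
have tap y : (c <= y <= e)%R -> totally_ap (translate_pairing S v (bump_at d k y)).
  move=> /andP[cy ye]; apply/bohr_totally_ap/(WAP_bohr wv (bumpfun_bump_at krho y)).
    by apply: lt_le_trans ac _; rewrite lee_fin; lra.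
  by apply: le_lt_trans eb; rewrite lee_fin; lra.
apply: finitely_coloured_sub (finitely_coloured_forall (fun y yl => tap y (l1 y yl) _ eps30)).
move=> s t H [x y] /= yce; have [y' y'l yy'] := l2 y yce.
have y'ce := l1 y' y'l.
have E u : (`|mollify a b d k v (u, y) - mollify a b d k v (u, y')| <= eps / 3)%R.
  apply: le_trans (mollL u y y' yce y'ce) _; apply: le_trans hE.
  by apply: ler_wpM2r => //; exact: ler_wpM2l.
have h1 := E (x + s)%R; have h2 := E (x + t)%R; have h3 := H y' y'l x.
move: h1 h2 h3; rewrite -[translate_pairing S v _ (x + s)%R]/(mollify a b d k v (x + s, y')%R).
rewrite -[translate_pairing S v _ (x + t)%R]/(mollify a b d k v (x + t, y')%R).
move: (mollify a b d k v (x + s, y)%R) (mollify a b d k v (x + s, y')%R).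
move: (mollify a b d k v (x + t, y)%R) (mollify a b d k v (x + t, y')%R).
move=> q q' p p' h1 h2 h3.
have -> : (p - q = (p - p') + (p' - q') - (q - q'))%R by ring.
apply: le_trans (ler_normB _ _) _; apply: (@le_trans _ _ (eps / 3 + eps / 3 + eps / 3)%R).
  by apply: lerD => //; apply: le_trans (ler_normD _ _) _; exact: lerD.
by lra.
Qed.

(** A weighted mean does not exceed all the values that it averages. *)
Lemma mollify_point (d k A : R) (v : R * R -> \bar R) (z : R * R) (eps : R) :
  radial_kernel d A (bump_profile d k) -> subharmonic S v ->
  a < (z.2 - d)%:E -> (z.2 + d)%:E < b -> (0 < eps)%R ->
  exists2 p, closed_disc z d p & (mollify a b d k v z - eps)%:E <= v p.
Proof.
move=> krho sv az zb eps0; have [mrho rhob rho_out d0 rho1] := krho.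
pose B := sq z d.
have zB : closed_disc z d `<=` B by apply: closed_disc_sub_sq; exact: ltW.
have z1 : (z.1 - d <= z.1 + d)%R by lra.
have z2 : (z.2 - d <= z.2 + d)%R by lra.
have [M M0 vM] := subharmonic_box_bounded sv (z.1 - d) (z.1 + d) az zb.
have mE := mollifyE krho sv az zb M0 z1 z2 vM zB.
have [afin _ _] := average_gap_bounds krho sv az zb M0 z1 z2 vM z.
have mw := measurable_gap_box sv (z.1 - d) (z.1 + d) M az zb.
have w0 p := gap_ge0 p vM.
apply: contrapT => nex.
pose m := (mollify a b d k v z - eps)%R.
have lt p : closed_disc z d p -> v p < m%:E.
  by move=> zp; rewrite ltNge; apply/negP => h; apply: nex; exists p.
have mM : (m <= M)%R by rewrite /m mE; have := fine_ge0 (average_ge0 krho w0 z); lra.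
have : (M - m)%:E <= average (bump_profile d k) (gap B M v) z.
  have mr0 : measurable_fun (setT : set mR2) (fun p : mR2 => (bump_profile d k (sqnorm p))%:E).
    by apply/measurable_EFinP; exact: (measurableT_comp mrho (@measurable_sqnorm R)).
  have rho0 p : 0 <= (bump_profile d k (sqnorm p))%:E by rewrite lee_fin; have /andP[] := rhob (sqnorm p).
  have Mm0 : 0 <= (M - m)%:E by rewrite lee_fin subr_ge0.
  rewrite -[leLHS]mule1 -rho1 -(ge0_integralZl mu2 measurableT mr0 (fun p _ => rho0 p) Mm0).
  apply: ge0_le_integral.
  - exact: measurableT.
  - by move=> p _; exact: mule_ge0.
  - exact: measurable_funeM.
  - apply: emeasurable_funM => //; apply: (measurableT_comp mw).
    by apply: measurable_fun_pair; exact: measurable_funD.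
  move=> p _; have [pd|pd] := leP (sqnorm p) (d ^+ 2)%R; last first.
    by rewrite (rho_out _ pd) !mule0.
  have zp : closed_disc z d (z.1 + p.1, z.2 + p.2)%R.
    by rewrite /closed_disc/= (addrC z.1) (addrC z.2) !addrK.
  apply: lee_wpmul2r; first exact: rho0.
  rewrite (gapE M v (zB _ zp)); move: (lt _ zp); case: (v _) => [s||]//=.
    by rewrite lte_fin -?EFinB lee_fin => sm; lra.
  by rewrite leey.
by rewrite -(fineK afin) lee_fin /m mE; lra.
Qed.

(** Translating the argument amounts to translating the test function, which is
    Lipschitz. *)
Lemma translate_pairing_continuous (v : R * R -> \bar R) (phi : R * R -> R)
    (x1 x2 y1 y2 : R) : subharmonic S v -> bumpfun x1 x2 y1 y2 phi ->
  a < y1%:E -> y2%:E < b -> (x1 <= x2)%R -> (y1 <= y2)%R ->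
  continuous (translate_pairing S v phi).
Proof.
move=> sv bphi ay yb x12 y12 t0.
have [L L0 LP] := bumpfun_lip bphi; have [B B0 BP] := bumpfun_bounded bphi.
have mphi := bumpfun_measurable bphi.
pose K := box (x1 - 1) (x2 + 1) y1 y2.
have mK : measurable (K : set mR2) by exact: measurable_box.
have x12' : (x1 - 1 <= x2 + 1)%R by lra.
have svt := subharmonic_htrans t0 sv.
pose phis (s : R) (z : R * R) := phi (z.1 - s, z.2)%R.
have mphis s : measurable_fun (setT : set mR2) (phis s : mR2 -> mR).
  exact: (@measurable_htrans _ _ mR (- s)%R phi).
pose f := fine \o htrans t0 v.
have iv : mu2.-integrable K (EFin \o f).
  by apply: fine_integrable => //; exact: (subharmonic_integrable svt ay yb x12' y12).
pose C := (\int[mu2]_(z in K) `|f z|)%R.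
have C0 : (0 <= C)%R by apply: Rintegral_ge0.
have E s : (`|s| <= 1)%R -> translate_pairing S v phi (t0 + s)%R =
    (\int[mu2]_(z in K) (f z * phis s z))%R.
  move=> s1; rewrite addrC -(translate_pairing_htrans s t0 sv mphi).
  have -> : translate_pairing S (htrans t0 v) phi s =
      translate_pairing S (htrans t0 v) (phis s) 0%R.
    by rewrite /translate_pairing /phis; congr fine; apply: eq_integral => z _; rewrite /= subr0.
  rewrite (@translate_pairingE _ a b _ _ (x1 - 1)%R (x2 + 1)%R y1 y2 B 0%R svt (mphis s)) //.
  - by apply: eq_Rintegral => z _; rewrite /f/= /htrans addr0 -surjective_pairing.
  - by move=> z; exact: BP.
  - move=> z zK; apply: bphi.2 => /boxE/= [? ? ? ?]; apply: zK.
    move: s1; rewrite ler_norml => /andP[? ?].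
    by apply/boxE; split => //; lra.
apply/cvgrPdist_le => eps eps0.
pose e := Num.min 1%R (eps / (L * C + 1))%R.
have LC0 : (0 <= L * C)%R by exact: mulr_ge0.
have LC1 : (0 < L * C + 1)%R by lra.
have e0 : (0 < e)%R by rewrite lt_min ltr01 divr_gt0.
have : nbhs t0 (ball t0 e) by exact: nbhsx_ballx.
apply: filterS => t; rewrite /ball/= distrC => tt0.
have s1 : (`|t - t0| <= 1)%R by apply: ltW; apply: lt_le_trans tt0 _; rewrite ge_min lexx.
have s2 : (`|t - t0| * (L * C + 1) <= eps)%R.
  by rewrite -ler_pdivlMr//; apply: ltW; apply: lt_le_trans tt0 _; rewrite ge_min lexx orbT.
have n01 : (`|0 : R| <= 1)%R by rewrite normr0.
have := E 0%R n01; rewrite addr0 => ->; have := E _ s1; rewrite addrC subrK => ->.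
apply: le_trans (@pair_lip _ K mK f (phis 0%R) (phis (t - t0)%R) B (L * `|t - t0|)%R iv
  (measurable_funTS (mphis _)) (measurable_funTS (mphis _)) (fun z _ => BP _) (fun z _ => BP _) _) _.
  move=> z _; rewrite /phis; apply: le_trans (LP _ _) _; rewrite /= subrr normr0 addr0.
  by rewrite subr0 opprB addrCA subrr addr0.
rewrite -/C; have := normr_ge0 (t - t0)%R; move: s2; move: (`|t - t0|)%R => q; nra.
Qed.

Lemma le_Rintegral_of_integral (K : set (R * R)) (f : R * R -> R) (eps : R) :
  measurable (K : set mR2) -> measurable_fun (K : set mR2) (f : mR2 -> mR) ->
  \int[mu2]_(z in K) (`|f z|%R)%:E <= eps%:E ->
  mu2.-integrable K (EFin \o f) /\ (\int[mu2]_(z in K) `|f z| <= eps)%R.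
Proof.
move=> mK mf fe; have i0 : 0 <= \int[mu2]_(z in K) (`|f z|%R)%:E.
  by apply: integral_ge0 => z _; rewrite lee_fin.
have fin : \int[mu2]_(z in K) (`|f z|%R)%:E \is a fin_num.
  by rewrite ge0_fin_numE//; apply: le_lt_trans fe (ltry _).
split; last by rewrite /Rintegral -lee_fin fineK.
apply/integrableP; split; first exact/measurable_EFinP.
by apply: le_lt_trans fe (ltry _).
Qed.

(** The pairings of [v] and of [G] differ by little, uniformly in the translate, and
    translates of [G] of the same colour have close pairings. *)
Lemma totally_ap_approx (v : R * R -> \bar R) (phi : R * R -> R) (x1 x2 y1 y2 : R) :
  subharmonic S v -> bumpfun x1 x2 y1 y2 phi ->
  a < y1%:E -> y2%:E < b -> (x1 <= x2)%R -> (y1 <= y2)%R ->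
  (forall eps, (0 < eps)%R -> exists G : R * R -> R, [/\
    forall t, measurable_fun (box x1 x2 y1 y2 : set mR2) (htrans t G : mR2 -> mR),
    exists B, forall z, (y1 <= z.2 <= y2)%R -> (`|G z| <= B)%R,
    forall t, \int[mu2]_(z in box x1 x2 y1 y2)
      (`|fine (htrans t v z) - htrans t G z|%R)%:E <= eps%:E &
    finitely_coloured (fun s t => forall z : R * R, (y1 <= z.2 <= y2)%R ->
      `|G (z.1 + s, z.2) - G (z.1 + t, z.2)| <= eps)%R]) ->
  totally_ap (translate_pairing S v phi).
Proof.
move=> sv bphi ay yb x12 y12 H e e0.
have [B B0 BP] := bumpfun_bounded bphi; have mphi := bumpfun_measurable bphi.
pose K := box x1 x2 y1 y2; have mK : measurable (K : set mR2) by exact: measurable_box.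
have iphi : mu2.-integrable K (EFin \o phi).
  apply: (@le_integrable _ _ _ mu2 K mK _ (cst B%:E)).
  - by apply: measurable_funTS; exact/measurable_EFinP.
  - by move=> z _; rewrite /= lee_fin (ger0_norm B0).
  - by apply: integrable_cst => //; rewrite [ltLHS]area_box// ltry.
pose P := (\int[mu2]_(z in K) `|phi z|)%R.
have P0 : (0 <= P)%R by apply: Rintegral_ge0.
pose eps := (e / (2 * B + P + 1))%R.
have den : (0 < 2 * B + P + 1)%R by lra.
have eps0 : (0 < eps)%R by rewrite divr_gt0.
have [G [mG [BG BGP] vG cG]] := H eps eps0.
apply: finitely_coloured_sub cG => s t st x.
have FE u : translate_pairing S v phi u = (\int[mu2]_(z in K) (fine (htrans u v z) * phi z))%R.
  exact: (translate_pairingE u sv mphi BP bphi.2 ay yb x12 y12).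
have Gb u z : K z -> (`|htrans u G z| <= BG)%R.
  by move=> /boxE[_ _ ? ?]; apply: BGP; apply/andP.
have iv u : mu2.-integrable K (EFin \o (fine \o htrans u v)).
  by apply: fine_integrable => //; exact: (subharmonic_integrable (subharmonic_htrans u sv) ay yb x12 y12).
have mv u : measurable_fun (K : set mR2) ((fine \o htrans u v) : mR2 -> mR).
  by apply/measurable_EFinP; exact: measurable_int (iv u).
pose Hu u := (\int[mu2]_(z in K) (phi z * htrans u G z))%R.
have close u : (`|translate_pairing S v phi u - Hu u| <= B * eps)%R.
  have md : measurable_fun (K : set mR2) ((fun z => fine (htrans u v z) - htrans u G z)%R : mR2 -> mR).
    by apply: measurable_funB; [exact: mv|exact: mG].
  have [id de] := le_Rintegral_of_integral mK md (vG u).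
  have mphiK : measurable_fun (K : set mR2) (phi : mR2 -> mR) by exact: measurable_funTS.
  have i1 := integrable_pair mK (iv u) mphiK (fun z _ => BP z).
  have i2 := integrable_pair mK iphi (mG u) (Gb u).
  have m0 : measurable_fun (K : set mR2) ((fun=> 0%R) : mR2 -> mR) by exact: measurable_cst.
  have z0 (z : R * R) : K z -> (`|0 : R| <= B)%R by rewrite normr0.
  have p0 (z : R * R) : K z -> (`|phi z - 0| <= B)%R by rewrite subr0.
  have := @pair_lip _ K mK _ phi (fun=> 0%R) B B id mphiK m0 (fun z _ => BP z) z0 p0.
  have -> : (\int[mu2]_(z in K) ((fine (htrans u v z) - htrans u G z) * 0) = 0)%R.
    by under eq_Rintegral do rewrite mulr0; rewrite Rintegral_cst// mul0r.
  rewrite subr0 => h; rewrite FE /Hu -(RintegralB mK i1 i2).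
  have -> : (\int[mu2]_(z in K) (fine (htrans u v z) * phi z - phi z * htrans u G z) =
      \int[mu2]_(z in K) ((fine (htrans u v z) - htrans u G z) * phi z))%R.
    by apply: eq_Rintegral => z _; ring.
  by apply: le_trans h _; apply: ler_wpM2l.
have hh : (`|Hu (x + s)%R - Hu (x + t)%R| <= eps * P)%R.
  apply: (@pair_lip _ K mK phi _ _ BG eps iphi (mG _) (mG _) (Gb _) (Gb _)).
  move=> z /boxE[_ _ ? ?]; rewrite /htrans addrA addrA.
  by apply: (st (z.1 + x, z.2)%R); apply/andP.
have h1 := close (x + s)%R; have h2 := close (x + t)%R.
have E : (e = B * eps + eps * P + B * eps + eps)%R.
  have -> : (e = eps * (2 * B + P + 1))%R by rewrite /eps divfK// gt_eqF.
  by move: (eps : R) (B : R) (P : R) => q q1 q2; ring.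
move: h1 h2 hh; move: (translate_pairing S v phi (x + s)%R) (translate_pairing S v phi (x + t)%R).
move: (Hu (x + s)%R) (Hu (x + t)%R) => p' q' p q h1 h2 hh.
have -> : (p - q = (p - p') + (p' - q') - (q - q'))%R by ring.
apply: le_trans (ler_normB _ _) _.
apply: (@le_trans _ _ (B * eps + eps * P + B * eps)%R); last by rewrite [leRHS]E lerDl ltW.
by apply: lerD => //; apply: le_trans (ler_normD _ _) _; exact: lerD.
Qed.

End Approximation.

(** * Logarithmically subharmonic functions are subharmonic *)

Section LogSubharmonic.
Context {R : realType}.
Local Notation mu2 := (@lebesgue_measure R \x @lebesgue_measure R)%E.
Local Notation mu := (@lebesgue_measure R).
Local Notation mR := (measurableTypeR R).
Local Notation mR2 := (mR * mR)%type.

Lemma expR_tangent (c x : R) : (expR c * (1 + x - c) <= expR x)%R.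
Proof.
rewrite -[X in (_ <= expR X)%R](subrK c) expRD mulrC ler_wpM2r ?expR_ge0//.
by rewrite -addrA expR_ge1Dx.
Qed.

(** The tangent inequality of [expR] at [c] is integrated.  The integral of the
    logarithm may be [-oo], so its positive and negative parts are moved to the
    sides where they have a plus sign. *)
Lemma jensen_exp d (T : measurableType d) (m : {measure set T -> \bar R}) (I : set T)
    (g : T -> R) (c l : R) : measurable I -> m I = l%:E ->
  measurable_fun I g -> measurable_fun I (fun t => lne (g t)%:E) ->
  (forall t, 0 <= g t)%R ->
  (c * l)%:E <= \int[m]_(t in I) lne (g t)%:E ->
  (expR c * l)%:E <= \int[m]_(t in I) (g t)%:E.
Proof.
move=> mI lI mg mf g0; set f := fun t => lne (g t)%:E in mf *.
have E0 := expR_gt0 c.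
have fE t : f t = if (0 < g t)%R then (ln (g t))%:E else -oo.
  rewrite /f; case: ifPn => [gt|]; first by rewrite lne_EFin.
  by rewrite -leNgt => gt; rewrite le0_lneNy// lee_fin.
pose cp := Num.max c 0%R; pose cm := Num.max (- c)%R 0%R.
have cpm : (c = cp - cm)%R.
  by rewrite /cp /cm; case: (leP c 0%R) => ?; case: (leP (- c)%R 0%R) => ?; lra.
have cp0 : (0 <= cp)%R by rewrite /cp le_max lexx orbT.
have cm0 : (0 <= cm)%R by rewrite /cm le_max lexx orbT.
pose C1 := (expR c * (1 + cm))%R; pose C2 := (expR c * cp)%R.
have C10 : (0 <= C1)%R by rewrite mulr_ge0 ?ltW//; lra.
have C20 : (0 <= C2)%R by exact: mulr_ge0 (ltW E0) cp0.
have pt t : (expR c)%:E * f^\+ t + C1%:E <= ((g t)%:E + (expR c)%:E * f^\- t) + C2%:E.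
  rewrite funeposE funenegE fE; case: ifPn => gt.
    rewrite -EFinN -!EFin_max -!EFinM -!EFinD lee_fin.
    have := expR_tangent c (ln (g t)); rewrite lnK ?posrE// /C1 /C2 {2}cpm.
    move: (ln (g t)) => x; move: (expR c) E0 => q q0.
    have [?|?] := leP x 0%R; have [?|?] := leP (- x)%R 0%R; nra.
  rewrite /= max_r ?leNye// max_l ?leey// gt0_muley ?lte_fin//.
  by rewrite addey// addye// leey.
have mp : measurable_fun I (fun t => (expR c)%:E * f^\+ t).
  by apply: measurable_funeM; exact: measurable_funepos.
have mn : measurable_fun I (fun t => (expR c)%:E * f^\- t).
  by apply: measurable_funeM; exact: measurable_funeneg.
have me : measurable_fun I (fun t => (g t)%:E) by exact/measurable_EFinP.
have p0 t : 0 <= (expR c)%:E * f^\+ t by apply: mule_ge0; [rewrite lee_fin ltW|exact: funepos_ge0].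
have n0 t : 0 <= (expR c)%:E * f^\- t by apply: mule_ge0; [rewrite lee_fin ltW|exact: funeneg_ge0].
have ge t : 0 <= (g t)%:E by rewrite lee_fin.
have gn0 t : 0 <= (g t)%:E + (expR c)%:E * f^\- t by exact: adde_ge0.
have C1e : 0 <= C1%:E by rewrite lee_fin.
have C2e : 0 <= C2%:E by rewrite lee_fin.
have ec0 : 0 <= (expR c)%:E by rewrite lee_fin ltW.
have mc (q : R) : measurable_fun I (cst q%:E) by exact: measurable_cst.
have mgn := emeasurable_funD me mn.
have : \int[m]_(t in I) ((expR c)%:E * f^\+ t + C1%:E) <=
    \int[m]_(t in I) (((g t)%:E + (expR c)%:E * f^\- t) + C2%:E).
  apply: ge0_le_integral => //.
  - by move=> t _; exact: adde_ge0 (p0 t) C1e.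
  - exact: emeasurable_funD.
  - exact: emeasurable_funD.
rewrite (ge0_integralD m mI (fun t _ => p0 t) mp (fun t _ => C1e) (mc C1)).
rewrite (ge0_integralD m mI (fun t _ => gn0 t) mgn (fun t _ => C2e) (mc C2)).
rewrite (ge0_integralD m mI (fun t _ => ge t) me (fun t _ => n0 t) mn).
rewrite (ge0_integralZl m mI (measurable_funepos mf) (fun t _ => funepos_ge0 _ t) ec0).
rewrite (ge0_integralZl m mI (measurable_funeneg mf) (fun t _ => funeneg_ge0 _ t) ec0).
rewrite !integral_cst// lI (integralE m I f).
have P0 : 0 <= \int[m]_(t in I) f^\+ t by apply: integral_ge0 => t _; exact: funepos_ge0.
have N0 : 0 <= \int[m]_(t in I) f^\- t by apply: integral_ge0 => t _; exact: funeneg_ge0.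
have G0 : 0 <= \int[m]_(t in I) (g t)%:E by apply: integral_ge0.
move: P0 N0 G0.
move: (\int[m]_(t in I) f^\+ t) (\int[m]_(t in I) f^\- t) => P N.
case: (\int[m]_(t in I) (g t)%:E) => [G||]; [|by move=> *; rewrite leey|by []].
case: N => [N||]; [|by rewrite (_ : P - +oo = -oo) ?leeNy_eq//; case: P|by []].
case: P => [P||]; [|by move=> _ _ _; rewrite gt0_muley ?lte_fin// addye|by []].
rewrite -!EFinM -!EFinD !lee_fin /C1 /C2 => P0 N0 G0 h1 h2.
have h3 : (expR c * ((cp - cm) * l) <= expR c * (P - N))%R by rewrite -cpm ler_wpM2l// ltW.
clear -h1 h3; clearbody cp cm; move: (expR c) h1 h3 => q; lra.
Qed.

Variables (a b : \bar R) (u : R * R -> R).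
Local Notation S := (strip a b).

(** Jensen's inequality gives the mean value inequality; it is trivial at zeros of
    [u]. *)
Lemma log_subharmonic_subharmonic : log_subharmonic S u ->
  subharmonic S (fun z => (u z)%:E).
Proof.
move=> [u0 [vy [z0 Sz0 vz0] uv mean]].
have uu : upper_semicontinuous_on S (fun z => (u z)%:E).
  move=> z Sz c; rewrite lte_fin => uc; have c0 := le_lt_trans (u0 z Sz) uc.
  have vc : lne (u z)%:E < (ln c)%:E.
    have [q|q] := leP (u z) 0%R; first by rewrite le0_lneNy ?lee_fin// ltNyr.
    by rewrite lne_EFin// lte_fin ltr_ln.
  apply: filterS (uv z Sz _ vc) => w; rewrite lte_fin.
  have [q _|q] := leP (u w) 0%R; first exact: le_lt_trans q c0.
  by rewrite lne_EFin// lte_fin ltr_ln.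
split => //; [by move=> z _; exact: ltry|by exists z0|].
move=> z r r0 zS; have Sz : S z by apply: zS; exact: closed_disc_center.
have pi0 : (0 < 2 * pi :> R)%R by rewrite mulr_gt0// pi_gt0.
pose c t := (z.1 + r * cos t, z.2 + r * sin t)%R.
have Sc t : S (c t).
  by apply: zS; exact: closed_disc_circle.
pose I := `[0%R, (2 * pi)%R]%classic : set mR.
have mI : measurable I by exact: measurable_itv.
have lI : mu I = (2 * pi)%:E by rewrite [LHS]lebesgue_measure_itv/= lte_fin pi0 sube0.
have mean0 : 0 <= circle_mean (fun z => (u z)%:E) z r.
  apply: mule_ge0; first by rewrite lee_fin invr_ge0 ltW.
  by apply: integral_ge0 => t _; rewrite lee_fin; exact: u0 _ (Sc t).
have [q|q] := leP (u z) 0%R; first by apply: le_trans mean0; rewrite lee_fin.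
have := mean z r r0 zS; rewrite lne_EFin// /circle_mean => h.
have h' : (ln (u z) * (2 * pi))%:E <= \int[mu]_(t in I) lne (u (c t))%:E.
  move: h; rewrite -/I /c; case: (\int[_]_(t in _) _) => [x||]; last 2 first.
  - by rewrite leey.
  - by rewrite gt0_muleNy ?lte_fin ?invr_gt0.
  by rewrite -EFinM !lee_fin mulrC -ler_pdivrMr ?invr_gt0// invrK.
have mc : measurable_fun (setT : set mR) (c : mR -> mR2) := measurable_circle z r.
have mcomp w : upper_semicontinuous_on S w -> measurable_fun I (w \o c).
  move=> uw; have oS := @open_strip R a b; apply: measurable_funTS.
  apply: (measurable_comp (F := S : set mR2)) => //; first exact: plane_open_measurable.
    by move=> _ [t _ <-]; exact: Sc.
  exact: usc_measurable.
have muc : measurable_fun I (u \o c : mR -> mR) by apply/measurable_EFinP; exact: mcomp uu.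
have := jensen_exp mI lI muc (mcomp _ uv) (fun t => u0 _ (Sc t)) h'.
rewrite lnK ?posrE// -/I /c /=; case: (\int[_]_(t in _) _) => [x||]; [|by move=> _; rewrite gt0_muley ?leey// lte_fin invr_gt0|by []].
by rewrite -EFinM !lee_fin -ler_pdivlMr// mulrC.
Qed.

End LogSubharmonic.

(** * Mollification at a rate uniform in the translation *)

Section Mollification.
Context {R : realType}.
Local Notation mu2 := (@lebesgue_measure R \x @lebesgue_measure R)%E.
Local Notation mR := (measurableTypeR R).
Local Notation mR2 := (mR * mR)%type.
Variables (a b : \bar R).
Local Notation S := (strip a b).

Lemma recurrent_lowerW (v : R * R -> \bar R) (c e y1 y2 : R) : (y1 <= c)%R -> (e <= y2)%R ->
  recurrent_lower v c e -> recurrent_lower v y1 y2.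
Proof.
move=> yc ey [L [m Lm]]; exists L, m => t; have [z [zL /andP[cz ze] mz]] := Lm t.
by exists z; split => //; rewrite (le_trans yc cz) (le_trans ze ey).
Qed.

(** [`|v| <= (M - v) + M] as soon as [v <= M] and [0 <= M]. *)
Lemma Rintegral_norm_le (K B : set (R * R)) (v : R * R -> \bar R) (M C l : R) :
  measurable (K : set mR2) -> measurable (B : set mR2) -> K `<=` B -> (mu2 B <= l%:E) ->
  (0 <= M)%R -> measurable_fun (B : set mR2) v -> (forall z, B z -> v z <= M%:E) ->
  \int[mu2]_z gap B M v z <= C%:E ->
  (\int[mu2]_(z in K) `|fine (v z)| <= C + M * l)%R.
Proof.
move=> mK mB KB Bl M0 mv vM gC.
have mf : measurable_fun (B : set mR2) (fun z => (`|fine (v z)|%R)%:E).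
  apply/measurable_EFinP; apply: measurableT_comp => //.
  by apply: (measurableT_comp _ mv); exact: fine_measurable.
have f0 z : 0 <= (`|fine (v z)|%R)%:E by rewrite lee_fin.
have I : \int[mu2]_(z in K) (`|fine (v z)|%R)%:E <= (C + M * l)%:E.
  apply: (@le_trans _ _ (\int[mu2]_(z in B) (`|fine (v z)|%R)%:E)).
    by apply: ge0_subset_integral; [exact: mK|exact: mB|exact: mf|move=> z _; exact: f0|exact: KB].
  apply: (@le_trans _ _ (\int[mu2]_(z in B) ((M%:E - v z) + M%:E))).
    apply: ge0_le_integral => //.
    - by apply: emeasurable_funD; [exact: emeasurable_funB|exact: measurable_cst].
    move=> z Bz; have := vM z Bz; case: (v z) => [s||]//=.
    by rewrite -?EFinB -?EFinD !lee_fin => sM; rewrite ler_norml; apply/andP; split; lra.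
    by move=> _; rewrite addey// addye// leey.
  have M0e : 0 <= M%:E by rewrite lee_fin.
  have p0 z : B z -> 0 <= M%:E - v z by move=> Bz; rewrite sube_ge0 ?vM ?orbT.
  have mM : measurable_fun (B : set mR2) (fun z => M%:E - v z) by exact: emeasurable_funB.
  rewrite (ge0_integralD mu2 mB p0 mM (fun z _ => M0e) (measurable_cst _)).
  rewrite integral_gap// in gC; rewrite integral_cst// EFinD EFinM.
  by apply: leeD => //; exact: lee_wpmul2l.
have i0 : 0 <= \int[mu2]_(z in K) (`|fine (v z)|%R)%:E by apply: integral_ge0.
rewrite /Rintegral -lee_fin fineK// ge0_fin_numE//; exact: le_lt_trans I (ltry _).
Qed.

(** Harnack's inequality bounds the gaps of all translates at once; every estimate
    on a mollification depends on the translate through the mass of its gap only. *)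
Lemma uniform_mollification (v : R * R -> \bar R) (x1 x2 y1 y2 : R) :
  subharmonic S v -> a < y1%:E -> y2%:E < b -> (x1 <= x2)%R -> (y1 <= y2)%R ->
  (forall c e : R, a < c%:E -> e%:E < b -> (c <= e)%R ->
     exists2 M : R, (0 <= M)%R & forall z, (c <= z.2 <= e)%R -> v z <= M%:E) ->
  recurrent_lower v y1 y2 ->
  exists r M C : R, [/\ (0 < r)%R, (0 <= M)%R, (0 <= C)%R, a < (y1 - r)%:E & (y2 + r)%:E < b] /\
    forall d k A, radial_kernel d A (bump_profile d k) -> (d <= r)%R -> [/\
      forall z, (y1 <= z.2 <= y2)%R -> v z <= (mollify a b d k v z)%:E /\
        (M - A * C <= mollify a b d k v z <= M)%R,
      forall t, \int[mu2]_(z in box x1 x2 y1 y2)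
        ((htrans t (mollify a b d k v) z)%:E - htrans t v z) <= (d * C)%:E,
      forall t, measurable_fun (box x1 x2 y1 y2 : set mR2)
        (htrans t (mollify a b d k v) : mR2 -> mR) &
      forall t, (\int[mu2]_(z in box (- d) d (y1 - d) (y2 + d)) `|fine (htrans t v z)| <= C)%R].
Proof.
move=> sv ay yb x12 y12 ub rv.
have [r0 r00 [ar rb]] := strip_margin ay yb.
pose r := (r0 / 3)%R; have r_gt0 : (0 < r)%R by rewrite divr_gt0.
have rE : (3 * r = r0)%R by rewrite /r; lra.
have a3 : a < (y1 - 3 * r)%:E by rewrite rE.
have b3 : (y2 + 3 * r)%:E < b by rewrite rE.
have [M M0 vM] := ub (y1 - 3 * r)%R (y2 + 3 * r)%R a3 b3 ltac:(lra).
(* The box [B] leaves room for the radius [d <= r] and for the cutoff, of width [r];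
   it meets the axis [x = 0], where the pointwise bounds are read off after a
   translation. *)
pose Y1 := (y1 - 2 * r)%R; pose Y2 := (y2 + 2 * r)%R.
pose X1 := (Num.min x1 0 - 2 * r)%R; pose X2 := (Num.max x2 0 + 2 * r)%R.
have XX : [/\ X1 <= x1 - 2 * r, X1 <= - (2 * r), x2 + 2 * r <= X2 & 2 * r <= X2]%R.
  by rewrite /X1 /X2; case: (leP x1 0%R) => ?; case: (leP x2 0%R) => ?; split; lra.
have [X1x X10 X2x X20] := XX.
have aY : a < Y1%:E by apply: lt_le_trans a3 _; rewrite lee_fin /Y1; lra.
have bY : Y2%:E < b by apply: le_lt_trans b3; rewrite lee_fin /Y2; lra.
have X12 : (X1 <= X2)%R by lra.
have Y12 : (Y1 <= Y2)%R by rewrite /Y1 /Y2; lra.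
have aYr : a < (Y1 - r)%:E by apply: lt_le_trans a3 _; rewrite lee_fin /Y1; lra.
have bYr : (Y2 + r)%:E < b by apply: le_lt_trans b3; rewrite lee_fin /Y2; lra.
have vM' z : (Y1 - r <= z.2 <= Y2 + r)%R -> v z <= M%:E.
  by rewrite /Y1 /Y2 => /andP[? ?]; apply: vM; apply/andP; split; lra.
have rv' : recurrent_lower v Y1 Y2.
  by apply: recurrent_lowerW rv; rewrite /Y1 /Y2; lra.
have [C C0 gC] := uniform_gap_bound sv r_gt0 aYr bYr M0 X12 Y12 vM' rv'.
pose B := box X1 X2 Y1 Y2; pose l := ((X2 - X1) * (Y2 - Y1))%R.
have l0 : (0 <= l)%R by apply: mulr_ge0; lra.
have Ml0 : (0 <= M * l)%R by exact: mulr_ge0.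
have Cr0 : (0 <= C / r)%R by rewrite divr_ge0// ltW.
pose C' := (C / r + C + M * l)%R.
have [CC' CrC' ClC' C'0] : [/\ C <= C', C / r <= C', C + M * l <= C' & 0 <= C']%R.
  by rewrite /C'; clear -Cr0 Ml0 C0; split; lra.
exists r, M, C'; split.
  split => //.
    by apply: lt_le_trans a3 _; rewrite lee_fin; lra.
  by apply: le_lt_trans b3; rewrite lee_fin; lra.
move=> d k A krho dr; have [_ rhob _ d0 _] := krho.
have A0 : (0 <= A)%R by have /andP[h1 h2] := rhob 0%R; exact: le_trans h1 h2.
have mB : measurable (B : set mR2) by exact: measurable_box.
have mK : measurable (box x1 x2 y1 y2 : set mR2) by exact: measurable_box.
have svt t := subharmonic_htrans t sv.
have vtM t z : B z -> htrans t v z <= M%:E.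
  by move=> /boxE[_ _ ? ?]; apply: vM' => /=; apply/andP; split; lra.
have mollt t z : htrans t (mollify a b d k v) z = mollify a b d k (htrans t v) z.
  by rewrite (mollify_htrans krho t z sv).
have gfin t : \int[mu2]_z gap B M (htrans t v) z = (fine (\int[mu2]_z gap B M (htrans t v) z))%:E.
  rewrite fineK// ge0_fin_numE; first exact: le_lt_trans (gC t) (ltry _).
  by apply: integral_ge0 => z _; apply: gap_ge0; exact: vtM.
have gfC t : (fine (\int[mu2]_z gap B M (htrans t v) z) <= C)%R.
  by rewrite -lee_fin -gfin; exact: gC.
split.
- move=> z /andP[yz zy].
  have zB : closed_disc (0%R, z.2) d `<=` B.
    by apply: closed_disc_sub_box; [exact: ltW|apply/boxE; rewrite /Y1 /Y2/=; clear -X10 X20 dr d0 yz zy; split; lra].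
  have mE : mollify a b d k v z = mollify a b d k (htrans z.1 v) (0%R, z.2).
    by rewrite (mollify_htrans krho z.1 (0%R, z.2) sv) /= add0r -surjective_pairing.
  have vE : v z = htrans z.1 v (0%R, z.2) by rewrite /htrans/= add0r -surjective_pairing.
  rewrite mE vE; split.
    exact: (mollify_ge krho (svt z.1) aY bY M0 X12 Y12 (vtM z.1) zB).
  have /andP[h1 h2] := mollify_bounds krho (svt z.1) aY bY M0 X12 Y12 (vtM z.1) zB.
  rewrite h2 andbT; apply: le_trans h1.
  rewrite lerD2l lerN2; apply: (ler_wpM2l A0); exact: le_trans (gfC z.1) CC'.
- move=> t; have QB : box (x1 - r - d) (x2 + r + d) (y1 - r - d) (y2 + r + d) `<=` B.
    by apply: sub_box; rewrite /Y1 /Y2; clear -X1x X2x dr d0; lra.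
  have := integral_mollify_sub krho (svt t) aY bY M0 X12 Y12 (vtM t) r_gt0 QB.
  move=> h; apply: (@le_trans _ _ (d / r * C)%:E).
    apply: (@le_trans _ _ (d / r * fine (\int[mu2]_z gap B M (htrans t v) z))%:E).
      apply: le_trans h; rewrite le_eqVlt; apply/orP; left; apply/eqP.
      by apply: eq_integral => z _; rewrite mollt.
    by rewrite lee_fin; apply: ler_wpM2l (gfC t); rewrite divr_ge0// ltW.
  rewrite lee_fin -mulrA; apply: (ler_wpM2l (ltW d0)).
  by rewrite mulrC.
- move=> t; have KB z : box x1 x2 y1 y2 z -> closed_disc z d `<=` B.
    move=> /boxE[H H0 H1 H2]; apply: closed_disc_sub_box; first exact: ltW.
    by apply/boxE; rewrite /Y1 /Y2/=; clear -X1x X2x dr d0 H H0 H1 H2; split; lra.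
  apply/measurable_EFinP.
  apply: (eq_measurable_fun (fun z => M%:E - (fine (average (bump_profile d k) (gap B M (htrans t v)) z))%:E)).
    move=> z; rewrite inE => Kz.
    by rewrite /= mollt (mollifyE krho (svt t) aY bY M0 X12 Y12 (vtM t) (KB _ Kz)) EFinB.
  apply: emeasurable_funB; first exact: measurable_cst.
  apply/measurable_EFinP; apply: measurable_funTS.
  apply: (measurableT_comp (fine_measurable measurableT)).
  apply: (measurable_average krho).
    exact: (measurable_gap_box (svt t) _ _ _ aY bY).
  by move=> z; apply: gap_ge0; exact: vtM.
move=> t; have KB : box (- d) d (y1 - d) (y2 + d) `<=` B.
  by apply: sub_box; rewrite /Y1 /Y2; clear -X10 X20 dr d0; lra.
have mKd : measurable (box (- d) d (y1 - d) (y2 + d) : set mR2) by exact: measurable_box.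
have Bl : mu2 B <= l%:E by rewrite [leLHS]area_box.
have mv : measurable_fun (B : set mR2) (htrans t v).
  by apply: (subharmonic_measurable (svt t)) => //; exact: box_sub_strip.
apply: le_trans (Rintegral_norm_le mKd mB KB Bl M0 mv (vtM t) (gC t)) _; exact: ClC'.
Qed.

End Mollification.

(** * Exponentials and truncated logarithms as Lipschitz functions *)

Section Comparison.
Context {R : realType}.

Lemma expR_lip (M p q : R) : (p <= M)%R -> (q <= M)%R ->
  (`|expR p - expR q| <= expR M * `|p - q|)%R.
Proof.
wlog qp : p q / (q <= p)%R => [H pM qM|pM qM].
  have [qp|pq] := leP q p; first exact: H.
  by rewrite distrC (distrC p); apply: H => //; exact: ltW.
rewrite !ger0_norm ?subr_ge0 ?ler_expR//.
apply: (@le_trans _ _ (expR p * (p - q))%R).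
  by have := expR_tangent p q; lra.
by rewrite ler_wpM2r ?subr_ge0// ler_expR.
Qed.

Lemma ln_sub_le (c s t : R) : (0 < c)%R -> (c <= t)%R -> (t <= s)%R ->
  (ln s - ln t <= c^-1 * (s - t))%R.
Proof.
move=> c0 ct ts; have t0 := lt_le_trans c0 ct; have s0 := lt_le_trans t0 ts.
rewrite -ln_div ?posrE//; have st0 : (0 < s / t)%R by rewrite divr_gt0.
apply: (@le_trans _ _ (s / t - 1)%R).
  move: (s / t)%R st0 => x x0; have x1 : (-1 < x - 1)%R by lra.
  by have := le_ln1Dx x1; rewrite addrC subrK.
rewrite -[X in (_ - X <= _)%R](divff (lt0r_neq0 t0)) -mulrBl mulrC.
by rewrite ler_wpM2r ?subr_ge0// lef_pV2 ?posrE.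
Qed.

Lemma ln_max_lip (c p q : R) : (0 < c)%R ->
  (`|ln (Num.max p c) - ln (Num.max q c)| <= c^-1 * `|p - q|)%R.
Proof.
move=> c0; wlog qp : p q / (q <= p)%R => [H|].
  have [qp|pq] := leP q p; first exact: H.
  by rewrite distrC (distrC p); apply: H => //; exact: ltW.
have cq : (c <= Num.max q c)%R by rewrite le_max lexx orbT.
have qmp : (Num.max q c <= Num.max p c)%R.
  by rewrite ge_max !le_max qp lexx orbT.
have q0 := lt_le_trans c0 cq; have p0 := lt_le_trans q0 qmp.
rewrite ger0_norm; last by rewrite subr_ge0 ler_ln.
rewrite ger0_norm ?subr_ge0//; apply: le_trans (ln_sub_le c0 cq qmp) _.
rewrite ler_wpM2l ?invr_ge0 ?(ltW c0)//.
by case: (leP p c) => ?; case: (leP q c) => ?; lra.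
Qed.

Lemma exp_approx (u V M : R) : (0 <= u)%R -> lne u%:E <= V%:E -> (V <= M)%R ->
  (`|u - expR V|%R)%:E <= (expR M)%:E * (V%:E - lne u%:E).
Proof.
move=> u0 uV VM; have [q|q] := leP u 0%R.
  by rewrite le0_lneNy ?lee_fin//= addey// gt0_muley ?leey// lte_fin expR_gt0.
move: uV; rewrite lne_EFin// lee_fin -EFinB -EFinM lee_fin => uV.
have := expR_lip (le_trans uV VM) VM; rewrite lnK ?posrE// => /le_trans; apply.
by rewrite ler_wpM2l ?expR_ge0// distrC ger0_norm ?subr_ge0.
Qed.

(** Where [u] is small its logarithm is compared with [V], and elsewhere the
    logarithm is Lipschitz. *)
Lemma ln_approx (u U V c : R) : (0 <= u)%R -> (u <= U)%R -> (0 < c)%R ->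
  lne u%:E <= V%:E -> (ln c <= V)%R ->
  (`|fine (lne u%:E) - ln (Num.max U c)|%R)%:E <=
    (V%:E - lne u%:E) + (c^-1 * (U - u))%:E.
Proof.
move=> u0 uU c0 uV cV; have [q|q] := leP u 0%R.
  by rewrite le0_lneNy ?lee_fin//= addey// addye// leey.
move: uV; rewrite lne_EFin// lee_fin -EFinB -EFinD lee_fin /= => uV.
have cm : (c <= Num.max u c)%R by rewrite le_max lexx orbT.
have mU : (Num.max u c <= Num.max U c)%R by rewrite ge_max !le_max uU lexx orbT.
have um : (u <= Num.max u c)%R by rewrite le_max lexx.
have m0 := lt_le_trans c0 cm; have U0 := lt_le_trans m0 mU.
rewrite distrC ger0_norm; last by rewrite subr_ge0 ler_ln// (le_trans um).
have h1 := ln_sub_le c0 cm mU.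
have h2 : (c^-1 * (Num.max U c - Num.max u c) <= c^-1 * (U - u))%R.
  rewrite ler_wpM2l ?invr_ge0 ?(ltW c0)//.
  by case: (leP U c) => ?; case: (leP u c) => ?; lra.
have h3 : (ln (Num.max u c) <= V)%R by case: (leP u c).
by lra.
Qed.

Lemma small_scale (r eps q : R) : (0 < r)%R -> (0 < eps)%R -> (0 <= q)%R ->
  exists2 d : R, (0 < d)%R & (d <= r)%R /\ (d * q <= eps)%R.
Proof.
move=> r0 eps0 q0; exists (Num.min r (eps / (q + 1)))%R.
  by rewrite lt_min r0 divr_gt0// ltr_wpDl.
split; first by rewrite ge_min lexx.
have q1 : (0 < q + 1)%R by rewrite ltr_wpDl.
apply: (@le_trans _ _ (eps / (q + 1) * (q + 1))%R); last by rewrite divfK// gt_eqF.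
apply: ler_pM => //.
- by rewrite le_min (ltW r0) divr_ge0// ltW.
- by rewrite ge_min lexx orbT.
- by rewrite lerDl.
Qed.

End Comparison.

(** * Almost periodicity of a function and of its logarithm *)

Section AlmostPeriodicLog.
Context {R : realType}.
Local Notation mu2 := (@lebesgue_measure R \x @lebesgue_measure R)%E.
Local Notation mR := (measurableTypeR R).
Local Notation mR2 := (mR * mR)%type.
Variables (a b : \bar R).
Local Notation S := (strip a b).

(** The boxes may be enlarged, so only those which reach the heights [c] and [e] have to
    be considered; this leaves the choice of a level at which [v] is known to be
    recurrent. *)
Lemma WAP_of_approx (v : R * R -> \bar R) (c e : R) : subharmonic S v ->
  a < c%:E -> e%:E < b -> (c <= e)%R ->
  (forall x1 x2 y1 y2 eps : R, a < y1%:E -> y2%:E < b -> (x1 <= x2)%R ->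
    (y1 <= c)%R -> (e <= y2)%R -> (0 < eps)%R -> exists G : R * R -> R, [/\
    forall t, measurable_fun (box x1 x2 y1 y2 : set mR2) (htrans t G : mR2 -> mR),
    exists B, forall z, (y1 <= z.2 <= y2)%R -> (`|G z| <= B)%R,
    forall t, \int[mu2]_(z in box x1 x2 y1 y2)
      (`|fine (htrans t v z) - htrans t G z|%R)%:E <= eps%:E &
    finitely_coloured (fun s t => forall z : R * R, (y1 <= z.2 <= y2)%R ->
      `|G (z.1 + s, z.2) - G (z.1 + t, z.2)| <= eps)%R]) ->
  WAP S v.
Proof.
move=> sv ac eb ce H; split => // phi tphi.
have [x1 [x2 [y1 [y2 [bphi [[ay yb] [x12 [yc ey]]]]]]]] : exists x1 x2 y1 y2 : R,
    bumpfun x1 x2 y1 y2 phi /\ (a < y1%:E /\ y2%:E < b) /\ (x1 <= x2)%R /\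
    (y1 <= c)%R /\ (e <= y2)%R.
  have [x1 [x2 [y1 [y2 [[bphi x12 y12 ay yb]|phi0]]]]] := test_function_bumpfun tphi.
    exists x1, x2, (Num.min y1 c), (Num.max y2 e); split.
      split; first exact: bphi.1.
      move=> z nz; apply: bphi.2 => zb; apply: nz.
      by apply: sub_box zb; rewrite ?ge_min ?le_max lexx.
    split; last by split => //; split; rewrite ?ge_min ?le_max lexx orbT.
    by rewrite /Num.min /Num.max; case: ifP => _; case: ifP => _.
  exists 0%R, 0%R, c, e; split => //; split; last by move=> z _; exact: phi0.
  by move=> k; apply: smooth_Cks; case: tphi.
have y12 : (y1 <= y2)%R by exact: le_trans yc (le_trans ce ey).
apply: totally_ap_bohr; first exact: translate_pairing_continuous sv bphi ay yb x12 y12.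
apply: (totally_ap_approx sv bphi ay yb x12 y12) => eps eps0.
exact: H.
Qed.

(** A large mollified value forces a large value nearby. *)
Lemma mollify_recurrent (v : R * R -> \bar R) (d k A y L m : R) :
  subharmonic S v -> radial_kernel d A (bump_profile d k) ->
  a < (y - d)%:E -> (y + d)%:E < b ->
  (forall t, exists2 s, (`|s - t| <= L)%R & (- m <= mollify a b d k v (s, y))%R) ->
  forall eps, (0 < eps)%R -> forall t, exists z : R * R,
    [/\ (`|z.1 - t| <= L + d)%R, (y - d <= z.2 <= y + d)%R & (- m - eps)%:E <= v z].
Proof.
move=> sv krho ayd ybd H eps eps0 t; have [s st ms] := H t.
have [_ _ _ d0 _] := krho.
have [p pd vp] := mollify_point krho sv (z := (s, y)) ayd ybd eps0.
have := closed_disc_sub_sq (ltW d0) pd; rewrite /sq => /boxE/= [p1 p2 p3 p4].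
exists p; split.
- move: st; rewrite !ler_norml => /andP[? ?]; apply/andP; split; lra.
- by apply/andP.
- by apply: le_trans vp; rewrite lee_fin lerD2r.
Qed.

Variable u : R * R -> R.
Hypothesis lu : log_subharmonic S u.
Local Notation v := (fun z => lne (u z)%:E).
Local Notation U := (fun z => (u z)%:E).

(** [exp V] approximates [u], where [V] is a mollification of [log u]. *)
Lemma WAP_of_WAP_log : WAP S v -> WAP S U.
Proof.
move=> wv; have su := log_subharmonic_subharmonic lu; have [u0 sv] := lu.
have [_ [z0 [az0 z0b] _] _ _] := sv.
have [d0 d00 [ad0 d0b]] := strip_margin az0 z0b.
have rv : recurrent_lower v (z0.2 - d0)%R (z0.2 + d0)%R.
  have [k [A krho]] := exists_radial_kernel d00.
  have [B BP] := bohr_bounded (WAP_bohr wv (bumpfun_bump_at krho z0.2) ad0 d0b).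
  exists (0 + d0)%R, (B + 1)%R => t; rewrite opprD.
  apply: (mollify_recurrent (L := 0%R) (m := B) sv krho ad0 d0b) => // s.
  exists s; first by rewrite subrr normr0.
  by have := BP s; rewrite ler_norml => /andP[].
have c12 : (z0.2 - d0 <= z0.2 + d0)%R by lra.
apply: (WAP_of_approx su ad0 d0b c12) => x1 x2 y1 y2 eps ay yb x12 yc ey eps0.
have y12 : (y1 <= y2)%R by exact: le_trans yc (le_trans c12 ey).
have [r [M [C [[r0 M0 C0 ar br] P]]]] := uniform_mollification sv ay yb x12 y12
  (fun c e => @WAP_upper_bound _ _ _ _ c e wv) (recurrent_lowerW yc ey rv).
have E0 : (0 <= expR M * C)%R by rewrite mulr_ge0 ?expR_ge0.
have [d d0' [dr dC]] := small_scale r0 eps0 E0.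
have [k [A krho]] := exists_radial_kernel d0'.
have [Vb VI Vm Vn] := P d k A krho dr.
have Kz t z : box x1 x2 y1 y2 z -> (y1 <= (z.1 + t, z.2)%R.2 <= y2)%R.
  by move=> /boxE[_ _ ? ?]; apply/andP.
have mK : measurable (box x1 x2 y1 y2 : set mR2) by exact: measurable_box.
pose V := mollify a b d k v.
exists (fun z => expR (V z)); split.
- by move=> t; apply: (measurableT_comp (@measurable_expR R)); exact: Vm.
- exists (expR M) => z yz; rewrite ger0_norm ?expR_ge0// ler_expR.
  by have [_ /andP[]] := Vb z yz.
- move=> t.
  have mv : measurable_fun (box x1 x2 y1 y2 : set mR2) (htrans t v).
    by apply: (subharmonic_measurable (subharmonic_htrans t sv)) => //; exact: box_sub_strip.
  have mu' : measurable_fun (box x1 x2 y1 y2 : set mR2) (htrans t U).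
    by apply: (subharmonic_measurable (subharmonic_htrans t su)) => //; exact: box_sub_strip.
  have mV := Vm t; have meV : measurable_fun (box x1 x2 y1 y2 : set mR2)
      (fun z => (htrans t V z)%:E) by exact/measurable_EFinP.
  have mVv : measurable_fun (box x1 x2 y1 y2 : set mR2)
      (fun z => (htrans t V z)%:E - htrans t v z) by exact: emeasurable_funB.
  have p0 z : box x1 x2 y1 y2 z -> 0 <= (htrans t V z)%:E - htrans t v z.
    by move=> zK; rewrite sube_ge0 ?orbT//; exact: (Vb _ (Kz t z zK)).1.
  have eM0 : 0 <= (expR M)%:E by rewrite lee_fin expR_ge0.
  apply: (@le_trans _ _ (\int[mu2]_(z in box x1 x2 y1 y2)
      ((expR M)%:E * ((htrans t V z)%:E - htrans t v z)))).
    apply: ge0_le_integral.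
    - exact: mK.
    - by move=> z _; rewrite lee_fin.
    - apply/measurable_EFinP; apply: measurableT_comp => //; apply: measurable_funB.
        by apply: (measurableT_comp _ mu'); exact: fine_measurable.
      exact: (measurableT_comp (@measurable_expR R) mV).
    - exact: measurable_funeM.
    move=> z zK; have [h1 /andP[_ h2]] := Vb _ (Kz t z zK).
    have Sz : S (z.1 + t, z.2)%R := box_sub_strip ay yb zK.
    exact: exp_approx (u0 _ Sz) h1 h2.
  rewrite (ge0_integralZl mu2 mK mVv p0 eM0).
  apply: le_trans (lee_wpmul2l eM0 (VI t)) _.
  by rewrite -EFinM lee_fin mulrCA.
have e1 : (0 < eps / expR M)%R by rewrite divr_gt0// expR_gt0.
have ayd : a < (y1 - d)%:E by apply: lt_le_trans ar _; rewrite lee_fin; lra.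
have ybd : (y2 + d)%:E < b by apply: le_lt_trans br; rewrite lee_fin; lra.
apply: finitely_coloured_sub (mollify_coloured krho wv ayd ybd y12 C0 e1 Vn).
move=> s t st z yz.
have [_ /andP[_ h1]] := Vb (z.1 + s, z.2)%R yz; have [_ /andP[_ h2]] := Vb (z.1 + t, z.2)%R yz.
apply: le_trans (expR_lip h1 h2) _.
by rewrite mulrC -ler_pdivlMr ?expR_gt0//; exact: st.
Qed.

(** [u] is positive at [z0], hence so is its mollification there; this positive value
    nearly recurs at bounded distances, because finitely many translates suffice. *)
Lemma log_recurrent_of_WAP z0 : WAP S U -> S z0 -> v z0 != -oo ->
  forall d, (0 < d)%R -> a < (z0.2 - d)%:E -> (z0.2 + d)%:E < b ->
  recurrent_lower v (z0.2 - d) (z0.2 + d).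
Proof.
move=> wu Sz0 vz0 d d0 ad db; have [su _] := wu; have [u0 _] := lu.
have uz0 : (0 < u z0)%R by rewrite ltNge; apply: contra vz0 => q; rewrite le0_lneNy ?lee_fin.
have [k [A krho]] := exists_radial_kernel d0.
have tF := bohr_totally_ap (WAP_bohr wu (bumpfun_bump_at krho z0.2) ad db).
pose F t := mollify a b d k U (t, z0.2).
have x12 : (z0.1 - d <= z0.1 + d)%R by lra.
have y12 : (z0.2 - d <= z0.2 + d)%R by lra.
have [M M0 uM] := subharmonic_box_bounded su (z0.1 - d) (z0.1 + d) ad db.
have Fz0 : (u z0 <= F z0.1)%R.
  rewrite -lee_fin /F -surjective_pairing.
  exact: (mollify_ge krho su ad db M0 x12 y12 uM (closed_disc_sub_sq (ltW d0))).
pose K := F z0.1; have K0 : (0 < K)%R := lt_le_trans uz0 Fz0.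
have K2 : (0 < K / 2)%R by lra.
have [L LP] := finitely_coloured_net (tF _ K2).
(* [s] makes the translate by [s] close to the translate by [z0.1 - t]; at [t] the
   latter takes the value [K]. *)
have H t : exists2 s, (`|s - t| <= L)%R & (- - (K / 2) <= mollify a b d k U (s, z0.2))%R.
  have [s sL sF] := LP (z0.1 - t)%R.
  exists (t + s)%R; first by rewrite addrC addKr.
  have := sF t; rewrite (_ : t + (z0.1 - t) = z0.1)%R; last by ring.
  rewrite ler_norml => /andP[+ _].
  rewrite -[translate_pairing S U _ z0.1]/K.
  rewrite -[translate_pairing S U _ (t + s)%R]/(mollify a b d k U (t + s, z0.2))%R.
  by rewrite opprK; move: (mollify _ _ _ _ _ _) => q; lra.
have K4 : (0 < K / 4)%R by lra.
exists (L + d)%R, (- ln (K / 4))%R => t.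
have [z [z1 z2 uz]] := mollify_recurrent su krho ad db H K4 t.
exists z; split => //; rewrite opprK.
have Ku : (K / 4 <= u z)%R by move: uz; rewrite lee_fin; lra.
by rewrite lne_EFin ?lee_fin ?ler_ln ?posrE// (lt_le_trans K4 Ku).
Qed.

(** [log (max U c)] approximates [log u], where [U] is a mollification of [u]. *)
Lemma WAP_log_of_WAP : WAP S U -> WAP S v.
Proof.
move=> wu; have [su _] := wu; have [u0 sv] := lu.
have [_ [z0 Sz0 vz0] _ _] := sv; have [az0 z0b] := Sz0.
have [d0 d00 [ad0 d0b]] := strip_margin az0 z0b.
have rv := log_recurrent_of_WAP wu Sz0 vz0 d00 ad0 d0b.
have c12 : (z0.2 - d0 <= z0.2 + d0)%R by lra.
have ru : recurrent_lower U (z0.2 - d0)%R (z0.2 + d0)%R.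
  exists 0%R, 0%R => t; exists (t, z0.2); rewrite /= subrr normr0 oppr0; split => //.
    by apply/andP; split; lra.
  by rewrite lee_fin; exact: u0.
(* [log u <= u]. *)
have ub (c e : R) : a < c%:E -> e%:E < b -> (c <= e)%R ->
    exists2 M : R, (0 <= M)%R & forall z, (c <= z.2 <= e)%R -> v z <= M%:E.
  move=> ac eb ce; have [M M0 uM] := WAP_upper_bound wu ac eb ce.
  exists M => // z yz; apply: le_trans (uM z yz).
  have [q|q] := leP (u z) 0%R; first by rewrite le0_lneNy ?lee_fin// leNye.
  by rewrite lne_EFin// lee_fin; exact: ltW (ln_sublinear q).
apply: (WAP_of_approx sv ad0 d0b c12) => x1 x2 y1 y2 eps ay yb x12 yc ey eps0.
have y12 : (y1 <= y2)%R by exact: le_trans yc (le_trans c12 ey).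
have eps2 : (0 < eps / 2)%R by lra.
have [r [M [C [[r0 M0 C0 ar br] P]]]] := uniform_mollification sv ay yb x12 y12
  ub (recurrent_lowerW yc ey rv).
have [d1 d10 [d1r d1C]] := small_scale r0 eps2 C0.
have [k1 [A1 krho1]] := exists_radial_kernel d10.
have [Vb VI Vm _] := P d1 k1 A1 krho1 d1r.
(* The truncation level comes from a first mollification, of [log u]; it is fixed
   before the radius of the second one, of [u]. *)
pose c := expR (M - A1 * C)%R; have c0 : (0 < c)%R by exact: expR_gt0.
have ci0 : (0 <= c^-1)%R by rewrite invr_ge0 ltW.
have [r' [M' [C' [[r'0 M'0 C'0 ar' br'] P']]]] := uniform_mollification su ay yb x12 y12
  (fun c e => @WAP_upper_bound _ _ _ _ c e wu) (recurrent_lowerW yc ey ru).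
have [d2 d20 [d2r d2C]] := small_scale r'0 eps2 (mulr_ge0 ci0 C'0).
have [k2 [A2 krho2]] := exists_radial_kernel d20.
have [Wb WI Wm Wn] := P' d2 k2 A2 krho2 d2r.
pose V := mollify a b d1 k1 v; pose W := mollify a b d2 k2 U.
pose Q := box x1 x2 y1 y2.
have Kz t z : Q z -> (y1 <= (z.1 + t, z.2)%R.2 <= y2)%R.
  by move=> /boxE[_ _ ? ?]; apply/andP.
have mQ : measurable (Q : set mR2) by exact: measurable_box.
have mG t : measurable_fun (Q : set mR2)
    (htrans t (fun z => ln (Num.max (W z) c)) : mR2 -> mR).
  apply: (measurableT_comp (@measurable_ln R)); apply: measurable_maxr; first exact: Wm.
  exact: measurable_cst.
exists (fun z => ln (Num.max (W z) c)); split => //.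
- exists (`|ln c| + (M' + c))%R => z yz; have [_ /andP[_ WM]] := Wb z yz.
  have cm : (c <= Num.max (W z) c)%R by rewrite le_max lexx orbT.
  have m0 := lt_le_trans c0 cm.
  have mM : (Num.max (W z) c <= M' + c)%R.
    by rewrite ge_max lerDr M'0 andbT; apply: le_trans WM _; rewrite lerDl ltW.
  have h1 := ltW (ln_sublinear m0).
  have h2 : (ln c <= ln (Num.max (W z) c))%R by rewrite ler_ln.
  move: h1 h2 mM; move: (Num.max _ _) (ln _) => m lm h1 h2 mM.
  have h3 := ler_norm (- ln c)%R; rewrite normrN in h3.
  have h4 := normr_ge0 (ln c).
  by clear -h1 h2 mM h3 h4 M'0 c0; rewrite ler_norml; apply/andP; split; lra.
- move=> t.
  have mv : measurable_fun (Q : set mR2) (htrans t v).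
    by apply: (subharmonic_measurable (subharmonic_htrans t sv)) => //; exact: box_sub_strip.
  have mu' : measurable_fun (Q : set mR2) (htrans t U).
    by apply: (subharmonic_measurable (subharmonic_htrans t su)) => //; exact: box_sub_strip.
  have meV : measurable_fun (Q : set mR2) (fun z => (htrans t V z)%:E).
    by apply/measurable_EFinP; exact: Vm.
  have meW : measurable_fun (Q : set mR2) (fun z => (htrans t W z)%:E).
    by apply/measurable_EFinP; exact: Wm.
  have mVv : measurable_fun (Q : set mR2)
      (fun z => (htrans t V z)%:E - htrans t v z).
    by apply: emeasurable_funB; [exact: meV|exact: mv].
  have mWu : measurable_fun (Q : set mR2)
      (fun z => (htrans t W z)%:E - htrans t U z).
    by apply: emeasurable_funB; [exact: meW|exact: mu'].
  have p0 z : Q z -> 0 <= (htrans t V z)%:E - htrans t v z.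
    by move=> zQ; rewrite sube_ge0 ?orbT//; exact: (Vb _ (Kz t z zQ)).1.
  have q0 z : Q z -> 0 <= (htrans t W z)%:E - htrans t U z.
    by move=> zQ; rewrite sube_ge0 ?orbT//; exact: (Wb _ (Kz t z zQ)).1.
  have ce0 : 0 <= (c^-1)%:E by rewrite lee_fin.
  have q0' z : Q z -> 0 <= (c^-1)%:E * ((htrans t W z)%:E - htrans t U z).
    by move=> zQ; exact: mule_ge0 ce0 (q0 z zQ).
  have mWu' := measurable_funeM (c^-1)%:E mWu.
  apply: (@le_trans _ _ (\int[mu2]_(z in Q) (((htrans t V z)%:E - htrans t v z) +
      (c^-1)%:E * ((htrans t W z)%:E - htrans t U z)))).
    apply: ge0_le_integral.
    - exact: mQ.
    - by move=> z _; rewrite lee_fin.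
    - apply/measurable_EFinP; apply: measurableT_comp => //; apply: measurable_funB; last exact: mG.
      by apply: (measurableT_comp _ mv); exact: fine_measurable.
    - by apply: emeasurable_funD; [exact: mVv|apply: measurable_funeM; exact: mWu].
    move=> z zQ; have [h1 /andP[h2 _]] := Vb _ (Kz t z zQ).
    have [h3 _] := Wb _ (Kz t z zQ).
    have Sz : S (z.1 + t, z.2)%R := box_sub_strip ay yb zQ.
    have h4 : (ln c <= mollify a b d1 k1 v (z.1 + t, z.2))%R.
      by rewrite /c expRK; exact: h2.
    exact: (ln_approx (u0 _ Sz) h3 c0 h1 h4).
  rewrite (ge0_integralD mu2 mQ p0 mVv q0' mWu') (ge0_integralZl mu2 mQ mWu q0 ce0).
  apply: (@le_trans _ _ ((d1 * C)%:E + (c^-1)%:E * (d2 * C')%:E)).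
    exact: leeD (VI t) (lee_wpmul2l ce0 (WI t)).
  by rewrite -EFinM -EFinD lee_fin mulrCA; clear -d1C d2C; lra.
have e1 : (0 < eps * c)%R by rewrite mulr_gt0.
have ayd : a < (y1 - d2)%:E by apply: lt_le_trans ar' _; rewrite lee_fin lerD2l lerN2.
have ybd : (y2 + d2)%:E < b by apply: le_lt_trans br'; rewrite lee_fin lerD2l.
apply: finitely_coloured_sub (mollify_coloured krho2 wu ayd ybd y12 C'0 e1 Wn).
move=> s t st z yz; apply: le_trans (ln_max_lip _ _ c0) _.
by rewrite mulrC ler_pdivrMr//; exact: st.
Qed.

End AlmostPeriodicLog.

Theorem theorem2 (R : realType) (a b : \bar R) (u : R * R -> R) :
  (a < b)%E ->
  log_subharmonic (strip a b) u ->
  (WAP (strip a b) (fun z => lne (u z)%:E) <->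
   WAP (strip a b) (fun z => (u z)%:E)).
Proof.
by move=> _ lu; split; [exact: WAP_of_WAP_log|exact: WAP_log_of_WAP].
Qed.
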